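(* Let $F\in\mathrm{Perv}_\Sigma(\mathbb C_{\mathbb V})$ be a perverse sheaf with quiver $Q_\Sigma^{(\alpha,\beta)}(F)=(\Psi,\Phi_c,u_c,v_c)_{c\in\Sigma}$. With $\Sigma=\{c_1<_\beta\cdots<_\beta c_n\}$, write $u_i=u_{c_i}$, $v_i=v_{c_i}$, $\mathbb T_i=1-u_iv_i\in\mathrm{End}(\Phi_{c_i})$ and $\mathrm T_i=1-v_iu_i\in\mathrm{End}(\Psi)$. Let $K$ be the enhanced Fourier-Sato transform of $F$. Then the Stokes multipliers $S_{\pm\beta}\in\mathrm{End}(\bigoplus_{i=1}^n\Phi_{c_i})$ of $K$ at $\infty$ are given by the block triangular matrices $$S_\beta=\begin{pmatrix}1&u_1v_2&u_1v_3&\cdots&u_1v_n\\&1&u_2v_3&\cdots&u_2v_n\\&&\ddots&&\vdots\\&&&&1\end{pmatrix},\qquad S_{-\beta}=\begin{pmatrix}\mathbb T_1\\-u_2v_1&\mathbb T_2\\-u_3v_1&-u_3v_2&\ddots\\\vdots&\vdots&&\ddots\\-u_nv_1&-u_nv_2&\cdots&-u_nv_{n-1}&\mathbb T_n\end{pmatrix}.$$ In particular $S_\beta^{-1}S_{-\beta}=\mathbb T_\Sigma$, where $\mathbb T_\Sigma:=1-U_\Sigma V_\Sigma$ (the monodromy of $\Phi_\Sigma=\bigoplus_i\Phi_{c_i}$ around $\infty$), with $U_\Sigma={}^t(U_1,\dots,U_n):\Psi\to\Phi_\Sigma$, $U_i=u_i\mathrm T_{i+1}\mathrm T_{i+2}\cdots\mathrm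 T_n$, and $V_\Sigma=(v_1,\dots,v_n):\Phi_\Sigma\to\Psi$.
   Context: **Perverse sheaves and quivers.** Let $\mathbf k$ be a field (here $\mathbf k=\mathbb C$), $\mathbb V$ a one-dimensional complex vector space (the affine line), $\mathbb V^*$ its dual, $\langle z,w\rangle=zw$ the pairing, $\Sigma\subset\mathbb V$ finite. For $S$ locally closed, $\mathbf k_S$ is the extension by zero of the constant sheaf on $S$. $D^b_{\mathbb C\text{-}c}(\mathbf k_{\mathbb V},\Sigma)$ is the bounded derived category of complexes with cohomology constructible for the stratification $(\mathbb V\setminus\Sigma,\Sigma)$; $\mathrm{Perv}_\Sigma(\mathbf k_{\mathbb V})$ is the heart of its middle perversity t-structure ($\mathbf k_{\mathbb V}[1]$ and $\mathbf k_\Sigma$ are perverse). Fix nonzero $\alpha\in\mathbb V$, $\beta\in\mathbb V^*$ with $\mathrm{Re}\langle\alpha,\beta\rangle=0$ and $\mathrm{Re}\langle c-c',\beta\rangle\ne0$ for $c\neq c'$ in $\Sigma$. Put $p_\beta(z)=\mathrm{Re}\langle z,\beta\rangle$; order $\Sigma$ by $c<_\beta c'$ iff $p_\beta(c)<p_\beta(c')$; write $c_1<_\beta\dots<_\beta c_n$, $r_i=p_\beta(c_i)$, $r_0=-\infty$, $r_{n+1}=+\infty$. For $c=c_i$: $B_c=p_\beta^{-1}((r_{i-1},r_{i+1}))$, $B_c^>=p_\beta^{-1}((r_i,r_{i+1}))$, $B_c^{\ge}=p_\beta^{-1}([r_i,r_{i+1}))$, $B_c^{\le}=p_\beta^{-1}((r_{i-1},r_i])$,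 $\ell_c=\ell_c(\alpha)=c+\mathbb R_{\ge0}\alpha$, $\ell_c^\times=c+\mathbb R_{>0}\alpha$, $\ell_\Sigma=\bigcup_c\ell_c$. Define $\Psi_c(F)=R\Gamma_c(\mathbb V;\mathbf k_{\ell_c^\times}\otimes F)$, $\Phi_c(F)=\Phi_c^{(\alpha,\beta)}(F)=R\Gamma_c(\mathbb V;\mathbf k_{\ell_c}\otimes F)$, $\Psi(F)=R\Gamma_c(\mathbb V;\mathbf k_{\mathbb V\setminus\ell_\Sigma}\otimes F)[1]$ (concentrated in degree $0$ for $F$ perverse). $u_{cc}:\Psi_c(F)\to\Phi_c(F)$ is induced by $\mathbf k_{\ell_c^\times}\to\mathbf k_{\ell_c}$. There are isomorphisms $\Psi_c(F)\xrightarrow{\sim}R\Gamma_c(\mathbb V;\mathbf k_{B_c^>}\otimes F)[1]\xrightarrow{\sim}R\Gamma_c(\mathbb V;\mathbf k_{B_c\setminus\ell_c}\otimes F)[1]$ (connecting map of $0\to\mathbf k_{B_c^>}\to\mathbf k_{B_c^>\cup\ell_c^\times}\to\mathbf k_{\ell_c^\times}\to0$, then the map induced by $\mathbf k_{B_c^>}\to\mathbf k_{B_c\setminus\ell_c}$). $v_{cc}:\Phi_c(F)\to R\Gamma_c(\mathbb V;\mathbf k_{B_c\setminus\ell_c}\otimes F)[1]\simeq\Psi_c(F)$ is the connecting map of $0\to\mathbf k_{B_c\setminus\ell_c}\to\mathbf k_{B_c}\to\mathbf k_{\ell_c}\to0$. Composing with the isomorphism induced by $\mathbf k_{B_c\setminus\ell_c}\to\mathbf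 k_{\mathbb V\setminus\ell_\Sigma}$ gives $\theta_c:\Psi_c(F)\xrightarrow{\sim}\Psi(F)$. Set $u_c=u_{cc}\theta_c^{-1}$, $v_c=\theta_cv_{cc}$, and $Q_\Sigma^{(\alpha,\beta)}(F)=(\Psi(F),\Phi_c(F),u_c,v_c)_{c\in\Sigma}$. **Enhanced sheaves.** For a manifold $M$, let $\pi:M\times\mathbb R\to M$, $t\in\mathbb R$ the coordinate, $E^b(\mathbf k_M)=D^b(\mathbf k_{M\times\mathbb R})/\pi^{-1}D^b(\mathbf k_M)$ with quotient functor $\mathsf Q$. $E^b(\mathrm I\mathbf k_M)$ is D'Agnolo–Kashiwara's category of enhanced ind-sheaves (defined also for bordered spaces), $\overset{+}{\otimes}$ its convolution product, $\mathbf k_M^{\mathsf E}=\text{``}\varinjlim_{a\to+\infty}\text{''}\,\mathsf Q\mathbf k_{\{t\ge a\}}$. $\mathbb V^*_\infty=(\mathbb V^*,\mathbb P^* )$ is the bordered space given by the projective compactification $\mathbb P^*$ of $\mathbb V^*$. Set $E^{\varphi}=\mathbf k_{\{t+\mathrm{Re}\,\varphi\ge0\}}$ and $\mathbb E^\varphi=\mathbf k^{\mathsf E}\overset{+}{\otimes}\mathsf QE^\varphi$. With $\tilde q:\mathbb V\times\mathbb V^*\times\mathbb R\to\mathbb V^*\times\mathbb R$, $\bar p:\mathbb V\times\mathbb V^*\times\mathbb R\to\mathbb V$ the projections, set $\mathcal K=R\tilde q_!(\mathbf k_{\{t+\mathrm{Re}\,zw\ge0\}}\otimes\bar p^{-1}F)$.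 The enhanced Fourier-Sato transform of $F$ is $K=\mathbf k^{\mathsf E}_{\mathbb V^*_\infty}\overset{+}{\otimes}\mathsf Q\mathcal K\in E^b(\mathrm I\mathbf k_{\mathbb V^*_\infty})$. **Stokes multipliers.** Let $H_{\pm\alpha}=\{w\in\mathbb V^*\setminus\{0\}:\pm\mathrm{Re}\langle\alpha,w\rangle\ge0\}$ and $h_{\pm\beta}=\pm\mathbb R_{>0}\beta$, so $H_\alpha\cap H_{-\alpha}=h_\beta\cup h_{-\beta}$. Let $L_c(\pm\alpha)=\ell_c(\pm\alpha)\times\{(w,t):t+\mathrm{Re}\,cw\ge0\}$ and $\Phi_c^{(\pm\alpha,\beta)}(F)=R\Gamma_c(\mathbb V;\mathbf k_{\ell_c(\pm\alpha)}\otimes F)$. Over $H_{\pm\alpha}$, the restriction map $\mathbf k_{\{t+\mathrm{Re}\,zw\ge0\}}\to\bigoplus_c\mathbf k_{L_c(\pm\alpha)}$, after tensoring with $\bar p^{-1}F$ and applying $R\tilde q_!$, induces an isomorphism $s_{\pm\alpha}:\pi^{-1}\mathbf k_{H_{\pm\alpha}}\otimes\mathcal K\xrightarrow{\sim}\pi^{-1}\mathbf k_{H_{\pm\alpha}}\otimes\bigoplus_c\Phi_c^{(\pm\alpha,\beta)}(F)\otimes E^{cw}$. The closed embeddings $\ell_c(\pm\alpha)\subset B_c^{\ge}$ induce isomorphisms $R\Gamma_c(\mathbb V;\mathbf k_{B_c^\ge}\otimes F)\xrightarrow{\sim}\Phi_c^{(\pm\alpha,\beta)}(F)$, whence an isomorphism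 $\tau:\Phi_c^{(-\alpha,\beta)}(F)\xrightarrow{\sim}\Phi_c^{(\alpha,\beta)}(F)=\Phi_c$. Set $\sigma_{\pm\beta}=\tau\circ(s_{-\alpha}|_{h_{\pm\beta}})\circ(s_\alpha|_{h_{\pm\beta}})^{-1}$, an automorphism of $\pi^{-1}\mathbf k_{h_{\pm\beta}}\otimes\bigoplus_c\Phi_c\otimes E^{cw}$ in $E^b(\mathbf k_{\mathbb V^*_\infty})$ (equivalently, after applying $\mathbf k^{\mathsf E}\overset{+}{\otimes}\cdot$, with $K$ and $\mathbb E^{cw}$ in place of $\mathcal K$ and $E^{cw}$). For $c\ne d$, $\mathrm{Hom}(\pi^{-1}\mathbf k_{h_{\pm\beta}}\otimes\Phi_c\otimes E^{cw},\pi^{-1}\mathbf k_{h_{\pm\beta}}\otimes\Phi_d\otimes E^{dw})$ is canonically $\mathrm{Hom}_{\mathbf k}(\Phi_c,\Phi_d)$ if $\pm\mathrm{Re}\langle c-d,\beta\rangle>0$, and $0$ if $\pm\mathrm{Re}\langle c-d,\beta\rangle<0$; for $c=d$ it is $\mathrm{End}(\Phi_c)$. So $\sigma_{\pm\beta}$ is given by a block matrix $S_{\pm\beta}\in\mathrm{End}(\bigoplus_i\Phi_{c_i})$, block upper triangular for $+\beta$ and block lower triangular for $-\beta$, called the Stokes multiplier; its $(i,j)$ block is a map $\Phi_{c_j}\to\Phi_{c_i}$. *)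

(* Defs.v *)
From Stdlib Require Import Relation_Operators.
From HB Require Import structures.
From mathcomp Require Import all_boot all_order all_algebra.
From mathcomp Require Import generic_quotient ring_quotient.
From mathcomp Require Import all_classical all_reals.
From mathcomp Require Import complex topology normedtype.
From mathcomp Require Import zify.
Set Implicit Arguments.
Unset Strict Implicit.
Unset Printing Implicit Defensive.
Import Order.TTheory GRing.Theory Num.Theory.
Import numFieldNormedType.Exports.
Local Open Scope classical_set_scope.
Local Open Scope ring_scope.

Section VectorSpaces.
Variable k : fieldType.

Record subsp (E : lmodType k) := Subsp {
  sub_mem :> E -> Prop;
  sub_mem0 : sub_mem 0;
  sub_memP : forall a u v, sub_mem u -> sub_mem v -> sub_mem (a *: u + v) }.

Definition sub_pred (E : lmodType k) (P : subsp E) : {pred E} :=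
  fun x => `[< P x >].

Lemma sub_pred_closed (E : lmodType k) (P : subsp E) :
  submod_closed (sub_pred P).
Proof.
split; first exact/asboolP/sub_mem0.
by move=> a u v /asboolP Pu /asboolP Pv; apply/asboolP/sub_memP.
Qed.

HB.instance Definition _ (E : lmodType k) (P : subsp E) :=
  GRing.isSubmodClosed.Build k E (sub_pred P) (sub_pred_closed P).

Record subT (E : lmodType k) (P : subsp E) :=
  SubT { subv : E; subvP : subv \in sub_pred P }.

HB.instance Definition _ (E : lmodType k) (P : subsp E) :=
  [isSub for @subv E P].
HB.instance Definition _ (E : lmodType k) (P : subsp E) :=
  [Choice of subT P by <:].
HB.instance Definition _ (E : lmodType k) (P : subsp E) :=
  [SubChoice_isSubLmodule of subT P by <:].

Definition quoT (E : lmodType k) (P : subsp E) : Type :=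
  Quotient.quot (sub_pred P).
HB.instance Definition _ (E : lmodType k) (P : subsp E) :=
  GRing.Zmodule.on (quoT P).

Section QuotientScale.
Variables (E : lmodType k) (P : subsp E).
Definition quo_pi (x : E) : quoT P := (\pi_(Quotient.quot (sub_pred P)) x)%qT.

Lemma quo_piE x y : quo_pi x = quo_pi y <-> P (x - y).
Proof.
split=> [/eqP|h].
  by rewrite /quo_pi -Quotient.idealrBE => /asboolP.
by apply/eqP; rewrite /quo_pi -Quotient.idealrBE; apply/asboolP.
Qed.

Lemma quo_piD : {morph quo_pi : x y / x + y}.
Proof. by move=> x y; rewrite /quo_pi Quotient.pi_add. Qed.

Lemma quo_pi_surj q : exists x, quo_pi x = q.
Proof. by exists (repr q); rewrite /quo_pi reprK. Qed.

Definition quo_scale (a : k) (q : quoT P) : quoT P := quo_pi (a *: repr q).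

Lemma quo_scale_pi a x : quo_scale a (quo_pi x) = quo_pi (a *: x).
Proof.
apply/quo_piE; rewrite -scalerBr -[_ *: _]addr0.
apply: sub_memP (sub_mem0 P); apply/quo_piE; rewrite /quo_pi reprK //.
Qed.

Let scaleA a b v : quo_scale a (quo_scale b v) = quo_scale (a * b) v.
Proof. by have [x <-] := quo_pi_surj v; rewrite !quo_scale_pi scalerA. Qed.

Let scale1 : left_id 1 quo_scale.
Proof. by move=> v; have [x <-] := quo_pi_surj v; rewrite quo_scale_pi scale1r. Qed.

Let scaleDr : right_distributive quo_scale +%R.
Proof.
move=> a u v; have [x <-] := quo_pi_surj u; have [y <-] := quo_pi_surj v.
by rewrite -quo_piD !quo_scale_pi -quo_piD scalerDr.
Qed.

Let scaleDl v : {morph quo_scale^~ v : a b / a + b}.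
Proof.
move=> a b; have [x <-] := quo_pi_surj v.
by rewrite !quo_scale_pi -quo_piD scalerDl.
Qed.

HB.instance Definition _ :=
  GRing.Zmodule_isLmodule.Build k (quoT P) scaleA scale1 scaleDr scaleDl.
End QuotientScale.

Definition dfun (I : Type) (E : I -> lmodType k) := forall i, E i.

Section DFun.
Variables (I : Type) (E : I -> lmodType k).
HB.instance Definition _ := gen_eqMixin (dfun E).
HB.instance Definition _ := gen_choiceMixin (dfun E).
Let add (f g : dfun E) : dfun E := fun i => f i + g i.
Let opp (f : dfun E) : dfun E := fun i => - f i.
Let zer : dfun E := fun i => 0.
Let scl (a : k) (f : dfun E) : dfun E := fun i => a *: f i.
HB.instance Definition _ := @GRing.isZmodule.Build (dfun E) zer opp add
  (fun f g h => functional_extensionality_dep (fun i => addrA (f i) (g i) (h i)))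
  (fun f g => functional_extensionality_dep (fun i => addrC (f i) (g i)))
  (fun f => functional_extensionality_dep (fun i => add0r (f i)))
  (fun f => functional_extensionality_dep (fun i => addNr (f i))).
HB.instance Definition _ := @GRing.Zmodule_isLmodule.Build k (dfun E) scl
  (fun a b f => functional_extensionality_dep (fun i => scalerA a b (f i)))
  (fun f => functional_extensionality_dep (fun i => scale1r (f i)))
  (fun a f g => functional_extensionality_dep (fun i => scalerDr a (f i) (g i)))
  (fun f a b => functional_extensionality_dep (fun i => scalerDl (f i) a b)).
End DFun.
End VectorSpaces.

Section VectorComplexes.
Variable k : fieldType.

Record vcpx := Vcpx {
  vob :> int -> lmodType k;
  vd : forall m, {linear vob m -> vob (m + 1)};
  vdd : forall m v, vd (m + 1) (vd m v) = 0 }.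

Inductive cobound (C : vcpx) : forall m, C m -> Prop :=
  Cobound m (v : C m) : cobound (vd C m v).

Definition exact_at (C : vcpx) (m : int) :=
  forall v : C m, vd C m v = 0 -> cobound v.

Section Cohomology.
Variables (C : vcpx) (m : int).

Lemma cocycle_subproof a (u v : C m) :
  vd C m u = 0 -> vd C m v = 0 -> vd C m (a *: u + v) = 0.
Proof. by move=> hu hv; rewrite linearP hu hv scaler0 addr0. Qed.

Definition cocycles : subsp (C m) :=
  Subsp (linear0 (vd C m)) cocycle_subproof.

Lemma cobound_inv (C' : vcpx) i (w : C' i) : cobound w ->
  forall j (e : i = j + 1), exists u : C' j, eq_rect i (fun i => vob C' i : Type) w (j + 1) e =
    vd C' j u.
Proof.
case=> l v j e; have elj : l = j by exact: addIr e.
by case: j / elj e => e; rewrite (eq_irrelevance e erefl); exists v.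
Qed.

Lemma coboundE (C' : vcpx) i (w : C' (i + 1)) :
  cobound w <-> exists u, w = vd C' i u.
Proof.
split=> [h|[u ->]]; last by constructor.
by have [u] := cobound_inv h erefl; exists u.
Qed.

Lemma cobound_closed (C' : vcpx) i :
  cobound (0 : C' i) /\ forall a (u v : C' i),
  cobound u -> cobound v -> cobound (a *: u + v).
Proof.
have : i - 1 + 1 = i by rewrite subrK.
move: (i - 1) => j e; case: i / e; split=> [|a u v].
  by apply/coboundE; exists 0; rewrite linear0.
move=> /coboundE[u' ->] /coboundE[v' ->].
by apply/coboundE; exists (a *: u' + v'); rewrite linearP.
Qed.

Let Z := subT cocycles.

Lemma cobound_subproof a (u v : Z) :
  cobound (subv u) -> cobound (subv v) -> cobound (subv (a *: u + v)).
Proof. exact: (cobound_closed C m).2. Qed.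

Definition coboundaries : subsp Z :=
  @Subsp k Z (fun z => cobound (subv z)) (cobound_closed C m).1 cobound_subproof.

Definition Coh : lmodType k := quoT coboundaries.

(* the cochain v is a cocycle whose class is a *)
Definition class_of (v : C m) (a : Coh) : Prop :=
  exists2 z : Z, subv z = v & quo_pi coboundaries z = a.
End Cohomology.
End VectorComplexes.

Section Sheaves.
Variable k : fieldType.

(* Sheaves of vector spaces are presented by their etale spaces: [cont x s]
   says that the family s of elements of the stalks is a section on some
   neighbourhood of x, so that the sections on an open set U are the families s
   with [cont x s] for all x in U (modulo their values outside U).  In a
   [presh] the fibers [psh_fib x] may be too large; [etale] cuts them down to the
   stalks. *)
Record presh (X : topologicalType) := Presh {
  psh_fib :> X -> lmodType k;
  cont : forall x : X, (forall y, psh_fib y) -> Prop;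
  cont_near : forall x s, cont x s -> \forall y \near x, cont y s;
  cont_ext : forall x s t,
    cont x s -> (\forall y \near x, s y = t y) -> cont x t;
  cont0 : forall x, cont x (fun _ => 0);
  contP : forall x a s t,
    cont x s -> cont x t -> cont x (fun y => a *: s y + t y);
  cont_inj : forall x s, cont x s -> s x = 0 -> \forall y \near x, s y = 0 }.

Record sheaf (X : topologicalType) := Sheaf {
  sh_presh :> presh X;
  cont_surj : forall x (v : sh_presh x), exists2 s, cont x s & s x = v }.

Record shom (X : topologicalType) (F G : presh X) := Shom {
  shom_fun :> forall x, {linear F x -> G x};
  shom_cont : forall x s, cont x s -> cont x (fun y => shom_fun y (s y)) }.

Section Etale.
Variables (X : topologicalType) (P : presh X).

Lemma stalk_subproof0 x : exists2 s : forall y, P y, cont x s & s x = 0.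
Proof. by exists (fun=> 0) => //; exact: cont0. Qed.

Lemma stalk_subproofP x a (u v : P x) :
  (exists2 s, cont x s & s x = u) -> (exists2 s, cont x s & s x = v) ->
  exists2 s, cont x s & s x = a *: u + v.
Proof.
by move=> [s cs <-] [t ct <-]; exists (fun y => a *: s y + t y) => //; exact: contP.
Qed.

Definition stalk_sub x : subsp (P x) :=
  @Subsp k (P x) (fun v => exists2 s, cont x s & s x = v) (stalk_subproof0 x)
    (@stalk_subproofP x).

Definition estalk x : lmodType k := subT (stalk_sub x).
Definition econt x (s : forall y, estalk y) := cont x (fun y => subv (s y)).

Lemma econt_near x s : econt x s -> \forall y \near x, econt y s.
Proof. exact: cont_near. Qed.
Lemma econt_ext x s t :
  econt x s -> (\forall y \near x, s y = t y) -> econt x t.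
Proof. by move=> cs st; apply: cont_ext cs _; near=> y; congr subv; near: y.
Unshelve. all: by end_near. Qed.
Lemma econt0 x : econt x (fun _ => 0).
Proof. exact: cont0. Qed.
Lemma econtP x a s t :
  econt x s -> econt x t -> econt x (fun y => a *: s y + t y).
Proof. exact: contP. Qed.
Lemma econt_inj x s : econt x s -> s x = 0 -> \forall y \near x, s y = 0.
Proof.
move=> cs s0; have : \forall y \near x, subv (s y) = 0.
  by apply: cont_inj cs _; rewrite s0.
by apply: filterS => y sy0; apply: val_inj.
Qed.

Definition etale_presh : presh X :=
  Presh econt_near econt_ext econt0 econtP econt_inj.

Lemma etale_surj x (v : etale_presh x) : exists2 s, cont x s & s x = v.
Proof.
have [s0 cs0 s0v] : exists2 s, cont x s & s x = subv v.
  exact/asboolP/(subvP v).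
pose s y : etale_presh y :=
  if pselect (exists2 t, cont y t & t y = s0 y) is left h
  then @SubT k _ (stalk_sub y) (s0 y) (asboolT h) else 0.
have sE y : cont y s0 -> subv (s y) = s0 y.
  by move=> cy; rewrite /s; case: pselect => // -[]; exists s0.
exists s; last by apply: val_inj; rewrite /= sE.
rewrite /= /econt; apply: cont_ext (cs0) _.
by have := cont_near cs0; apply: filterS => y cy; rewrite sE.
Qed.

Definition etale : sheaf X := Sheaf etale_surj.
End Etale.

Section Morphisms.
Variables (X : topologicalType).
Implicit Types P Q : presh X.

Lemma shom_id_subproof P x (s : forall y, P y) :
  cont x s -> cont x (fun y => (idfun : {linear P y -> P y}) (s y)).
Proof. by []. Qed.
Definition shom_id P : shom P P := Shom (@shom_id_subproof P).

Lemma shom_comp_subproof P Q (S : presh X) (g : shom Q S) (f : shom P Q)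
  x (s : forall y, P y) :
  cont x s -> cont x (fun y => (g y \o f y : {linear P y -> S y}) (s y)).
Proof. by move=> cs; exact/(shom_cont g)/(shom_cont f). Qed.
Definition shom_comp P Q (S : presh X) (g : shom Q S) (f : shom P Q) : shom P S :=
  Shom (shom_comp_subproof g f).

Lemma shom0_subproof P Q x (s : forall y, P y) :
  cont x s -> cont x (fun y => (\0 : {linear P y -> Q y}) (s y)).
Proof. by move=> _; exact: cont0. Qed.
Definition shom0 P Q : shom P Q := Shom (@shom0_subproof P Q).

Section EtaleHom.
Variables (P Q : presh X) (f : shom P Q).

Lemma etale_hom_mem x (v : etale P x) : f x (subv v) \in sub_pred (stalk_sub Q x).
Proof.
have /asboolP[s cs sv] := subvP v; apply/asboolP.
by exists (fun y => f y (s y)); [exact: shom_cont|rewrite sv].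
Qed.

Definition etale_fun x (v : etale P x) : etale Q x := SubT (etale_hom_mem v).

Lemma etale_fun_linear x : linear (@etale_fun x).
Proof. by move=> a u v; apply: val_inj; rewrite /= linearP. Qed.

HB.instance Definition _ x :=
  GRing.isLinear.Build k (etale P x) (etale Q x) *:%R (@etale_fun x)
    (@etale_fun_linear x).

Lemma etale_fun_cont x (s : forall y, etale P y) :
  cont x s -> cont x (fun y => (etale_fun (x := y) : {linear _ -> _}) (s y)).
Proof. exact: (shom_cont f). Qed.

Definition etale_hom : shom (etale P) (etale Q) := Shom etale_fun_cont.
End EtaleHom.
End Morphisms.

Section Pullback.
Variables (X Y : topologicalType) (f : Y -> X) (cf : continuous f).

Section Object.
Variable F : sheaf X.
Definition pull_cont y (s : forall y, F (f y)) :=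
  exists2 r : forall x, F x, cont (f y) r & \forall z \near y, s z = r (f z).

Lemma pull_near y s : pull_cont y s -> \forall z \near y, pull_cont z s.
Proof.
move=> [r /cont_near cr /near_join sr].
have cr' : \forall z \near y, cont (f z) r by exact: cf cr.
by near=> z; exists r; near: z.
Unshelve. all: by end_near. Qed.
Lemma pull_ext y s t :
  pull_cont y s -> (\forall z \near y, s z = t z) -> pull_cont y t.
Proof.
move=> [r cr sr] st; exists r => //.
by near=> z; rewrite -(near st z) //; near: z.
Unshelve. all: by end_near. Qed.
Lemma pull0 y : pull_cont y (fun _ => 0).
Proof. by exists (fun=> 0); [exact: cont0|exact: nearW]. Qed.
Lemma pullP y a s t :
  pull_cont y s -> pull_cont y t -> pull_cont y (fun z => a *: s z + t z).
Proof.
move=> [r cr sr] [q cq tq]; exists (fun x => a *: r x + q x); first exact: contP.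
by near=> z; rewrite (near sr z) // (near tq z).
Unshelve. all: by end_near. Qed.
Lemma pull_inj y s : pull_cont y s -> s y = 0 -> \forall z \near y, s z = 0.
Proof.
move=> [r cr sr] s0; have r0 : r (f y) = 0.
  by rewrite -(nbhs_singleton sr).
have r0' : \forall z \near y, r (f z) = 0
  by exact: cf (cont_inj cr r0).
by near=> z; rewrite (near sr z) //; near: z.
Unshelve. all: by end_near. Qed.
Definition pull_presh : presh Y := Presh pull_near pull_ext pull0 pullP pull_inj.
Lemma pull_surj y (v : pull_presh y) : exists2 s, cont y s & s y = v.
Proof.
have [r cr <-] := cont_surj v.
by exists (fun z => r (f z)) => //; exists r => //; exact: nearW.
Qed.
Definition pull : sheaf Y := Sheaf pull_surj.
End Object.

Lemma pull_hom_subproof (F G : sheaf X) (h : shom F G) y (s : forall y, pull F y) :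
  cont y s -> cont y (fun z => (h (f z) : {linear pull F z -> pull G z}) (s z)).
Proof.
move=> [r cr sr]; exists (fun x => h x (r x)); first exact: shom_cont.
by near=> z; rewrite (near sr z).
Unshelve. all: by end_near. Qed.
Definition pull_hom (F G : sheaf X) (h : shom F G) : shom (pull F) (pull G) :=
  Shom (pull_hom_subproof h).
End Pullback.

Section TensorLocClosed.
Variable X : topologicalType.

Section Object.
Variables (S : set X) (F : sheaf X).
Definition ten_cont x (s : forall y, F y) :=
  exists2 r : forall y, F y, cont x r &
    \forall y \near x, (S y -> s y = r y) /\ (~ S y -> \forall z \near y, s z = 0).

Lemma ten_out x s : ten_cont x s -> \forall y \near x, ~ S y -> s y = 0.
Proof.
move=> [r _ h]; apply: filterS h => y [_ h] /h; exact: nbhs_singleton.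
Qed.
Lemma ten_near x s : ten_cont x s -> \forall y \near x, ten_cont y s.
Proof.
move=> [r /cont_near cr /near_join sr].
by near=> y; exists r; near: y.
Unshelve. all: by end_near. Qed.
Lemma ten_ext x s t :
  ten_cont x s -> (\forall y \near x, s y = t y) -> ten_cont x t.
Proof.
move=> [r cr sr] st; exists r => //; have /near_join st' := st.
near=> y; split=> [Sy|nSy].
  rewrite -(near st y) //; have [+ _] : (S y -> s y = r y) /\
   (~ S y -> \forall z \near y, s z = 0) by near: y.
  exact.
have [_ /(_ nSy) s0] : (S y -> s y = r y) /\
   (~ S y -> \forall z \near y, s z = 0) by near: y.
have sty : \forall z \near y, s z = t z by near: y.
by near=> z; rewrite -(near sty z) //; near: z.
Unshelve. all: by end_near. Qed.
Lemma ten0 x : ten_cont x (fun _ => 0).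
Proof.
exists (fun=> 0); first exact: cont0.
by apply: nearW => y; split=> // _; exact: nearW.
Qed.
Lemma tenP x a s t :
  ten_cont x s -> ten_cont x t -> ten_cont x (fun y => a *: s y + t y).
Proof.
move=> [r cr sr] [q cq tq]; exists (fun y => a *: r y + q y); first exact: contP.
apply: filterS2 sr tq => y [sr s0] [tq t0]; split=> [Sy|nSy].
  by rewrite sr// tq.
by apply: filterS2 (s0 nSy) (t0 nSy) => z -> ->; rewrite scaler0 addr0.
Qed.
Lemma ten_inj x s : ten_cont x s -> s x = 0 -> \forall y \near x, s y = 0.
Proof.
move=> [r cr sr] sx; have [s1 s2] := nbhs_singleton sr.
have [Sx|/s2//] := pselect (S x).
have r0 := cont_inj cr (etrans (esym (s1 Sx)) sx).
apply: filterS2 r0 sr => y ry [sr0 s0].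
have [Sy|nSy] := pselect (S y); first by rewrite sr0.
exact: nbhs_singleton (s0 nSy).
Qed.
Definition ten_presh : presh X := Presh ten_near ten_ext ten0 tenP ten_inj.

(* k_S tensor F, for S locally closed: a section on U is a section of F on the
   subspace S of U whose support is closed in U. *)
Definition ten : sheaf X := etale ten_presh.
End Object.

Lemma ten_hom_subproof (S : set X) (F G : sheaf X) (h : shom F G) x s :
  cont (p := ten_presh S F) x s -> cont (p := ten_presh S G) x (fun y => h y (s y)).
Proof.
move=> [r cr sr]; exists (fun x => h x (r x)); first exact: shom_cont.
apply: filterS sr => y [sr s0]; split=> [/sr->//|/s0].
by apply: filterS => z ->; rewrite linear0.
Qed.
Definition ten_hom (S : set X) (F G : sheaf X) (h : shom F G) :
  shom (ten S F) (ten S G) :=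
  etale_hom (Shom (@ten_hom_subproof S F G h)).

(* S `&` S' is closed in S and open in S', so that there is a canonical morphism
   from k_S to k_S' *)
Definition kadm (S S' : set X) :=
  (forall x, S x -> ~ S' x -> \forall y \near x, S y -> ~ S' y) /\
  (forall x, S x -> S' x -> \forall y \near x, S' y -> S y).

Section CanonicalMap.
Variables (S S' : set X) (F : sheaf X) (h : kadm S S').

Definition kfun x (v : F x) : F x := if `[< S' x >] then v else 0.

Lemma kfun_linear x : linear (@kfun x).
Proof. by move=> a u v; rewrite /kfun; case: ifP; rewrite // scaler0 addr0. Qed.

HB.instance Definition _ x :=
  GRing.isLinear.Build k (F x) (F x) *:%R (@kfun x) (@kfun_linear x).

Lemma kfun_cont x s : cont (p := ten_presh S F) x s ->
  cont (p := ten_presh S' F) x (fun y => (@kfun y : {linear F y -> F y}) (s y)).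
Proof.
move=> cs; have out := ten_out cs; move: (cs) => [r cr sr].
have kT y (v : F y) : S' y -> kfun v = v.
  by move=> S'y; rewrite /kfun asboolT.
have kF y (v : F y) : ~ S' y -> kfun v = 0.
  by move=> S'y; rewrite /kfun asboolF.
have [Sx|nSx] := pselect (S x); last first.
  have s0 := (nbhs_singleton sr).2 nSx.
  exists (fun=> 0); first exact: cont0.
  have /near_join s0' := s0.
  apply: filterS2 s0 s0' => y sy sy'; split=> [_|_]; first by rewrite /= sy linear0.
  by apply: filterS sy' => z sz; rewrite /= sz linear0.
have [S'x|nS'x] := pselect (S' x); last first.
  exists (fun=> 0); first exact: cont0.
  have k0 : \forall y \near x, kfun (s y) = 0.
    apply: filterS2 out (h.1 _ Sx nS'x) => y sy SS'.
    have [S'y|nS'y] := pselect (S' y); last by rewrite kF.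
    by rewrite kT// sy// => Sy; exact: SS' Sy S'y.
  have /near_join k0' := k0.
  by apply: filterS2 k0 k0' => y sy sy'; split.
exists r => //; have /near_join out' := out.
have S'S := h.2 _ Sx S'x.
near=> y.
have [s1 s2] : (S y -> s y = r y) /\ (~ S y -> \forall z \near y, s z = 0).
  by near: y.
have outy : \forall z \near y, ~ S z -> s z = 0 by near: y.
have S'Sy : S' y -> S y by near: y.
split=> [S'y|nS'y]; first by rewrite /= kT// s1//; exact: S'Sy.
have [Sy|nSy] := pselect (S y); last first.
  by apply: filterS (s2 nSy) => z sz; rewrite /= sz linear0.
apply: filterS2 outy (h.1 _ Sy nS'y) => z sz SS'.
have [S'z|nS'z] := pselect (S' z); last by rewrite /= kF.
by rewrite /= kT// sz// => Sz; exact: SS' Sz S'z.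
Unshelve. all: by end_near. Qed.

Definition kmap_adm : shom (ten S F) (ten S' F) := etale_hom (Shom kfun_cont).
End CanonicalMap.

(* the morphism induced by the canonical morphism from k_S to k_S' (restriction
   to S', or extension by zero), and the zero morphism if there is none *)
Definition kmap (S S' : set X) (F : sheaf X) : shom (ten S F) (ten S' F) :=
  if pselect (kadm S S') is left h then kmap_adm F h else shom0 _ _.
End TensorLocClosed.
End Sheaves.

Section Sums.
Variables (k : fieldType) (X : topologicalType).

(* the constant sheaf with stalk M *)
Section Constant.
Variable M : lmodType k.
Definition const_cont (x : X) (s : X -> M) := \forall y \near x, s y = s x.
Lemma const_near x s : const_cont x s -> \forall y \near x, const_cont y s.
Proof.
move=> cs; have /near_join cs' := cs.
by apply: filterS2 cs cs' => y sy; apply: filterS => z ->; rewrite sy.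
Qed.
Lemma const_ext x s t :
  const_cont x s -> (\forall y \near x, s y = t y) -> const_cont x t.
Proof.
move=> cs st; have sx := nbhs_singleton st.
by apply: filterS2 cs st => y sy <-; rewrite sy.
Qed.
Lemma const0 x : const_cont x (fun _ => 0).
Proof. exact: nearW. Qed.
Lemma constP x a s t :
  const_cont x s -> const_cont x t -> const_cont x (fun y => a *: s y + t y).
Proof. by apply: filterS2 => y -> ->. Qed.
Lemma const_inj x s : const_cont x s -> s x = 0 -> \forall y \near x, s y = 0.
Proof. by move=> cs s0; apply: filterS cs => y ->. Qed.
Definition const_presh : presh k X :=
  @Presh k X (fun=> M) const_cont const_near const_ext const0 constP const_inj.
Lemma const_surj x (v : const_presh x) : exists2 s, cont x s & s x = v.
Proof. by exists (fun=> v) => //; exact: nearW. Qed.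
Definition const : sheaf k X := Sheaf const_surj.
End Constant.

Definition zero_sheaf : sheaf k X := const 'rV[k]_0.

Section BinarySum.
Variables F G : sheaf k X.
Definition add_cont x (s : forall y, (F y * G y)%type) :=
  cont x (fun y => (s y).1) /\ cont x (fun y => (s y).2).
Lemma add_near x s : add_cont x s -> \forall y \near x, add_cont y s.
Proof. by move=> [/cont_near + /cont_near]; apply: filterS2 => y. Qed.
Lemma add_ext x s t :
  add_cont x s -> (\forall y \near x, s y = t y) -> add_cont x t.
Proof.
by move=> [c1 c2] st; split; [apply: cont_ext c1 _|apply: cont_ext c2 _];
  apply: filterS st => y ->.
Qed.
Lemma add0 x : add_cont x (fun _ => 0).
Proof. by split; exact: cont0. Qed.
Lemma addP x a s t :
  add_cont x s -> add_cont x t -> add_cont x (fun y => a *: s y + t y).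
Proof. by move=> [s1 s2] [t1 t2]; split; exact: contP. Qed.
Lemma add_inj x s : add_cont x s -> s x = 0 -> \forall y \near x, s y = 0.
Proof.
move=> [c1 c2] s0.
have s1 : (s x).1 = 0 by rewrite s0.
have s2 : (s x).2 = 0 by rewrite s0.
by apply: filterS2 (cont_inj c1 s1) (cont_inj c2 s2) => y; case: (s y) => a b /= -> ->.
Qed.
Definition add_presh : presh k X := Presh add_near add_ext add0 addP add_inj.
Lemma add_surj x (v : add_presh x) : exists2 s, cont x s & s x = v.
Proof.
case: v => v w; have [s cs <-] := cont_surj v; have [t ct <-] := cont_surj w.
by exists (fun y => (s y, t y)).
Qed.
Definition add_sheaf : sheaf k X := Sheaf add_surj.
End BinarySum.

Section FiniteSum.
Variable n : nat.
Section Object.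
Variable F : 'I_n -> sheaf k X.
Definition sum_cont x (s : forall y, dfun (fun i => F i y)) :=
  forall i, cont x (fun y => s y i).
Lemma sum_near x s : sum_cont x s -> \forall y \near x, sum_cont y s.
Proof. by move=> cs; apply: filter_forall => i; exact: cont_near (cs i). Qed.
Lemma sum_ext x s t :
  sum_cont x s -> (\forall y \near x, s y = t y) -> sum_cont x t.
Proof. by move=> cs st i; apply: cont_ext (cs i) _; apply: filterS st => y ->. Qed.
Lemma sum0 x : sum_cont x (fun _ => 0).
Proof. by move=> i; exact: cont0. Qed.
Lemma sumP x a s t :
  sum_cont x s -> sum_cont x t -> sum_cont x (fun y => a *: s y + t y).
Proof. by move=> cs ct i; exact: contP. Qed.
Lemma sum_inj x s : sum_cont x s -> s x = 0 -> \forall y \near x, s y = 0.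
Proof.
move=> cs s0; have : \forall y \near x, forall i, s y i = 0.
  by apply: filter_forall => i; apply: cont_inj (cs i) _; rewrite s0.
by apply: filterS => y sy; exact: functional_extensionality_dep.
Qed.
Definition sum_presh : presh k X := Presh sum_near sum_ext sum0 sumP sum_inj.
Lemma sum_surj x (v : sum_presh x) : exists2 s, cont x s & s x = v.
Proof.
have h i : {s : forall y, F i y | cont x s /\ s x = v i}.
  by apply: cid; have [s cs sx] := cont_surj (v i); exists s.
exists (fun y i => sval (h i) y).
  by move=> i; exact: (svalP (h i)).1.
by apply: functional_extensionality_dep => i; exact: (svalP (h i)).2.
Qed.
Definition sum_sheaf : sheaf k X := Sheaf sum_surj.
End Object.

Section Hom.
Variables (F G : 'I_n -> sheaf k X) (f : forall i, shom (F i) (G i)).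
Definition sum_fun x (v : sum_sheaf F x) : sum_sheaf G x := fun i => f i x (v i).
Lemma sum_fun_linear x : linear (@sum_fun x).
Proof.
by move=> a u v; apply: functional_extensionality_dep => i; exact: linearP.
Qed.
HB.instance Definition _ x :=
  GRing.isLinear.Build k (sum_sheaf F x) (sum_sheaf G x) *:%R (@sum_fun x)
    (@sum_fun_linear x).
Lemma sum_fun_cont x (s : forall y, sum_sheaf F y) :
  cont x s -> cont x (fun y => (@sum_fun y : {linear _ -> _}) (s y)).
Proof. by move=> cs i; exact: shom_cont (cs i). Qed.
Definition sum_hom : shom (sum_sheaf F) (sum_sheaf G) := Shom sum_fun_cont.
End Hom.
End FiniteSum.
End Sums.

Section CompactSupports.
Variable k : fieldType.

(* global sections with compact support *)
Section Gamma.
Variables (X : topologicalType).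

Definition gam_mem (G : presh k X) (s : dfun G) :=
  (forall x, cont x s) /\ exists2 A, compact A & forall x, ~ A x -> s x = 0.
Lemma gam_mem0 (G : presh k X) : gam_mem (0 : dfun G).
Proof.
by split; [move=> x; exact: cont0|exists set0 => //; exact: compact0].
Qed.
Lemma gam_memP (G : presh k X) a (s t : dfun G) :
  gam_mem s -> gam_mem t -> gam_mem (a *: s + t).
Proof.
move=> [cs [A kA sA]] [ct [B kB tB]]; split; first by move=> x; exact: contP.
exists (A `|` B); first exact: compactU.
move=> x /not_orP[nA nB].
by rewrite -[LHS]/(a *: s x + t x) sA// tB// scaler0 addr0.
Qed.
Definition gam_sub (G : presh k X) : subsp (dfun G) :=
  Subsp (gam_mem0 G) (@gam_memP G).
Definition Gam (G : presh k X) : lmodType k := subT (gam_sub G).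

Section Hom.
Variables (G H : presh k X) (f : shom G H).
Lemma gam_fun_mem (s : Gam G) :
  (fun x => f x (subv s x) : H x) \in sub_pred (gam_sub H).
Proof.
have /asboolP[cs [A kA sA]] := subvP s; apply/asboolP; split.
  by move=> x; exact: shom_cont.
by exists A => // x nAx; rewrite sA// linear0.
Qed.
Definition gam_fun (s : Gam G) : Gam H := SubT (gam_fun_mem s).
Lemma gam_fun_linear : linear gam_fun.
Proof.
move=> a u v; apply: val_inj; apply: functional_extensionality_dep => x /=.
exact: linearP.
Qed.
HB.instance Definition _ :=
  GRing.isLinear.Build k (Gam G) (Gam H) *:%R gam_fun gam_fun_linear.
Definition Gam_hom : {linear Gam G -> Gam H} := gam_fun.
End Hom.
End Gamma.

Lemma cont_eq (X : topologicalType) (P : presh k X) x (s t : forall y, P y) :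
  cont x s -> (forall y, s y = t y) -> cont x t.
Proof. by move=> cs st; apply: cont_ext cs _; exact: nearW. Qed.

(* direct image with proper supports along the projection X * Y -> Y *)
Section ProperImage.
Variables (X Y : topologicalType).

Section Object.
Variable G : sheaf k (X * Y)%type.
Definition fib (y : Y) : lmodType k := dfun (fun x : X => G (x, y)).
Definition glue (e : forall y, fib y) : forall p, G p :=
  fun p => let: (x, y) as q := p return G q in e y x.

(* sections over a neighbourhood of the fiber of y whose support is proper over a
   neighbourhood of y *)
Definition shr_cont (y : Y) (e : forall y, fib y) :=
  (exists2 A : set X, compact A &
     \forall z \near y, forall x, ~ A x -> e z x = 0) /\
  \forall z \near y, forall x, cont (x, z) (glue e).

Lemma shr_near y e : shr_cont y e -> \forall z \near y, shr_cont z e.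
Proof.
move=> [[A kA /near_join eA] /near_join ce].
by apply: filterS2 eA ce => z ez cz; split => //; exists A.
Qed.
Lemma shr_ext y e t :
  shr_cont y e -> (\forall z \near y, e z = t z) -> shr_cont y t.
Proof.
move=> [[A kA eA] ce] et; split.
  by exists A => //; apply: filterS2 eA et => z ez <-.
have /near_join et' := et.
apply: filterS2 ce et' => z cz etz x; apply: cont_ext (cz x) _.
exists (setT, [set z | e z = t z]); first by split; [exact: filterT|].
by move=> [x' z'] [_ /= ->].
Qed.
Lemma shr0 y : shr_cont y (fun _ => 0).
Proof.
split; first by exists set0; [exact: compact0|exact: nearW].
apply: nearW => z x; by apply: cont_eq (cont0 _ _) _ => -[].
Qed.
Lemma shrP y a e t :
  shr_cont y e -> shr_cont y t -> shr_cont y (fun z => a *: e z + t z).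
Proof.
move=> [[A kA eA] ce] [[B kB tB] ct]; split.
  exists (A `|` B); first exact: compactU.
  apply: filterS2 eA tB => z ez tz x /not_orP[nA nB].
  by rewrite -[LHS]/(a *: e z x + t z x) ez// tz// scaler0 addr0.
apply: filterS2 ce ct => z cz tz x.
by apply: cont_eq (contP a (cz x) (tz x)) _ => -[].
Qed.
Lemma shr_inj y e : shr_cont y e -> e y = 0 -> \forall z \near y, e z = 0.
Proof.
move=> [[A kA eA] ce] e0.
have cov : \forall z \near y, A `<=` (fun x => e z x = 0).
  apply: (compact_near_coveringP A).1 => // x Ax.
  have := cont_inj (nbhs_singleton ce x).
  rewrite /= e0 => /(_ erefl); apply: filterS => -[x' z'] //.
apply: filterS2 eA cov => z ez cz; apply: functional_extensionality_dep => x.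
by have [Ax|/ez//] := pselect (A x); exact: cz.
Qed.
Definition shr_presh : presh k Y := Presh shr_near shr_ext shr0 shrP shr_inj.
Definition shr : sheaf k Y := etale shr_presh.
End Object.

Section Hom.
Variables (G H : sheaf k (X * Y)%type) (f : shom G H).
Definition shr_fun y (e : shr_presh G y) : shr_presh H y := fun x => f (x, y) (e x).
Lemma shr_fun_linear y : linear (@shr_fun y).
Proof.
by move=> a u v; apply: functional_extensionality_dep => x; exact: linearP.
Qed.
HB.instance Definition _ y :=
  GRing.isLinear.Build k (shr_presh G y) (shr_presh H y) *:%R (@shr_fun y)
    (@shr_fun_linear y).
Lemma shr_fun_cont y (e : forall y, shr_presh G y) :
  cont y e -> cont y (fun z => (@shr_fun z : {linear _ -> _}) (e z)).
Proof.
move=> [[A kA eA] ce]; split.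
  by exists A => //; apply: filterS eA => z ez x nA; rewrite /= /shr_fun ez// linear0.
apply: filterS ce => z cz x; by apply: cont_eq (shom_cont f (cz x)) _ => -[].
Qed.
Definition shr_hom : shom (shr G) (shr H) := etale_hom (Shom shr_fun_cont).
End Hom.
End ProperImage.
End CompactSupports.

Section Complexes.
Variable k : fieldType.

Record cpx (X : topologicalType) := Cpx {
  ob :> int -> sheaf k X;
  df : forall m, shom (ob m) (ob (m + 1));
  dfdf : forall m x v, df (m + 1) x (df m x v) = 0;
  bounded : exists N : nat, forall m x (v : ob m x), (N < `|m|)%N -> v = 0 }.

Record chain (X : topologicalType) (F G : cpx X) := Chain {
  chain_hom :> forall m, shom (F m) (G m);
  chain_d : forall m x v,
    chain_hom (m + 1) x (df F m x v) = df G m x (chain_hom m x v) }.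

Section Constructions.
Variable X : topologicalType.

Definition stalk_cpx (F : cpx X) (x : X) : vcpx k :=
  @Vcpx k (fun m => F m x) (fun m => df F m x) (fun m v => dfdf v).

Lemma gam_dd (F : cpx X) m (s : Gam (F m)) :
  Gam_hom (df F (m + 1)) (Gam_hom (df F m) s) = 0.
Proof.
apply: val_inj; apply: functional_extensionality_dep => x /=; exact: dfdf.
Qed.

(* computes the cohomology with compact support of F when X is locally compact
   Hausdorff and the terms of F are c-soft *)
Definition Gam_cpx (F : cpx X) : vcpx k :=
  @Vcpx k (fun m => Gam (F m)) (fun m => Gam_hom (df F m)) (@gam_dd F).

Definition acyclic (F : cpx X) := forall x m, exact_at (stalk_cpx F x) m.

Definition chain_id (F : cpx X) : chain F F :=
  @Chain X F F (fun m => shom_id (F m)) (fun m x v => erefl).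

Lemma chain_comp_subproof (F G H : cpx X) (g : chain G H) (f : chain F G) m x v :
  shom_comp (g (m + 1)) (f (m + 1)) x (df F m x v) =
  df H m x (shom_comp (g m) (f m) x v).
Proof. by rewrite /= chain_d chain_d. Qed.
Definition chain_comp (F G H : cpx X) (g : chain G H) (f : chain F G) : chain F H :=
  Chain (chain_comp_subproof g f).

Section Cone.
Variables (F G : cpx X) (f : chain F G).
Let C m : sheaf k X := add_sheaf (F (m + 1)) (G m).
Definition cone_fun m x (v : C m x) : C (m + 1) x :=
  (- df F (m + 1) x v.1, f (m + 1) x v.1 + df G m x v.2).
Lemma cone_linear m x : linear (@cone_fun m x).
Proof.
move=> a u v; rewrite /cone_fun; congr (_, _) => /=.
  by rewrite linearP opprD scalerN.
by rewrite !linearP /= scalerDr addrACA.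
Qed.
HB.instance Definition _ m x :=
  GRing.isLinear.Build k (C m x) (C (m + 1) x) *:%R (@cone_fun m x)
    (@cone_linear m x).
Lemma cone_cont m x (s : forall y, C m y) :
  cont x s -> cont x (fun y => (@cone_fun m y : {linear _ -> _}) (s y)).
Proof.
move=> [c1 c2]; have d1 := shom_cont (df F (m + 1)) c1.
have d2 := shom_cont (df G m) c2; have d3 := shom_cont (f (m + 1)) c1.
split.
  apply: cont_eq (contP (-1) d1 (cont0 _ _)) _ => y /=.
  by rewrite scaleN1r addr0.
by apply: cont_eq (contP 1 d3 d2) _ => y /=; rewrite scale1r.
Qed.
Lemma cone_dd m x v : Shom (@cone_cont (m + 1)) x (Shom (@cone_cont m) x v) = 0.
Proof.
rewrite /= /cone_fun /=; congr (_, _).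
  by rewrite linearN dfdf !oppr0.
by rewrite linearN linearD /= dfdf addr0 chain_d addNr.
Qed.
Lemma cone_bounded :
  exists N : nat, forall m x (v : C m x), (N < `|m|)%N -> v = 0.
Proof.
have [N hN] := bounded F; have [M hM] := bounded G.
exists (maxn N.+1 M) => m x [v w] hm; congr (_, _); [apply: hN|apply: hM].
  have : (absz m <= absz (m + 1)%R + 1)%N.
    by clear; lia.
  move: hm; rewrite gtn_max => /andP[hm _]; rewrite addn1 => /(leq_trans hm).
  by rewrite ltnS.
by move: hm; rewrite gtn_max => /andP[].
Qed.
Definition cone : cpx X := Cpx cone_dd cone_bounded.
End Cone.

Definition quasi_iso (F G : cpx X) (f : chain F G) := acyclic (cone f).

(* isomorphism in the derived category *)
Definition qis_equiv : cpx X -> cpx X -> Prop :=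
  clos_refl_sym_trans _ (fun F G => exists f : chain F G, quasi_iso f).

(* the sheaf A in degree 0 *)
Section Single.
Variable A : sheaf k X.
Definition single_ob (m : int) : sheaf k X :=
  if m is Posz 0 then A else zero_sheaf k X.
Lemma single_dd m x v :
  shom0 (single_ob (m + 1)) (single_ob (m + 1 + 1)) x
    (shom0 (single_ob m) (single_ob (m + 1)) x v) = 0.
Proof. by []. Qed.
Lemma single_bounded :
  exists N : nat, forall m x (v : single_ob m x), (N < `|m|)%N -> v = 0.
Proof. by exists 0%N => -[[|m]|m] x v // _; apply/matrixP => i []. Qed.
Definition single : cpx X := Cpx single_dd single_bounded.
End Single.

Section Sum.
Variables (n : nat) (F : 'I_n -> cpx X).
Lemma sum_dd m x v :
  sum_hom (fun i => df (F i) (m + 1)) x (sum_hom (fun i => df (F i) m) x v) = 0.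
Proof. by apply: functional_extensionality_dep => i; exact: dfdf. Qed.
Lemma sum_bounded : exists N : nat, forall m x
  (v : sum_sheaf (fun i => F i m) x), (N < `|m|)%N -> v = 0.
Proof.
have h i : {N : nat | forall m x (v : F i m x), (N < `|m|)%N -> v = 0}.
  exact/cid/bounded.
exists (\max_i sval (h i)) => m x v hm; apply: functional_extensionality_dep => i.
by apply: (svalP (h i)); apply: leq_ltn_trans hm; exact: leq_bigmax.
Qed.
Definition sum_cpx : cpx X := Cpx sum_dd sum_bounded.
End Sum.
End Constructions.

(* termwise application of an additive functor *)
Section Functor.
Variables (X Y : topologicalType) (T : sheaf k X -> sheaf k Y).
Variable Th : forall F G : sheaf k X, shom F G -> shom (T F) (T G).
Hypothesis Th0 : forall (F G H : sheaf k X) (g : shom G H) (f : shom F G),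
  (forall x v, g x (f x v) = 0) -> forall y v, Th g y (Th f y v) = 0.
Hypothesis T0 : forall F : sheaf k X,
  (forall x (v : F x), v = 0) -> forall y (v : T F y), v = 0.
Variable F : cpx X.

Lemma map_bounded : exists N : nat, forall m y (v : T (F m) y),
  (N < `|m|)%N -> v = 0.
Proof.
by have [N hN] := bounded F; exists N => m y v hm; apply: T0 => x w; exact: hN.
Qed.
Definition map_cpx : cpx Y :=
  Cpx (fun m => Th0 (fun x v => dfdf v)) map_bounded.
End Functor.

Section Functors.
Variables (X Y : topologicalType).

Lemma ten_hom0 (S : set X) (F G H : sheaf k X) (g : shom G H) (f : shom F G) :
  (forall x v, g x (f x v) = 0) ->
  forall y v, ten_hom S g y (ten_hom S f y v) = 0.
Proof. by move=> gf y v; apply: val_inj => /=; exact: gf. Qed.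
Lemma ten_zero (S : set X) (F : sheaf k X) :
  (forall x (v : F x), v = 0) -> forall y (v : ten S F y), v = 0.
Proof. by move=> F0 y v; apply: val_inj => /=; exact: F0. Qed.
Definition ten_cpx (S : set X) (F : cpx X) : cpx X :=
  map_cpx (@ten_hom0 S) (@ten_zero S) F.

Section Pull.
Variables (f : Y -> X) (cf : continuous f).
Lemma pull_hom0 (F G H : sheaf k X) (g : shom G H) (h : shom F G) :
  (forall x v, g x (h x v) = 0) ->
  forall y v, pull_hom cf g y (pull_hom cf h y v) = 0.
Proof. by move=> gf y v; exact: gf. Qed.
Lemma pull_zero (F : sheaf k X) :
  (forall x (v : F x), v = 0) -> forall y (v : pull cf F y), v = 0.
Proof. by move=> F0 y v; exact: F0. Qed.
Definition pull_cpx (F : cpx X) : cpx Y := map_cpx pull_hom0 pull_zero F.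
End Pull.

Lemma shr_hom0 (F G H : sheaf k (X * Y)%type) (g : shom G H) (f : shom F G) :
  (forall p v, g p (f p v) = 0) ->
  forall y v, shr_hom g y (shr_hom f y v) = 0.
Proof.
move=> gf y v; apply: val_inj; apply: functional_extensionality_dep => x /=.
exact: gf.
Qed.
Lemma shr_zero (F : sheaf k (X * Y)%type) :
  (forall p (v : F p), v = 0) -> forall y (v : shr F y), v = 0.
Proof.
move=> F0 y v; apply: val_inj; apply: functional_extensionality_dep => x /=.
exact: F0.
Qed.
(* computes the derived direct image with proper supports when X is locally
   compact Hausdorff and the terms of F are c-soft on the fibers X * {y} *)
Definition shr_cpx (F : cpx (X * Y)%type) : cpx Y := map_cpx shr_hom0 shr_zero F.
End Functors.

Section Localization.
Variables (X : topologicalType) (W : forall F G : cpx X, chain F G -> Prop).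

(* The localization at W: a morphism from F to G is a zigzag, modulo the
   congruence eqz. *)
Inductive zz (F : cpx X) : cpx X -> Type :=
| zid : zz F F
| zfwd G H : zz F G -> chain G H -> zz F H
| zbwd G H : zz F G -> forall w : chain H G, W w -> zz F H.

Inductive eqz (F : cpx X) : forall G, zz F G -> zz F G -> Prop :=
| eqz_refl G (p : zz F G) : eqz p p
| eqz_sym G (p q : zz F G) : eqz p q -> eqz q p
| eqz_trans G (p q r : zz F G) : eqz p q -> eqz q r -> eqz p r
| eqz_fwd G H (p q : zz F G) (f : chain G H) :
    eqz p q -> eqz (zfwd p f) (zfwd q f)
| eqz_bwd G H (p q : zz F G) (w : chain H G) (h : W w) :
    eqz p q -> eqz (zbwd p h) (zbwd q h)
| eqz_ext G H (p : zz F G) (f g : chain G H) :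
    (forall m x v, f m x v = g m x v) -> eqz (zfwd p f) (zfwd p g)
| eqz_id G (p : zz F G) : eqz (zfwd p (chain_id G)) p
| eqz_comp G H K (p : zz F G) (f : chain G H) (g : chain H K) :
    eqz (zfwd (zfwd p f) g) (zfwd p (chain_comp g f))
| eqz_wV G H (p : zz F G) (w : chain H G) (h : W w) : eqz (zfwd (zbwd p h) w) p
| eqz_Vw G H (p : zz F H) (w : chain H G) (h : W w) : eqz (zbwd (zfwd p w) h) p.
End Localization.
End Complexes.

Section Enhanced.
Variables (k : fieldType) (R : realType) (M : topologicalType).

Definition pi_M : M * R -> M := fst.
Lemma pi_M_cont : continuous pi_M.
Proof. by move=> p; exact: cvg_fst. Qed.

(* The quotient of the bounded derived category of M * R by the inverse image of
   that of M is the localization of bounded complexes at the following class. *)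
Definition Eiso (F G : cpx k (M * R)%type) (f : chain F G) : Prop :=
  exists H : cpx k M, qis_equiv (cone f) (pull_cpx pi_M_cont H).

Lemma quasi_iso_Eiso F G (f : chain F G) : quasi_iso f -> Eiso f.
Proof.
move=> qf; exists (single (zero_sheaf k M)).
have Z0 m x (v : pull_cpx pi_M_cont (single (zero_sheaf k M)) m x) : v = 0.
  by apply: pull_zero => y w; case: m w {v} => [[|m]|m] w; apply/matrixP => i [].
have cm m x (v : pull_cpx pi_M_cont (single (zero_sheaf k M)) m x) :
  (shom0 _ (cone f (m + 1)) x (df (pull_cpx pi_M_cont _) m x v) =
   df (cone f) m x (shom0 _ (cone f m) x v)).
  by rewrite [RHS]linear0.
apply: rst_sym; apply: rst_step; exists (Chain cm) => x m.
set D := stalk_cpx _ x; set K := stalk_cpx (cone f) x.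
pose inc j (w : K j) : D j := (0, w).
have incd j (w : K j) : inc (j + 1) (vd K j w) = vd D j (inc j w).
  by congr (_, _) => /=; rewrite ?linear0 ?oppr0 ?add0r.
move=> [v w] e; have wK : vd K m w = 0.
  by have := congr1 snd e; rewrite /= add0r.
have -> : (v, w) = inc m w by congr (_, _); exact: Z0.
move: (qf x m w wK) => h; clear e wK; case: _ w / h => j u; by rewrite incd; constructor.
Qed.
End Enhanced.

Section Restriction.
Variable k : fieldType.

Lemma kmap_nat (X : topologicalType) (S S' : set X) (F G : sheaf k X)
    (f : shom F G) x v :
  kmap S S' G x (ten_hom S f x v) = ten_hom S' f x (kmap S S' F x v).
Proof.
rewrite /kmap; case: pselect => h; last first.
  by apply: val_inj => /=; rewrite linear0.
by apply: val_inj => /=; rewrite /kfun; case: ifP => // _; rewrite linear0.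
Qed.

Section ToSum.
Variables (X : topologicalType) (n : nat) (F : sheaf k X) (G : 'I_n -> sheaf k X).
Variable f : forall i, shom F (G i).
Definition tosum_fun x (v : F x) : sum_sheaf G x := fun i => f i x v.
Lemma tosum_fun_linear x : linear (@tosum_fun x).
Proof.
by move=> a u v; apply: functional_extensionality_dep => i; exact: linearP.
Qed.
HB.instance Definition _ x :=
  GRing.isLinear.Build k (F x) (sum_sheaf G x) *:%R (@tosum_fun x)
    (@tosum_fun_linear x).
Lemma tosum_fun_cont x (s : forall y, F y) :
  cont x s -> cont x (fun y => (@tosum_fun y : {linear _ -> _}) (s y)).
Proof. by move=> cs i; exact: shom_cont cs. Qed.
Definition tosum_hom : shom F (sum_sheaf G) := Shom tosum_fun_cont.
End ToSum.

Variables (X Y : topologicalType) (n : nat) (F : cpx k (X * Y)%type).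
Variables (Z : set (X * Y)%type) (L : 'I_n -> set (X * Y)%type).

Let A := shr_cpx (ten_cpx Z F).
Let B := sum_cpx (fun i => shr_cpx (ten_cpx (L i) F)).

Definition restr_hom m : shom (A m) (B m) :=
  tosum_hom (fun i => shr_hom (kmap Z (L i) (F m))).

Lemma restr_subproof m y v :
  restr_hom (m + 1) y (df A m y v) = df B m y (restr_hom m y v).
Proof.
apply: functional_extensionality_dep => i; apply: val_inj.
by apply: functional_extensionality_dep => x; exact: kmap_nat.
Qed.

(* induced by the sum over i of the morphisms from k_Z to k_(L i) *)
Definition restr : chain A B := @Chain _ _ A B restr_hom restr_subproof.
End Restriction.

Section Perverse.
Variables (k : fieldType) (X : topologicalType).

(* Every object of the bounded derived category is represented by a bounded
   complex of flabby sheaves when X is a manifold, and then the restrictions of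
   its terms to locally closed subsets are c-soft. *)
Definition flabby (F : cpx k X) := forall m (U : set X) (s : forall x, F m x),
  open U -> (forall x, U x -> cont x s) ->
  exists2 t : forall x, F m x,
    (forall x, cont x t) & forall x, U x -> t x = s x.

Variable F : cpx k X.

(* The m-th cohomology sheaf is locally free of finite rank near x: over a
   neighbourhood of x there are cocycles s i whose classes form a basis of each
   stalk. *)
Definition locally_constant_at (m : int) (x : X) :=
  exists (N : nat) (s : 'I_N -> forall y, F m y), \forall y \near x,
    [/\ forall i, cont y (s i) /\ df F m y (s i y) = 0,
        forall v : F m y, df F m y v = 0 -> exists a : 'I_N -> k,
          cobound (v - \sum_i a i *: s i y : stalk_cpx F y m) &
        forall a : 'I_N -> k,
          cobound (\sum_i a i *: s i y : stalk_cpx F y m) ->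
          forall i, a i = 0].

Definition finite_stalk (m : int) (x : X) :=
  exists (N : nat) (s : 'I_N -> F m x), (forall i, df F m x (s i) = 0) /\
    forall v : F m x, df F m x v = 0 -> exists a : 'I_N -> k,
      cobound (v - \sum_i a i *: s i : stalk_cpx F x m).

(* constructible with respect to the stratification (X \ Sigma, Sigma) *)
Definition constructible (Sigma : set X) := forall m x,
  (~ Sigma x -> locally_constant_at m x) /\ (Sigma x -> finite_stalk m x).

(* vanishing in degree m + 1 of the cohomology of F with support in {x}, F being
   flabby *)
Definition no_local_cohomology (m : int) (x : X) :=
  forall s : forall y, F (m + 1) y,
    (forall y, cont y s) -> (forall y, y <> x -> s y = 0) ->
    (forall y, df F (m + 1) y (s y) = 0) ->
    exists t : forall y, F m y,
      [/\ forall y, cont y t, forall y, y <> x -> t y = 0 &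
          forall y, df F m y (t y) = s y].

(* middle perversity on a surface, Sigma being discrete *)
Definition perverse (Sigma : set X) :=
  [/\ constructible Sigma,
      forall x, ~ Sigma x -> forall m, m != -1 -> exact_at (stalk_cpx F x) m,
      forall x, Sigma x -> forall m, 0 < m -> exact_at (stalk_cpx F x) m &
      forall x, Sigma x -> forall m, m + 1 < 0 -> no_local_cohomology m x].
End Perverse.

Section CompactCohomology.
Variables (k : fieldType) (X : topologicalType) (F : cpx k X).

(* H^m of RGamma_c (X; k_S tensor F) *)
Definition Hc (S : set X) (m : int) : lmodType k :=
  Coh (Gam_cpx (ten_cpx S F)) m.

Definition Gam_kmap (S S' : set X) m :
  {linear Gam (ten S (F m)) -> Gam (ten S' (F m))} := Gam_hom (kmap S S' (F m)).

(* f is induced by the canonical morphism from k_S to k_S' *)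
Definition is_induced S S' m (f : Hc S m -> Hc S' m) :=
  forall a (s : Gam_cpx (ten_cpx S F) m),
    class_of s a -> class_of (C := Gam_cpx (ten_cpx S' F)) (Gam_kmap S S' m s) (f a).

(* f is the connecting map of 0 -> k_U -> k_T -> k_Z -> 0 *)
Definition is_connecting U T Z m (f : Hc Z m -> Hc U (m + 1)) :=
  forall a, exists (s : Gam_cpx (ten_cpx T F) m)
                   (t : Gam_cpx (ten_cpx U F) (m + 1)),
    [/\ class_of (C := Gam_cpx (ten_cpx Z F)) (Gam_kmap T Z m s) a,
        Gam_kmap U T (m + 1) t = vd (Gam_cpx (ten_cpx T F)) m s &
        class_of t (f a)].
End CompactCohomology.

Section Plane.
Variable R : realType.
Local Open Scope complex_scope.

(* the complex line, as well as its dual, the pairing being the product *)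
Definition plane : topologicalType := (R[i] : numFieldType).

Definition rep (z w : R[i]) : R := complex.Re (z * w).
Definition ray (c a : R[i]) : set plane :=
  [set z | exists2 r : R, 0 <= r & z = c + r%:C * a].
Definition oray (c a : R[i]) : set plane :=
  [set z | exists2 r : R, 0 < r & z = c + r%:C * a].

Variables (n : nat) (alpha beta : R[i]) (c : 'I_n -> R[i]).
Variable F : cpx R[i] plane.

(* c i being increasing for the order defined by beta, this is the strip
   r_(i-1) < Re <z, beta> < r_(i+1) *)
Definition strip (i : 'I_n) : set plane :=
  [set z | (forall j : 'I_n, (j < i)%N -> rep (c j) beta < rep z beta) /\
           (forall j : 'I_n, (i < j)%N -> rep z beta < rep (c j) beta)].
Definition strip_gt (i : 'I_n) : set plane :=
  strip i `&` [set z | rep (c i) beta < rep z beta].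
Definition strip_ge (i : 'I_n) : set plane :=
  strip i `&` [set z | rep (c i) beta <= rep z beta].

Definition Phi (a : R[i]) i := Hc F (ray (c i) a) 0.
Definition Psi := Hc F (~` \bigcup_i ray (c i) alpha) 1.

(* [u], [v] are the maps of the quiver of F.  Inverses of the isomorphisms entering
   the definition are avoided by characterizing v_cc by
   ext1 \o delta1 \o v_cc = delta2 and u by u \o theta = u_cc. *)
Definition is_quiver (u : forall i, {linear Psi -> Phi alpha i})
    (v : forall i, {linear Phi alpha i -> Psi}) :=
  forall i,
  let Psi_c := Hc F (oray (c i) alpha) 0 in
  let B' := strip i `\` ray (c i) alpha in
  exists (u_cc : {linear Psi_c -> Phi alpha i})
         (v_cc : {linear Phi alpha i -> Psi_c})
         (delta1 : {linear Psi_c -> Hc F (strip_gt i) 1})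
         (ext1 : {linear Hc F (strip_gt i) 1 -> Hc F B' 1})
         (delta2 : {linear Phi alpha i -> Hc F B' 1})
         (ext2 : {linear Hc F B' 1 -> Psi}),
  [/\ is_induced u_cc, is_induced ext1 & is_induced ext2] /\
  is_connecting (strip_gt i `|` oray (c i) alpha) delta1 /\
  is_connecting (strip i) delta2 /\
  [/\ bijective delta1, bijective ext1 & bijective ext2] /\
  (forall x, ext1 (delta1 (v_cc x)) = delta2 x) /\
  let theta x := ext2 (ext1 (delta1 x)) in
  (forall x, u i (theta x) = u_cc x) /\ (forall x, v i x = theta (v_cc x)).

Definition pbar : (plane * (plane * R))%type -> plane := fst.
Lemma pbar_cont : continuous pbar.
Proof. by move=> p; exact: cvg_fst. Qed.

(* In plane * (plane * R) the coordinates are (z, (w, t)).  FS setT is the complex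
   representing the enhanced Fourier-Sato transform of F; more generally FS S
   is its tensor product with the inverse image of k_S, for S locally closed in
   the dual line, the tensor product being taken before the direct image with
   proper supports (projection formula). *)
Definition Zset (S : set plane) : set (plane * (plane * R))%type :=
  [set p | S p.2.1 /\ 0 <= p.2.2 + rep p.1 p.2.1].
Definition Lset (S : set plane) a i : set (plane * (plane * R))%type :=
  [set p | [/\ ray (c i) a p.1, S p.2.1 & 0 <= p.2.2 + rep (c i) p.2.1]].

Definition FS (S : set plane) : cpx R[i] (plane * R)%type :=
  shr_cpx (ten_cpx (Zset S) (pull_cpx pbar_cont F)).
Definition FSray (S : set plane) a : cpx R[i] (plane * R)%type :=
  sum_cpx (fun i => shr_cpx (ten_cpx (Lset S a i) (pull_cpx pbar_cont F))).
Definition FSrestr (S : set plane) a : chain (FS S) (FSray S a) :=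
  restr (pull_cpx pbar_cont F) (Zset S) (Lset S a).

(* the direct sum of the k_S tensor M i tensor E^(c_i w) *)
Definition Eexp (S : set plane) (M : 'I_n -> lmodType R[i]) :
    cpx R[i] (plane * R)%type :=
  single (sum_sheaf (fun i =>
    ten [set y : plane * R | S y.1 /\ 0 <= y.2 + rep (c i) y.1]
        (const (plane * R)%type (M i)))).

(* The canonical isomorphism from the sum of the Phi a i tensor E^(c_i w).  As
   RGamma_c (k_ray tensor F) is concentrated in degree 0, any linear choice rho of
   representatives identifies Phi a i with it. *)
Definition is_canonical S a (f : chain (Eexp S (Phi a)) (FSray S a)) :=
  exists2 rho : forall i, {linear Phi a i -> Gam (ten (ray (c i) a) (F 0))},
    (forall i x, class_of (C := Gam_cpx (ten_cpx _ F)) (rho i x) x) &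
    forall y (v : Eexp S (Phi a) 0 y) i z,
      subv (subv (f 0 y v i) z) = subv (subv (rho i (subv (v i))) z) :> F 0 z.

Definition is_tau i (tau : {linear Phi (- alpha) i -> Phi alpha i}) :=
  exists (res : {linear Hc F (strip_ge i) 0 -> Phi alpha i})
         (res' : {linear Hc F (strip_ge i) 0 -> Phi (- alpha) i}),
  [/\ is_induced res, is_induced res', bijective res & bijective res'] /\
  forall x, tau (res' x) = res x.

(* f acts through the block matrix A and the restriction maps between the
   exponentials *)
Definition is_matrix S (M N : 'I_n -> lmodType R[i])
    (A : forall i j, {linear M j -> N i}) (f : chain (Eexp S M) (Eexp S N)) :=
  forall y (v : Eexp S M 0 y) i,
    subv (f 0 y v i) =
    if 0 <= y.2 + rep (c i) y.1 then \sum_j A i j (subv (v j)) else 0.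

Definition is_diagonal S (M N : 'I_n -> lmodType R[i])
    (A : forall i, {linear M i -> N i}) (f : chain (Eexp S M) (Eexp S N)) :=
  forall y (v : Eexp S M 0 y) i, subv (f 0 y v i) = A i (subv (v i)).

(* [A] is the Stokes multiplier along the half-line h generated by [b] (beta or
   - beta).  On h, s_(+- alpha) is FSrestr followed by the inverse of the canonical
   isomorphism, and sigma = tau \o s_(- alpha) \o (s_alpha)^-1 is the morphism
   given by A in the category of enhanced sheaves. *)
Definition is_stokes (b : R[i])
    (A : forall i j, {linear Phi alpha j -> Phi alpha i}) :=
  let h := oray 0 b in
  (forall i j, rep (c j) b < rep (c i) b -> forall x, A i j x = 0) /\
  exists (tau : forall i, {linear Phi (- alpha) i -> Phi alpha i})
         (can : chain (Eexp h (Phi alpha)) (FSray h alpha))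
         (can' : chain (Eexp h (Phi (- alpha))) (FSray h (- alpha)))
         (tauE : chain (Eexp h (Phi (- alpha))) (Eexp h (Phi alpha)))
         (AE : chain (Eexp h (Phi alpha)) (Eexp h (Phi alpha)))
         (qrestr : quasi_iso (FSrestr h alpha)) (qcan' : quasi_iso can'),
  [/\ forall i, is_tau (tau i), is_canonical can, is_canonical can',
      is_diagonal tau tauE & is_matrix A AE] /\
  let E := @Eiso R[i] R plane in
  let s_inv := zbwd (zfwd (zid E _) can) (quasi_iso_Eiso qrestr) in
  let s_s_inv := zbwd (zfwd s_inv (FSrestr h (- alpha))) (quasi_iso_Eiso qcan') in
  eqz (zfwd s_s_inv tauE) (zfwd (zid E _) AE).
End Plane.

Section BlockMaps.
Variables (k : fieldType) (n : nat) (P : lmodType k) (M : 'I_n -> lmodType k).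

Definition block (A : forall i j, {linear M j -> M i}) (x : dfun M) : dfun M :=
  fun i => \sum_j A i j (x j).

Variables (u : forall i, {linear P -> M i}) (v : forall i, {linear M i -> P}).

(* u_i T_(i+1) ... T_n with T_j = 1 - v_j u_j *)
Definition Ucol (i : 'I_n) (y : P) : M i :=
  u i (foldr (fun j z => z - v j (u j z)) y
         [seq j : 'I_n <- enum 'I_n | (i < j)%N]).
Definition USigma (y : P) : dfun M := fun i => Ucol i y.
Definition VSigma (x : dfun M) : P := \sum_j v j (x j).
Definition TSigma (x : dfun M) : dfun M := x - USigma (VSigma x).
End BlockMaps.

(* Main.v *)
Require Import Defs.
From mathcomp Require Import all_boot all_order all_algebra.
From mathcomp Require Import all_classical all_reals.
From mathcomp Require Import complex topology normedtype.
From mathcomp Require Import lra ring.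
From Stdlib Require Import Relation_Operators.
Import Order.TTheory GRing.Theory Num.Theory.
Import numFieldNormedType.Exports.
Local Open Scope classical_set_scope.
Local Open Scope ring_scope.

(* Evaluate everything on a segment {b} x [t0, t1] of the (w, t)-space: the complex of
   sections over [t0, t1] vanishing at t0 is exact in the sheaf when it is computed
   with piecewise sections and their jumps, and it kills the inverse images from the
   w-space, so it is an invariant of enhanced sheaves.  With t0 << 0 << t1 it turns
   the Stokes multiplier along b into the following statement: for x in the sum of the
   Phi_k there is a cocycle Y on a closed half-plane {Re zb >= q} containing Sigma
   whose restrictions to the rays l_k(alpha) represent the x_k, and those to the
   l_k(-alpha) represent the tau^-1 of the components of S_b x.  Moreover, s_alpha
   being an isomorphism on every stalk, a cocycle on any half-plane {Re zb >= q} is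
   determined up to coboundary by its restrictions to the rays l_k(alpha) it contains.

   For x in Phi_j, v_j x is the class of ds, where s is supported in the strip of c_j
   and represents x on l_j.  The definition of u_i gives Y_i, supported on the right of
   c_i, representing u_i v_j x on l_i, and eta vanishing on the rays l_k(alpha), with
   d Y_i - ds = d eta.  Then Y - (s + eta - Y_i) (for b = beta, i < j), resp.
   s + eta - Y_i (for b = -beta, j <= i), is a cocycle on {p_beta >= r_i} whose
   restrictions to the rays are known, while eta, resp. Y - (s + eta), is a coboundary
   on {p_beta <= r_i}.  Comparison with an element of RGamma_c of the strip defining
   tau gives the entries. *)

Set Implicit Arguments.
Unset Strict Implicit.
Unset Printing Implicit Defensive.
Local Open Scope complex_scope.

(** * Piecewise sections along a line *)

Lemma near_segment (R : realType) (t : R) (P : R -> Prop) :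
  (\forall t' \near t, P t') ->
  exists2 e : R, 0 < e & forall t', t - e < t' < t + e -> P t'.
Proof.
move=> /nbhs_ballP[e /= e0 he]; exists e => // t' /andP[h1 h2]; apply: he.
by rewrite /ball /= distrC ltr_norml; apply/andP; split; lra.
Qed.

(** The local hypothesis at the supremum of the y with [Q a y] shows that it is such a y and that,
    unless it is b, some larger y is one too. This glues local primitives into one over the whole
    segment. *)
Lemma interval_induction (R : realType) (a b : R) (Q : R -> R -> Prop) :
  a <= b ->
  (forall x y z, a <= x -> x <= y -> y <= z -> z <= b -> Q x y -> Q y z -> Q x z) ->
  (forall t, a <= t <= b -> exists2 e, 0 < e & forall x y,
     a <= x -> t - e < x <= t -> t <= y < t + e -> y <= b -> Q x y) ->
  Q a b.
Proof.
move=> ab Qtr Qloc.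
pose A : set R := [set y | a <= y <= b /\ Q a y].
have Aa : A a.
  have aI : a <= a <= b by rewrite lexx.
  split => //; have [e e0] := Qloc _ aI; apply => //.
    by rewrite lexx andbT ltrBlDr ltrDl.
  by rewrite lexx ltrDl.
have hA : has_sup A by split; [exists a|exists b => y [/andP[]]].
have sb : sup A <= b by apply: ge_sup; [exists a|move=> y [/andP[]]].
have as_ : a <= sup A by exact: (ub_le_sup hA.2).
have sI : a <= sup A <= b by rewrite as_.
have [e e0 he] := Qloc _ sI.
have [x Ax xs] := sup_adherent e0 hA.
have xs' : x <= sup A by exact: (ub_le_sup hA.2).
have [/andP[ax xb] Qx] := Ax.
have Qy y : sup A <= y < sup A + e -> y <= b -> Q a y.
  move=> yI yb; apply: (Qtr a x) => //; first by rewrite (le_trans xs')//; case/andP: yI.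
  by apply: he => //; rewrite xs.
have [sE|sltb] := eqVneq (sup A) b; first by apply: Qy => //; rewrite sE lexx ltrDl.
have {sltb} sltb : sup A < b by rewrite lt_neqAle sltb.
(* Half of e keeps y strictly within reach of the local hypothesis. *)
pose y := Num.min b (sup A + e / 2).
have sy : sup A < y by rewrite lt_min sltb ltrDl divr_gt0.
have yb : y <= b by rewrite ge_min lexx.
have : A y.
  split; first by rewrite yb andbT (le_trans as_)// ltW.
  apply: Qy => //; rewrite (ltW sy) /= gt_min.
  by apply/orP; right; rewrite ltrD2l gtr_pMr// invf_lt1// ltr1n.
by move=> /(ub_le_sup hA.2) /(lt_le_trans sy); rewrite ltxx.
Qed.

Section LineSections.
Variables (k : fieldType) (R : realType) (M : topologicalType) (w : M).

Lemma near_line (P : (M * R)%type -> Prop) (t : R) :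
  (\forall p \near ((w, t) : (M * R)%type), P p) -> \forall t' \near t, P (w, t').
Proof.
move=> [[U V] /= [wU tV] UV]; apply: filterS tV => t' Vt'.
by apply: UV; split => //=; exact: nbhs_singleton wU.
Qed.

Section Piecewise.
Variable G : presh k (M * R)%type.
Implicit Types l r : forall t, G (w, t).

(** Germs come from sections near (w, t) in all of M * R, so that sheaf morphisms act on them. At t
    itself only one of the two limits is prescribed, which leaves room for a jump. *)
Definition right_germ l r (y t : R) := exists s : forall p, G p,
  [/\ cont (w, t) s, s (w, t) = r t &
      \forall t' \near t, t < t' <= y -> l t' = s (w, t') /\ r t' = s (w, t')].
Definition left_germ l r (x t : R) := exists s : forall p, G p,
  [/\ cont (w, t) s, s (w, t) = l t &
      \forall t' \near t, x <= t' < t -> l t' = s (w, t') /\ r t' = s (w, t')].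

(* Piecewise sections over the segment [x, y], [l] and [r] being the limits from
   the left and from the right. *)
Definition piecewise (x y : R) l r := forall t, x <= t <= y ->
  right_germ l r y t /\ left_germ l r x t.

(** By compactness of the segment this amounts to finite support; the local form is the one that the
    jumps of a piecewise section satisfy directly. *)
Definition isolated (x y : R) (j : forall t, G (w, t)) := forall t, x <= t <= y ->
  \forall t' \near t, t' != t -> x <= t' <= y -> j t' = 0.

Lemma piecewiseP x y c l r l' r' : piecewise x y l r -> piecewise x y l' r' ->
  piecewise x y (fun t => c *: l t + l' t) (fun t => c *: r t + r' t).
Proof.
move=> p p' t /[dup] /p[[s1 [c1 e1 n1]] [s2 [c2 e2 n2]]].
move=> /p'[[s3 [c3 e3 n3]] [s4 [c4 e4 n4]]]; split.
  exists (fun p => c *: s1 p + s3 p); split; [exact: contP|by rewrite e1 e3|].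
  by apply: filterS2 n1 n3 => t' h h' /[dup] /h[-> ->] /h'[-> ->].
exists (fun p => c *: s2 p + s4 p); split; [exact: contP|by rewrite e2 e4|].
by apply: filterS2 n2 n4 => t' h h' /[dup] /h[-> ->] /h'[-> ->].
Qed.

Lemma piecewise_eq x y l r l' r' : piecewise x y l r ->
  (forall t, x <= t <= y -> l t = l' t /\ r t = r' t) -> piecewise x y l' r'.
Proof.
move=> p e t /[dup] I /p[[s1 [c1 e1 n1]] [s2 [c2 e2 n2]]]; have [el er] := e _ I.
have [xt ty] := andP I; split.
  exists s1; split => //; first by rewrite e1.
  apply: filterS n1 => t' h /andP[tt' t'y].
  have [|<- <-] := e t'; first by rewrite t'y andbT (le_trans xt)// ltW.
  by apply: h; rewrite tt'.
exists s2; split => //; first by rewrite e2.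
apply: filterS n2 => t' h /andP[xt' t't].
have [|<- <-] := e t'; first by rewrite xt' (le_trans _ ty)// ltW.
by apply: h; rewrite xt'.
Qed.

(** At y the left limit is taken from the first piece and the right limit from the second: pieces
    are glued without any matching condition, and the mismatch becomes a jump. *)
Definition cat_left (y : R) l l' t : G (w, t) := if t <= y then l t else l' t.
Definition cat_right (y : R) r r' t : G (w, t) := if t < y then r t else r' t.

Lemma piecewise_cat x y z l r l' r' : x <= y -> y <= z ->
  piecewise x y l r -> piecewise y z l' r' ->
  piecewise x z (cat_left y l l') (cat_right y r r').
Proof.
rewrite /cat_left /cat_right.
move=> xy yz p p' t /andP[xt tz].
have [ty|yt|ty] := ltgtP t y.
- have [|[s1 [c1 e1 n1]] [s2 [c2 e2 n2]]] := p t; first by rewrite xt ltW.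
  have nt : \forall t' \near t, t' < y by exact: lt_nbhsl.
  split; [exists s1|exists s2]; split=> //; rewrite ?ty ?(ltW ty)//.
    apply: filterS2 n1 nt => t' h t'y /andP[tt' t'z]; rewrite t'y (ltW t'y).
    by apply: h; rewrite tt' ltW.
  apply: filterS2 n2 nt => t' h t'y /andP[tt' t'z]; rewrite t'y (ltW t'y).
  by apply: h; rewrite tt'.
- have [|[s1 [c1 e1 n1]] [s2 [c2 e2 n2]]] := p' t; first by rewrite tz ltW.
  have nt : \forall t' \near t, y < t' by exact: lt_nbhsr.
  split; [exists s1|exists s2]; split=> //; rewrite ?ltNge ?(ltW yt)//= ?leNgt ?yt//=.
    apply: filterS2 n1 nt => t' h t'y /andP[tt' t'z].
    rewrite !ltNge (ltW t'y) /= leNgt t'y /=.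
    by apply: h; rewrite tt'.
  apply: filterS2 n2 nt => t' h t'y /andP[tt' t'z].
  rewrite !ltNge (ltW t'y) /= leNgt t'y /=.
  by apply: h; rewrite t'z ltW.
- rewrite ty.
  have [|_ [s2 [c2 e2 n2]]] := p y; first by rewrite lexx andbT.
  have [|[s1 [c1 e1 n1]] _] := p' y; first by rewrite lexx.
  split; [exists s1|exists s2]; split=> //; rewrite ?lexx ?ltxx//.
    apply: filterS n1 => t' h /andP[tt' t'z].
    rewrite !ltNge (ltW tt') /= leNgt tt' /=.
    by apply: h; rewrite tt'.
  apply: filterS n2 => t' h /andP[tt' t'z].
  rewrite t'z (ltW t'z).
  by apply: h; rewrite tt'.
Qed.

Lemma isolatedP x y c j j' : isolated x y j -> isolated x y j' ->
  isolated x y (fun t => c *: j t + j' t).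
Proof.
move=> h h' t /[dup] /h n /h' n'; apply: filterS2 n n' => t' e e' n I.
by rewrite e// e'// scaler0 addr0.
Qed.

Lemma piecewise_isolated x y l r : piecewise x y l r ->
  isolated x y (fun t => r t - l t).
Proof.
move=> p t I; have [[s1 [c1 e1 n1]] [s2 [c2 e2 n2]]] := p _ I.
apply: filterS2 n1 n2 => t' h1 h2 n /andP[xt' t'y].
have := n; rewrite neq_lt => /orP[tt'|tt'].
  by have [|-> ->] := h2; [rewrite xt'|rewrite subrr].
by have [|-> ->] := h1; [rewrite tt'|rewrite subrr].
Qed.
End Piecewise.

Lemma piecewise_hom (G H : presh k (M * R)%type) (f : shom G H) x y l r :
  piecewise x y l r ->
  piecewise x y (fun t => f (w, t) (l t)) (fun t => f (w, t) (r t)).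
Proof.
move=> p t /p[[s1 [c1 e1 n1]] [s2 [c2 e2 n2]]]; split.
  exists (fun p => f p (s1 p)); split; [exact: shom_cont|by rewrite e1|].
  by apply: filterS n1 => t' h /h[-> ->].
exists (fun p => f p (s2 p)); split; [exact: shom_cont|by rewrite e2|].
by apply: filterS n2 => t' h /h[-> ->].
Qed.

Lemma isolated_hom (G H : presh k (M * R)%type) (f : shom G H) x y j :
  isolated x y j -> isolated x y (fun t => f (w, t) (j t)).
Proof.
by move=> h t /h; apply: filterS => t' + n I => /(_ n I) ->; rewrite linear0.
Qed.

Lemma piecewise_pair (G H : sheaf k (M * R)%type) x y l r l' r' :
  piecewise (G := G) x y l r -> piecewise (G := H) x y l' r' ->
  piecewise (G := add_sheaf G H) x y (fun t => (l t, l' t)) (fun t => (r t, r' t)).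
Proof.
move=> p p' t /[dup] /p[[s1 [c1 e1 n1]] [s2 [c2 e2 n2]]].
move=> /p'[[s3 [c3 e3 n3]] [s4 [c4 e4 n4]]]; split.
  exists (fun p => (s1 p, s3 p)); split; [by split|by rewrite e1 e3|].
  by apply: filterS2 n1 n3 => t' h h' /[dup] /h[-> ->] /h'[-> ->].
exists (fun p => (s2 p, s4 p)); split; [by split|by rewrite e2 e4|].
by apply: filterS2 n2 n4 => t' h h' /[dup] /h[-> ->] /h'[-> ->].
Qed.

Lemma piecewise_fst (G H : sheaf k (M * R)%type) x y l r :
  piecewise (G := add_sheaf G H) x y l r ->
  piecewise (G := G) x y (fun t => (l t).1) (fun t => (r t).1).
Proof.
move=> p t /p[[s1 [[c1 _] e1 n1]] [s2 [[c2 _] e2 n2]]]; split.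
  exists (fun p => (s1 p).1); split=> //; first by rewrite e1.
  by apply: filterS n1 => t' h /h[-> ->].
exists (fun p => (s2 p).1); split=> //; first by rewrite e2.
by apply: filterS n2 => t' h /h[-> ->].
Qed.

Lemma piecewise_snd (G H : sheaf k (M * R)%type) x y l r :
  piecewise (G := add_sheaf G H) x y l r ->
  piecewise (G := H) x y (fun t => (l t).2) (fun t => (r t).2).
Proof.
move=> p t /p[[s1 [[_ c1] e1 n1]] [s2 [[_ c2] e2 n2]]]; split.
  exists (fun p => (s1 p).2); split=> //; first by rewrite e1.
  by apply: filterS n1 => t' h /h[-> ->].
exists (fun p => (s2 p).2); split=> //; first by rewrite e2.
by apply: filterS n2 => t' h /h[-> ->].
Qed.
End LineSections.

(** * The complex of sections along a line *)

Lemma exact_atE (k : fieldType) (C : vcpx k) m (v : C (m + 1)) :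
  exact_at C (m + 1) -> vd C (m + 1) v = 0 -> exists u, v = vd C m u.
Proof. by move=> h /h /coboundE. Qed.

Section LineComplexes.
Variables (k : fieldType) (R : realType) (M : topologicalType) (w : M).
Variables (a b : R).
Hypothesis ab : a <= b.

Section Cochains.
Variable G : cpx k (M * R)%type.

(* The degree m + 1 part of the total complex: (cl, cr) is a piecewise section and cj a
   family concentrated at isolated points; the differential maps (s, j) to
   (ds, jump s - dj). *)
Record cochain (m : int) := Cochain {
  cl : forall t : R, G (m + 1) (w, t);
  cr : forall t : R, G (m + 1) (w, t);
  cj : forall t : R, G m (w, t) }.

(** [cl X a] is the limit from outside the segment. Setting it to 0 makes the sections relative to
    the left end, where a jump is still allowed since [cr X a] stays free. *)
Definition admissible m (X : cochain m) :=
  [/\ piecewise (G := G (m + 1)) a b (cl X) (cr X),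
      isolated (G := G m) a b (cj X) & cl X a = 0].

Definition ccycle m (X : cochain m) :=
  admissible X /\ forall t, a <= t <= b ->
  [/\ df G (m + 1) (w, t) (cl X t) = 0, df G (m + 1) (w, t) (cr X t) = 0 &
      cr X t - cl X t = df G m (w, t) (cj X t)].

Definition cbound m (X : cochain (m + 1)) := exists2 Y : cochain m,
  admissible Y & forall t, a <= t <= b ->
  [/\ cl X t = df G (m + 1) (w, t) (cl Y t),
      cr X t = df G (m + 1) (w, t) (cr Y t) &
      cj X t = cr Y t - cl Y t - df G m (w, t) (cj Y t)].

Definition line_acyclic := forall m (X : cochain (m + 1)), ccycle X -> cbound X.
End Cochains.

Lemma piecewise_sec (G : presh k (M * R)%type) (s : forall p, G p) x y :
  (forall t, x <= t <= y -> cont (w, t) s) ->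
  piecewise x y (fun t => s (w, t)) (fun t => s (w, t)).
Proof.
move=> cs t I; split.
  exists s; split; [exact: cs|by []|by apply: (@filterE _ (nbhs t)) => t' _; split].
exists s; split; [exact: cs|by []|by apply: (@filterE _ (nbhs t)) => t' _; split].
Qed.

(** Exactness on stalks gives primitives on both sides of each point. They glue with jumps, and the
    remaining defect in the jumps is a cocycle in each stalk, nonzero only at isolated points, where
    exactness is used once more. *)
Lemma acyclic_line (G : cpx k (M * R)%type) : acyclic G -> line_acyclic G.
Proof.
move=> acG m [l r j] [[/= pX iX l0] dX].
have lift_sec t (s : forall p, G (m + 1 + 1) p) :
  cont (w, t) s -> df G (m + 1 + 1) (w, t) (s (w, t)) = 0 ->
  exists f : forall p, G (m + 1) p,
    \forall t' \near t, cont (w, t') f /\ df G (m + 1) (w, t') (f (w, t')) = s (w, t').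
  move=> cs ds; have [u su] := exact_atE (acG (w, t) (m + 1 + 1)) ds.
  have [f cf fu] := cont_surj u; exists f.
  apply: (near_line (P := fun p => cont p f /\ df G (m + 1) p (f p) = s p)).
  (* A section that vanishes at a point vanishes near it, so a primitive at (w, t) is one nearby. *)
  have e : \forall p \near ((w, t) : (M * R)%type), df G (m + 1) p (f p) - s p = 0.
    have := cont_inj (contP (-1) cs (shom_cont (df G (m + 1)) cf)).
    rewrite /= fu [X in _ -> X]/=; rewrite su scaleN1r addNr => /(_ erefl).
    by apply: filterS => p; rewrite scaleN1r [- s p + _]addrC.
  by apply: filterS2 (cont_near cf) e => p cp /subr0_eq.
pose Q x y := exists l' r' : forall t, G (m + 1) (w, t),
  piecewise (G := G (m + 1)) x y l' r' /\
  forall t, x <= t <= y -> df G (m + 1) (w, t) (l' t) = l t /\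
                           df G (m + 1) (w, t) (r' t) = r t.
have [l' [r' [p' d']]] : Q a b.
  apply: interval_induction => //.
    move=> x y z ax xy yz zb [l1 [r1 [p1 d1]]] [l2 [r2 [p2 d2]]].
    exists (cat_left y l1 l2), (cat_right y r1 r2); split.
      exact: piecewise_cat.
    move=> t /andP[xt tz]; rewrite /cat_left /cat_right.
    have [ty|ty|ty] := ltgtP t y.
    - by apply: d1; rewrite xt ltW.
    - by apply: d2; rewrite tz ltW.
    - by subst y; split; [apply: (d1 _ _).1; rewrite xt lexx|apply: (d2 _ _).2; rewrite tz lexx].
  move=> t tI; have [[s1 [c1 e1 n1]] [s2 [c2 e2 n2]]] := pX _ tI.
  have [dl dr _] := dX _ tI.
  have [f1 h1] := lift_sec t s1 c1 (etrans (congr1 _ e1) dr).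
  have [f2 h2] := lift_sec t s2 c2 (etrans (congr1 _ e2) dl).
  have [e e0 he] := near_segment (filterI (filterI n1 n2) (filterI h1 h2)).
  exists e => // x y ax /andP[ex xt] /andP[ty ey] yb.
  exists (cat_left t (fun t => f2 (w, t)) (fun t => f1 (w, t))).
  exists (cat_right t (fun t => f2 (w, t)) (fun t => f1 (w, t))).
  split.
    apply: piecewise_cat => //; apply: piecewise_sec => t' /andP[h h'].
      by have [|_ [_ []]] := he t' => //; rewrite (lt_le_trans ex)// (le_lt_trans h')// ltrDl.
    have [|_ [[]]] := he t' => //; rewrite (le_lt_trans h')// (lt_le_trans _ h)//.
    by rewrite ltrBlDr ltrDl.
  move=> t' /andP[xt' t'y]; rewrite /cat_left /cat_right.
  have [|[hr hl] [[_ d1] [_ d2]]] := he t'.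
    by rewrite (lt_le_trans ex)// (le_lt_trans t'y).
  have [t't|t't|t'E] := ltgtP t' t.
  - by have [|-> ->] := hl; rewrite ?t't ?(le_trans ax).
  - by have [|-> ->] := hr; rewrite ?t't ?(le_trans _ yb).
  - by subst t'; rewrite d1 d2 e1 e2.
have aI : a <= a <= b by rewrite lexx.
pose z t : G (m + 1) (w, t) := 0.
(* Only the left limit at a is changed to 0; it is still a primitive there because [l a] is 0. *)
pose l'' := cat_left a z l'.
have p'' : piecewise (G := G (m + 1)) a b l'' r'.
  have pz : piecewise (G := G (m + 1)) a a z z.
    by apply: (piecewise_sec (s := fun=> 0)) => t _; exact: cont0.
  apply: piecewise_eq (piecewise_cat (lexx a) ab pz p') _ => t /andP[a_t _].
  by rewrite /cat_right ltNge a_t.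
have d'' t : a <= t <= b -> df G (m + 1) (w, t) (l'' t) = l t /\
    df G (m + 1) (w, t) (r' t) = r t.
  move=> tI; have [dl dr] := d' _ tI; split => //; rewrite /l'' /cat_left.
  case: ifP => // ta; have -> : t = a by apply: le_anti; rewrite ta; case/andP: tI.
  by rewrite linear0 l0.
(* Choosing 0 wherever the defect vanishes makes the resulting family isolated. *)
have hj t : {j' : G m (w, t) | (r' t - l'' t - j t = 0 -> j' = 0) /\
    (a <= t <= b -> df G m (w, t) j' = r' t - l'' t - j t)}.
  apply: cid; have [z0|/eqP nz] := pselect (r' t - l'' t - j t = 0).
    by exists 0; rewrite z0 linear0.
  have [tI|tI] := boolP (a <= t <= b); last by exists 0.
  have [|u eu] := @exact_atE _ (stalk_cpx G (w, t)) m (r' t - l'' t - j t)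
    (acG (w, t) (m + 1)).
    have [dl dr dj] := dX _ tI; have [dl' dr'] := d'' _ tI.
    by rewrite /= !linearB dl' dr' -dj subrr.
  by exists u; split => // z0; case/eqP: nz.
exists (@Cochain G m l'' r' (fun t => sval (hj t))).
  split => //=; last by rewrite /l'' /cat_left lexx.
  move=> t tI; apply: filterS2 (iX t tI) (piecewise_isolated p'' tI).
  move=> t' h h' n I; apply: (svalP (hj t')).1.
  by rewrite h// h'// subrr.
move=> t tI /=; have [el er] := d'' _ tI; split => //.
by rewrite (svalP (hj t)).2// subKr.
Qed.

(** Along the line the inverse image is constant with stalk H w, so sections are locally constant
    and, for a cocycle, jump by the differential of [j]. The running sum of the [j t], starting from
    0 at a, is then a primitive. *)
Lemma pullback_line (H : cpx k M) : line_acyclic (pull_cpx (@pi_M_cont R M) H).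
Proof.
move=> m [l r j] [[/= pX iX l0] dX].
set G := pull_cpx (@pi_M_cont R M) H in l r j pX iX l0 dX *.
have const_germ n t (s : forall p, G n p) : cont (w, t) s ->
    \forall t' \near t, s (w, t') = s (w, t) :> H n w.
  move=> [q cq sq].
  have st : s (w, t) = q w by exact: (nbhs_singleton sq).
  have := near_line (P := fun p => s p = q (pi_M p)) sq.
  by apply: filterS => t' ->; rewrite st.
have const_pw n (v : H n w) x y : piecewise (G := G n) x y (fun=> v) (fun=> v).
  have [s cs <-] := cont_surj v.
  apply: (piecewise_sec (G := G n) (s := fun p => s (pi_M p))) => t _.
  by exists s => //; apply: (@filterE _ (nbhs ((w, t) : (M * R)%type))).
(* Every initial value is allowed, so that consecutive pieces can be matched exactly: no jump other
   than [j] may appear. *)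
pose Q x y := forall v0 : H (m + 1) w, df H (m + 1) w v0 = l x ->
  exists l' r' : R -> H (m + 1) w,
  [/\ piecewise (G := G (m + 1)) x y l' r', l' x = v0 &
  forall t, x <= t <= y -> [/\ df H (m + 1) w (l' t) = l t,
    df H (m + 1) w (r' t) = r t & r' t - l' t = j t]].
have [l' [r' [p' l'0 d']]] : exists l' r' : R -> H (m + 1) w,
  [/\ piecewise (G := G (m + 1)) a b l' r', l' a = 0 &
  forall t, a <= t <= b -> [/\ df H (m + 1) w (l' t) = l t,
    df H (m + 1) w (r' t) = r t & r' t - l' t = j t]].
  suff : Q a b by apply; rewrite linear0 l0.
  apply: interval_induction => //.
    move=> x y z ax xy yz zb Q1 Q2 v0 dv0.
    have [l1 [r1 [p1 e1 d1]]] := Q1 _ dv0.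
    have yI : x <= y <= y by rewrite xy lexx.
    have yI' : y <= y <= z by rewrite yz lexx.
    have [dl1 dr1 dj1] := d1 _ yI.
    have [l2 [r2 [p2 e2 d2]]] := Q2 _ dl1.
    exists (cat_left (G := G (m + 1)) (w := w) y l1 l2).
    exists (cat_right (G := G (m + 1)) (w := w) y r1 r2); split.
    - exact: piecewise_cat.
    - by rewrite /cat_left xy.
    move=> t /andP[xt tz]; rewrite /cat_left /cat_right.
    have [ty|ty|ty] := ltgtP t y.
    - by apply: d1; rewrite xt ltW.
    - by apply: d2; rewrite tz ltW.
    - by subst y; have [dl2 dr2 dj2] := d2 _ yI'; rewrite -e2 in dl1 dj1 *.
  move=> t tI; have [[s1 [c1 e1 n1]] [s2 [c2 e2 n2]]] := pX _ tI.
  have [dl dr dj] := dX _ tI.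
  have [e e0 he] := near_segment (filterI (filterI n1 n2)
    (filterI (iX _ tI) (filterI (const_germ _ _ _ c1) (const_germ _ _ _ c2)))).
  exists e => // x y ax /andP[ex xt] /andP[ty ey] yb v0 dv0.
  have lx : l x = l t.
    have [->//|nxt] := eqVneq x t; have {nxt} xt' : x < t by rewrite lt_neqAle nxt.
    have [|[_ hl] [_ [_ h2]]] := he x; first by rewrite ex (le_lt_trans xt)// (le_lt_trans ty).
    by have [|-> _] := hl; rewrite ?ax // h2 e2.
  exists (cat_left (G := G (m + 1)) (w := w) t (fun=> v0) (fun=> v0 + j t)).
  exists (cat_right (G := G (m + 1)) (w := w) t (fun=> v0) (fun=> v0 + j t)).
  split.
  - exact: piecewise_cat.
  - by rewrite /cat_left xt.
  have drt : df H (m + 1) w (v0 + j t) = r t.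
    by rewrite linearD dv0 lx -[df H (m + 1) w (j t)]dj [l t + _]addrC subrK.
  move=> t' /andP[xt' t'y]; rewrite /cat_left /cat_right.
  have [|[hr hl] [hj [h1 h2]]] := he t'.
    by rewrite (lt_le_trans ex)// (le_lt_trans t'y).
  have t'I : a <= t' <= b by rewrite (le_trans ax)// (le_trans _ yb).
  have [t't|t't|t'E] := ltgtP t' t.
  - have [|-> ->] := hl; first by rewrite t't (le_trans ax).
    by rewrite hj// ?lt_eqF// h2 e2 subrr dv0 lx.
  - have [|-> ->] := hr; first by rewrite t't (le_trans _ yb).
    by rewrite hj// ?gt_eqF// h1 e1 subrr drt.
  - by subst t'; rewrite drt dv0 lx [v0 + _]addrC addrK.
have aI : a <= a <= b by rewrite lexx.
exists (@Cochain G m l' r' (fun=> 0)).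
  by split => //= t _; apply: (@filterE _ (nbhs t)).
move=> t /d'[dl dr dj]; split; [exact: esym dl|exact: esym dr|].
by rewrite linear0 subr0; exact: esym dj.
Qed.
End LineComplexes.

(** * Invariance in the category of enhanced sheaves *)

Section LineFunctor.
Variables (k : fieldType) (R : realType) (M : topologicalType) (w : M).
Variables (a b : R).
Hypothesis ab : a <= b.
Notation cochain := (cochain (k := k) (R := R) (M := M) w).
Notation ccycle := (ccycle (k := k) (R := R) (M := M) (w := w) a b).
Notation cbound := (cbound (k := k) (R := R) (M := M) (w := w) a b).
Notation line_acyclic := (line_acyclic (k := k) (R := R) (M := M) w a b).

Section Linear.
Variable G : cpx k (M * R)%type.

Definition clin m (c : k) (X Y : cochain G m) : cochain G m :=
  Cochain (fun t => c *: cl X t + cl Y t) (fun t => c *: cr X t + cr Y t)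
          (fun t => c *: cj X t + cj Y t).

Lemma cochain_eq m (X Y : cochain G m) :
  (forall t, cl X t = cl Y t) -> (forall t, cr X t = cr Y t) ->
  (forall t, cj X t = cj Y t) -> X = Y.
Proof.
case: X Y => l r j [l' r' j'] /= el er ej; congr Cochain;
  exact: functional_extensionality_dep.
Qed.

Lemma admissibleP m c (X Y : cochain G m) :
  admissible a b X -> admissible a b Y -> admissible a b (clin c X Y).
Proof.
move=> [pX iX X0] [pY iY Y0]; split.
- exact: piecewiseP.
- exact: isolatedP.
- by rewrite /= X0 Y0 scaler0 addr0.
Qed.

Lemma ccycleP m c (X Y : cochain G m) :
  ccycle X -> ccycle Y -> ccycle (clin c X Y).
Proof.
move=> [aX dX] [aY dY]; split; first exact: admissibleP.
move=> t /[dup] /dX[lX rX jX] /dY[lY rY jY]; split => /=.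
- by rewrite linearP lX lY scaler0 addr0.
- by rewrite linearP rX rY scaler0 addr0.
- by rewrite [RHS]linearP -jX -jY scalerBr opprD addrACA.
Qed.

Lemma cboundP m c (X Y : cochain G (m + 1)) :
  cbound X -> cbound Y -> cbound (clin c X Y).
Proof.
move=> [X' aX dX] [Y' aY dY]; exists (clin c X' Y'); first exact: admissibleP.
move=> t /[dup] /dX[lX rX jX] /dY[lY rY jY]; split => /=.
- by rewrite linearP lX lY.
- by rewrite linearP rX rY.
rewrite [df G m _ _]linearP jX jY !scalerBr !opprD.
by rewrite [X in _ = X + _]addrACA [RHS]addrACA.
Qed.

Lemma ccycle0 m (X : cochain G m) :
  (forall t, cl X t = 0) -> (forall t, cr X t = 0) -> (forall t, cj X t = 0) ->
  ccycle X.
Proof.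
move=> l0 r0 j0; split.
  split => //; last by move=> t _; apply: (@filterE _ (nbhs t)).
  apply: piecewise_eq (piecewise_sec (s := fun=> 0) _) _.
    by move=> t _; exact: cont0.
  by move=> t _.
by move=> t _; rewrite l0 r0 j0 !linear0 addr0.
Qed.

Lemma cbound0 m (X : cochain G (m + 1)) :
  (forall t, cl X t = 0) -> (forall t, cr X t = 0) -> (forall t, cj X t = 0) ->
  cbound X.
Proof.
move=> l0 r0 j0; pose Y : cochain G m := Cochain (fun=> 0) (fun=> 0) (fun=> 0).
have [aY _] : ccycle Y by exact: ccycle0.
by exists Y => // t _; rewrite l0 r0 j0 /= !linear0 !addr0.
Qed.

Definition ceq m (X Y : cochain G (m + 1)) := cbound (clin (-1) Y X).

Lemma ceq_refl m (X : cochain G (m + 1)) : ceq X X.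
Proof. by apply: cbound0 => t /=; rewrite scaleN1r addNr. Qed.

Lemma ceq_sym m (X Y : cochain G (m + 1)) : ceq X Y -> ceq Y X.
Proof.
move=> h; have := cboundP (-1) h (ceq_refl X).
congr cbound; apply: cochain_eq => t /=;
  by rewrite !scaleN1r addNr addr0 opprD opprK [LHS]addrC.
Qed.

Lemma ceq_trans m (X Y Z : cochain G (m + 1)) : ceq X Y -> ceq Y Z -> ceq X Z.
Proof.
have telescope (V : zmodType) (x y z : V) : - y + x + (- z + y) = - z + x.
  by rewrite addrCA [- y + x + y]addrAC addNr add0r.
move=> h /(cboundP 1 h); congr cbound; apply: cochain_eq => t /=;
  by rewrite !scaleN1r scale1r telescope.
Qed.
End Linear.

(** * The long exact sequence of a cone, on line cocycles *)

Section Push.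
Variables (F G : cpx k (M * R)%type) (f : chain F G).

Definition push m (X : cochain F m) : cochain G m :=
  Cochain (fun t => f (m + 1) (w, t) (cl X t)) (fun t => f (m + 1) (w, t) (cr X t))
          (fun t => f m (w, t) (cj X t)).

Lemma push_lin m c (X Y : cochain F m) :
  push (clin c X Y) = clin c (push X) (push Y).
Proof. by apply: cochain_eq => t /=; rewrite linearP. Qed.

Lemma admissible_push m (X : cochain F m) :
  admissible a b X -> admissible a b (push X).
Proof.
move=> [pX iX X0]; split.
- exact: piecewise_hom.
- exact: isolated_hom.
- by rewrite /= X0 linear0.
Qed.

Lemma ccycle_push m (X : cochain F m) : ccycle X -> ccycle (push X).
Proof.
move=> [aX dX]; split; first exact: admissible_push.
move=> t /dX[lX rX jX]; rewrite /= -!chain_d lX rX -jX !linear0 linearB.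
by split.
Qed.

Lemma cbound_push m (X : cochain F (m + 1)) : cbound X -> cbound (push X).
Proof.
move=> [Y aY dY]; exists (push Y); first exact: admissible_push.
move=> t /dY[lX rX jX]; rewrite /= -!chain_d lX rX jX !linearB.
by split.
Qed.

Lemma ceq_push m (X Y : cochain F (m + 1)) : ceq X Y -> ceq (push X) (push Y).
Proof. by move=> /cbound_push; rewrite push_lin. Qed.

Hypothesis acf : line_acyclic (cone f).

(* The complex of the cone is the cone of the complexes, up to the sign of cj on the
   first summand. *)
Let pw_cone n (l r : forall t, F (n + 1) (w, t)) (l' r' : forall t, G n (w, t)) :
  piecewise (G := F (n + 1)) a b l r -> piecewise (G := G n) a b l' r' ->
  piecewise (G := cone f n) a b (fun t => (l t, l' t)) (fun t => (r t, r' t)).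
Proof. exact: piecewise_pair. Qed.

Let iso_cone n (j : forall t, F (n + 1) (w, t)) (j' : forall t, G n (w, t)) :
  isolated (G := F (n + 1)) a b j -> isolated (G := G n) a b j' ->
  isolated (G := cone f n) a b (fun t => (j t, j' t)).
Proof.
move=> h h' t /[dup] /h n1 /h' n2; apply: filterS2 n1 n2 => t' e e' ne I.
by rewrite e// e'.
Qed.

(** When [push X] is the coboundary of Y, the pair (X, - Y) is a cocycle of the cone, and the first
    component of a primitive of it is, up to signs, a primitive of X. *)
Lemma push_inj m (X : cochain F (m + 1 + 1)) :
  ccycle X -> cbound (push X) -> cbound X.
Proof.
move=> [aX dX] [Y aY dY].
pose O n (H : cpx k (M * R)%type) : cochain H n := Cochain (fun=> 0) (fun=> 0) (fun=> 0).
have aO n H : admissible a b (O n H) by apply: (ccycle0 (X := O n H) _ _ _).1.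
have [pX iX X0] := aX.
have [_ nX _] := admissibleP (-1) aX (aO _ _).
have [pY iY Y0] := admissibleP (-1) aY (aO _ _).
pose C : cochain (cone f) (m + 1) := @Cochain _ _ _ w (cone f) (m + 1)
  (fun t => (cl X t, cl (clin (-1) Y (O _ _)) t))
  (fun t => (cr X t, cr (clin (-1) Y (O _ _)) t))
  (fun t => (cj (clin (-1) X (O _ _)) t, cj (clin (-1) Y (O _ _)) t)).
have [|[l r j] [/= pZ iZ Z0] dZ] := acf (X := C).
  split; first by split; [exact: pw_cone|exact: iso_cone|rewrite /= X0; congr (_, _); exact: Y0].
  move=> t tI; have [lX rX jX] := dX t tI; have [lY rY jY] := dY t tI.
  rewrite /= /cone_fun /= !addr0 !scaleN1r; split.
  - by rewrite lX oppr0 !linearN -lY subrr.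
  - by rewrite rX oppr0 !linearN -rY subrr.
  congr (_, _) => /=; first by rewrite linearN opprK.
  rewrite [f _ _ _]linearN [df G _ _ _]linearN [f _ _ _]jY -[RHS]opprD subrK.
  by rewrite -[LHS]opprD.

exists (Cochain (fun t => -1 *: (l t).1 + 0) (fun t => -1 *: (r t).1 + 0)
          (fun t => (j t).1)).
  split => /=.
  - apply: piecewiseP; last by case: (aO (m + 1) F).
    exact: piecewise_fst pZ.
  - by move=> t /iZ; apply: filterS => t' h n I; rewrite h.
  - by rewrite Z0 scaler0 addr0.
move=> t /dZ; rewrite /= /cone_fun /= => -[[lX _] [rX _] [jX _]].
rewrite !addr0 !scaleN1r; split; [by rewrite linearN|by rewrite linearN|].
rewrite -[LHS]opprK; move: jX; rewrite scaleN1r addr0 => ->.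
by rewrite !opprK !opprD !opprK.
Qed.

(** The pair (0, Y) is a cocycle of the cone. A primitive of it has for first component, up to sign,
    a cocycle X, and its second component bounds the difference of Y and [push X]. *)
Lemma push_surj m (Y : cochain G (m + 1)) : ccycle Y ->
  exists2 X : cochain F (m + 1), ccycle X & ceq Y (push X).
Proof.
move=> [[pY iY Y0] dY].
pose O n (H : cpx k (M * R)%type) : cochain H n := Cochain (fun=> 0) (fun=> 0) (fun=> 0).
have aO n H : admissible a b (O n H) by apply: (ccycle0 (X := O n H) _ _ _).1.
pose C : cochain (cone f) (m + 1) := @Cochain _ _ _ w (cone f) (m + 1)
  (fun t => (0, cl Y t)) (fun t => (0, cr Y t)) (fun t => (0, cj Y t)).
have [|[l r j] [/= pZ iZ Z0] dZ] := acf (X := C).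
  split.
    have [pO iO _] := aO (m + 1 + 1) F; have [_ iO' _] := aO (m + 1 + 1) F.
    split; [exact: pw_cone|exact: iso_cone|by rewrite /= Y0].
  move=> t tI; have [lY rY jY] := dY t tI.
  rewrite /= /cone_fun /= !linear0 !add0r lY rY -jY; split => //.
  by congr (_, _); rewrite subr0.
pose X : cochain F (m + 1) := Cochain (fun t => (l t).1) (fun t => (r t).1)
  (fun t => -1 *: (j t).1 + 0).
exists X.
  split.
    split => /=; [exact: piecewise_fst pZ| |by rewrite Z0].
    apply: isolatedP; last by case: (aO (m + 1) F).
    by move=> t /iZ; apply: filterS => t' h n I; rewrite h.
  move=> t /dZ; rewrite /= /cone_fun /= => -[[lX _] [rX _] [jX _]].
  split.
  - by rewrite -[LHS]opprK -lX oppr0.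
  - by rewrite -[LHS]opprK -rX oppr0.
  by rewrite addr0 scaleN1r linearN; apply/eqP; rewrite -subr_eq0 -jX.
exists (Cochain (fun t => (l t).2) (fun t => (r t).2) (fun t => (j t).2)).
  split => /=; [exact: piecewise_snd pZ| |by rewrite Z0].
  by move=> t /iZ; apply: filterS => t' h n I; rewrite h.
move=> t /dZ; rewrite /= /cone_fun /= => -[[_ lY] [_ rY] [_ jY]].
rewrite lY rY jY !scaleN1r !addKr; split => //.
by rewrite addr0 linearN opprK opprD addrCA [f _ _ _ + _]addrA subrr add0r.
Qed.
End Push.

(** The cones along the zigzag are acyclic, so each of its arrows is bijective on classes of line
    cocycles. *)
Lemma qis_line_acyclic (F G : cpx k (M * R)%type) :
  qis_equiv F G -> line_acyclic F <-> line_acyclic G.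
Proof.
elim=> {F G} [F G [f qf]|F|F G _ [h1 h2]|F G H _ [h1 h2] _ [h3 h4]];
  [|by split|by split|by split; auto].
have acf := acyclic_line (w := w) ab qf; split=> ac m X cX.
  have [Y cY XY] := push_surj acf cX.
  have /(cbound_push f) bY := ac _ _ cY.
  have := cboundP 1 XY bY; congr cbound; apply: cochain_eq => t /=;
    by rewrite scaleN1r scale1r [- _ + _]addrC subrK.
(* [push_inj] needs a degree with two successors, hence m is written as p + 1. *)
have : m - 1 + 1 = m by rewrite subrK.
move: (m - 1) => p e; case: m / e X cX => X cX.
by apply: (push_inj acf cX); apply: ac; exact: ccycle_push.
Qed.

(** The cone is quasi-isomorphic to an inverse image from M, which the line complexes kill: this
    makes them invariants of enhanced sheaves. *)
Lemma Eiso_line_acyclic (F G : cpx k (M * R)%type) (f : chain F G) :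
  Eiso f -> line_acyclic (cone f).
Proof. by case=> H /qis_line_acyclic h; apply/h/pullback_line. Qed.

(** * Action of the localized category on line cocycles *)

Section Zigzags.
Variable n : int.
Let E := @Eiso k R M.

(* Zigzags act as relations between line cocycles, the morphisms of E inducing
   bijections on their classes. *)
Fixpoint zrel F G (p : zz E F G) (X : cochain F (n + 1 + 1)) :
    cochain G (n + 1 + 1) -> Prop :=
  match p in zz _ _ G return cochain G (n + 1 + 1) -> Prop with
  | zid => fun Y => ceq X Y
  | zfwd _ _ p f => fun Y => exists Z, [/\ ccycle Z, zrel p X Z & ceq (push f Z) Y]
  | zbwd _ _ p f _ => fun Y => exists Z, [/\ ccycle Z, zrel p X Z & ceq (push f Y) Z]
  end.

Lemma zrel_ceq F G (p : zz E F G) X Y Z : zrel p X Y -> ceq Y Z -> zrel p X Z.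
Proof.
case: p Y Z => [|H K p f|H K p f h] Y Z /=; first exact: ceq_trans.
  by move=> [U [cU pU e]] e'; exists U; split => //; exact: ceq_trans e'.
move=> [U [cU pU e]] e'; exists U; split => //; apply: ceq_trans e.
exact/ceq_push/ceq_sym.
Qed.

Lemma push_ceq_inj F G (f : chain F G) (X Y : cochain F (n + 1 + 1)) :
  E f -> ccycle X -> ccycle Y -> ceq (push f X) (push f Y) -> ceq X Y.
Proof.
move=> /Eiso_line_acyclic acf cX cY; rewrite /ceq -push_lin.
by apply: push_inj => //; exact: ccycleP.
Qed.

(** Induction over the generators of the congruence. The two cancellation rules for a formally
    inverted arrow rest on the surjectivity and the injectivity of [push] on classes. *)
Lemma eqz_zrel F G (p q : zz E F G) : eqz p q ->
  forall X Y, ccycle Y -> zrel p X Y <-> zrel q X Y.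
Proof.
elim=> {G p q} [//|G p q _ IH|G p q r _ IH1 _ IH2|G H p q f _ IH|
  G H p q f h _ IH|G H p f g fg|G p|G H K p f g|G H p f h|G H p f h] X Y cY.
- by split=> /IH; apply.
- by split=> [/IH1|/IH2] => [/(_ cY)/IH2|/(_ cY)/IH1]; apply.
- by split=> -[Z [cZ pZ e]]; exists Z; split => //; apply/IH.
- by split=> -[Z [cZ pZ e]]; exists Z; split => //; apply/IH.
- have fgE Z : push f Z = push g Z by apply: cochain_eq => t; exact: fg.
  by split=> -[Z [cZ pZ e]]; exists Z; split => //; rewrite ?fgE// -fgE.
- split=> [[Z [cZ pZ e]]|pY]; first exact: zrel_ceq pZ e.
  by exists Y; split => //; exact: ceq_refl.
- split=> [[Z [cZ [U [cU pU e]]] e']|[Z [cZ pZ e]]].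
    by exists U; split => //; apply: ceq_trans e'; exact: (ceq_push g e).
  exists (push f Z); split; [exact: ccycle_push| |exact: e].
  by exists Z; split => //; exact: ceq_refl.
- split=> [[Z [cZ [U [cU pU e]]] e']|pY].
    exact: zrel_ceq (zrel_ceq pU (ceq_sym e)) e'.
  have [Z cZ e] := push_surj (Eiso_line_acyclic h) cY.
  exists Z; split => //; last exact: ceq_sym.
  by exists Y; split => //; exact: ceq_sym.
- split=> [[Z [cZ [U [cU pU e]]] e']|pY].
    apply: zrel_ceq pU _; apply: push_ceq_inj h cU cY _.
    exact: ceq_trans e (ceq_sym e').
  exists (push f Y); split; [exact: ccycle_push| |exact: ceq_refl].
  by exists Y; split => //; exact: ceq_refl.
Qed.
End Zigzags.
End LineFunctor.

(** * Sections with compact support *)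

Section Lift.
Variables (k : fieldType) (X : topologicalType) (P : presh k X).

(** The value 0 is a default at points where [s] is not a section; it never occurs near a point
    where [s] is one. *)
Definition stalk_lift (s : forall y, P y) y : etale P y :=
  if pselect (cont y s) is left h
  then @SubT k _ (stalk_sub P y) (s y) (asboolT (ex_intro2 _ _ s h erefl)) else 0.

Lemma stalk_liftE s y : cont y s -> subv (stalk_lift s y) = s y.
Proof. by move=> cs; rewrite /stalk_lift; case: pselect. Qed.

Lemma stalk_lift_cont s x : cont x s -> cont (p := etale P) x (stalk_lift s).
Proof.
move=> cs; rewrite /= /econt; apply: cont_ext (cs) _.
by apply: filterS (cont_near cs) => y cy; rewrite stalk_liftE.
Qed.

End Lift.

Section Sections.
Variables (k : fieldType) (X : topologicalType).

(* Sections of k_S tensor F with compact support, given by their values. *)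
Definition csec (S : set X) (F : sheaf k X) (s : forall x, F x) :=
  (forall x, ten_cont S x s) /\ exists2 A, compact A & forall x, ~ A x -> s x = 0.

(** Two subtypes are removed, so that values lie in F x whatever S is: sections over different
    subsets can be added and compared pointwise. *)
Definition gval (S : set X) (F : sheaf k X) (g : Gam (ten S F)) x : F x :=
  subv (subv g x).

Lemma csec_gval (S : set X) (F : sheaf k X) (g : Gam (ten S F)) : csec S (gval g).
Proof.
have /asboolP[cg [A kA gA]] := Defs.subvP g; split; first exact: cg.
by exists A => // x /gA e; rewrite /gval e.
Qed.

Lemma gval_ex (S : set X) (F : sheaf k X) s : csec S s ->
  exists g : Gam (ten S F), gval g = s.
Proof.
move=> [cs [A kA sA]].
have m : gam_mem (G := ten S F) (stalk_lift (P := ten_presh S F) s).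
  split; first by move=> x; apply: (stalk_lift_cont (P := ten_presh S F)); exact: cs.
  exists A => // x nAx; apply: val_inj.
  by rewrite [val _](@stalk_liftE _ _ (ten_presh S F) s x (cs x)) sA.
exists (@SubT _ _ (gam_sub (ten S F)) _ (asboolT m)); apply: functional_extensionality_dep => x.
exact: (@stalk_liftE _ _ (ten_presh S F) s x (cs x)).
Qed.

Lemma csecP (S : set X) (F : sheaf k X) a (s t : forall x, F x) :
  csec S s -> csec S t -> csec S (fun x => a *: s x + t x).
Proof.
move=> [cs [A kA sA]] [ct [B kB tB]]; split; first by move=> x; exact: tenP.
exists (A `|` B); first exact: compactU.
by move=> x /not_orP[nA nB]; rewrite sA// tB// scaler0 addr0.
Qed.

Lemma csec_eq (S : set X) (F : sheaf k X) (s t : forall x, F x) :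
  csec S s -> (forall x, s x = t x) -> csec S t.
Proof. by move=> cs st; have <- : s = t by exact: functional_extensionality_dep. Qed.

Lemma csec0 (S : set X) (F : sheaf k X) : csec S (fun x => 0 : F x).
Proof. by split; [exact: ten0|exists set0 => //; exact: compact0]. Qed.

Lemma csecD (S : set X) (F : sheaf k X) (s t : forall x, F x) :
  csec S s -> csec S t -> csec S (fun x => s x + t x).
Proof.
by move=> cs ct; apply: csec_eq (csecP 1 cs ct) _ => x; rewrite scale1r.
Qed.

Lemma csecB (S : set X) (F : sheaf k X) (s t : forall x, F x) :
  csec S s -> csec S t -> csec S (fun x => s x - t x).
Proof.
move=> cs ct; apply: csec_eq (csecP (-1) ct cs) _ => x.
by rewrite scaleN1r addrC.
Qed.

Lemma csec_out (S : set X) (F : sheaf k X) (s : forall x, F x) x :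
  csec S s -> ~ S x -> s x = 0.
Proof. by move=> [cs _]; exact: nbhs_singleton (ten_out (cs x)). Qed.

(** One formula for restriction to a closed subset and for extension by zero from an open one;
    [kadm] guarantees that the result is a section. *)
Definition restrict (S : set X) (F : sheaf k X) (s : forall x, F x) x : F x :=
  if `[< S x >] then s x else 0.

Lemma restrict_in (S : set X) (F : sheaf k X) (s : forall x, F x) x :
  S x -> restrict S s x = s x.
Proof. by move=> Sx; rewrite /restrict asboolT. Qed.

Lemma restrict_out (S : set X) (F : sheaf k X) (s : forall x, F x) x :
  ~ S x -> restrict S s x = 0.
Proof. by move=> Sx; rewrite /restrict asboolF. Qed.

Lemma csec_restrict (S S' : set X) (F : sheaf k X) (s : forall x, F x) :
  kadm S S' -> csec S s -> csec S' (restrict S' s).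
Proof.
move=> h [cs [A kA sA]]; split; first by move=> x; exact: kfun_cont h _ _ (cs x).
by exists A => // x nA; rewrite /restrict sA// if_same.
Qed.

Lemma gval_kmap (S S' : set X) (F : sheaf k X) (g : Gam (ten S F)) :
  kadm S S' -> gval (Gam_hom (kmap S S' F) g) = restrict S' (gval g).
Proof.
move=> h; apply: functional_extensionality_dep => x.
by rewrite /gval /= /kmap; case: pselect.
Qed.
End Sections.

(** * Cocycles, coboundaries and classes in terms of values *)

Section Classes.
Variables (k : fieldType) (X : topologicalType) (F : cpx k X).

(* [s] and [t] are cohomologous in RGamma_c (X; k_S tensor F). *)
Definition cohom (S : set X) m (s t : forall x, F (m + 1) x) :=
  exists2 h : forall x, F m x, csec S h & forall x, s x - t x = df F m x (h x).

Lemma class_of_cocycle S m (g : Gam_cpx (ten_cpx S F) m) a :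
  class_of g a -> forall x, df F m x (gval g x) = 0.
Proof.
move=> [z <- _] x; have /asboolP/= dz := Defs.subvP z.
by have := congr1 (fun s : Gam (ten S (F (m + 1))) => gval s x) dz.
Qed.

Lemma class_of_cohom S m (g g' : Gam_cpx (ten_cpx S F) (m + 1)) a :
  class_of g a -> class_of g' a -> cohom S (gval g) (gval g').
Proof.
move=> [z <- <-] [z' <- /esym] /quo_piE/= /coboundE[u e].
exists (gval u); first exact: csec_gval.
by move=> x; have := congr1 (fun s : Gam (ten S (F (m + 1))) => gval s x) e.
Qed.

Lemma cohom_class_of S m (g g' : Gam_cpx (ten_cpx S F) (m + 1)) a :
  class_of g a -> (forall x, df F (m + 1) x (gval g' x) = 0) ->
  cohom S (gval g) (gval g') -> class_of g' a.
Proof.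
move=> [z <- za] dg' [h ch e].
have dg'0 : vd (Gam_cpx (ten_cpx S F)) (m + 1) g' = 0.
  apply: val_inj; apply: functional_extensionality_dep => x.
  by apply: val_inj; exact: dg'.
exists (@SubT _ _ (cocycles (Gam_cpx (ten_cpx S F)) (m + 1)) g' (asboolT dg'0)) => //.
rewrite -za; apply/esym/quo_piE => /=; apply/coboundE.
have [u uh] := gval_ex ch; exists u.
apply: val_inj; apply: functional_extensionality_dep => x; apply: val_inj.
by rewrite /= -[subv (subv u x)]/(gval u x) uh -e.
Qed.

Lemma cohom_refl S m (s : forall x, F (m + 1) x) : cohom S s s.
Proof. by exists (fun=> 0); [exact: csec0|move=> x; rewrite subrr linear0]. Qed.

Lemma cohom_eq S m (s t s' t' : forall x, F (m + 1) x) :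
  cohom S s t -> (forall x, s x = s' x) -> (forall x, t x = t' x) ->
  cohom S s' t'.
Proof.
move=> h es et; have <- : s = s' by exact: functional_extensionality_dep.
by have <- : t = t' by exact: functional_extensionality_dep.
Qed.

Lemma cohom_sym S m (s t : forall x, F (m + 1) x) : cohom S s t -> cohom S t s.
Proof.
move=> [h ch e]; exists (fun x => 0 - h x); first exact: csecB (csec0 _ _) ch.
by move=> x; rewrite sub0r linearN -e opprB.
Qed.

Lemma cohom_trans S m (s t u : forall x, F (m + 1) x) :
  cohom S s t -> cohom S t u -> cohom S s u.
Proof.
move=> [h ch e] [h' ch' e']; exists (fun x => h x + h' x); first exact: csecD.
by move=> x; rewrite linearD -e -e' addrA subrK.
Qed.

Lemma cohom_restrict S S' m (s t : forall x, F (m + 1) x) :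
  kadm S S' -> cohom S s t -> cohom S' (restrict S' s) (restrict S' t).
Proof.
move=> h [g cg e]; exists (restrict S' g); first exact: csec_restrict cg.
move=> x; rewrite /restrict; case: ifP => _; first exact: e.
by rewrite subrr linear0.
Qed.
Lemma cohomB S m (s t s' t' : forall x, F (m + 1) x) :
  cohom S s t -> cohom S s' t' ->
  cohom S (fun x => s x - s' x) (fun x => t x - t' x).
Proof.
move=> [h ch e] [h' ch' e']; exists (fun x => h x - h' x); first exact: csecB.
by move=> x; rewrite [RHS]linearB -e -e' !opprD addrACA.
Qed.

Lemma class_of_fun S m (g : Gam_cpx (ten_cpx S F) m) a a' :
  class_of g a -> class_of g a' -> a = a'.
Proof.
move=> [z e <-] [z' e' <-]; congr quo_pi.
by apply: val_inj; rewrite [val z]e [val z']e'.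
Qed.

Lemma class_of_ex S m (a : Hc F S m) :
  exists g : Gam_cpx (ten_cpx S F) m, class_of g a.
Proof. by have [z e] := quo_pi_surj a; exists (subv z); exists z. Qed.

Lemma class_of_cohom0 S m (g : Gam_cpx (ten_cpx S F) (m + 1)) :
  class_of g 0 -> cohom S (gval g) (fun=> 0).
Proof.
move=> [z <- /esym] e; have : quo_pi (coboundaries (Gam_cpx (ten_cpx S F)) (m + 1)) 0 =
    quo_pi _ z 
  by rewrite -e; apply: (addrI (quo_pi _ 0)); rewrite -quo_piD !addr0.
move=> /esym /quo_piE; rewrite subr0 /= => /coboundE[w ew].
exists (gval w); first exact: csec_gval.
by move=> x; rewrite subr0 ew.
Qed.

Lemma class_ofB S m (g g' : Gam_cpx (ten_cpx S F) m) a a' :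
  class_of g a -> class_of g' a' -> class_of (g - g') (a - a').
Proof.
move=> [z ez <-] [z' ez' <-]; exists (z - z'); first by rewrite -ez -ez'.
by apply: (addIr (quo_pi _ z')); rewrite -quo_piD !subrK.
Qed.

Lemma gval_induced S S' m (g : Gam_cpx (ten_cpx S F) m) : kadm S S' ->
  gval (Gam_kmap F S S' m g) = restrict S' (gval g).
Proof. exact: gval_kmap. Qed.

Lemma restrictB S m (s t : forall x, F m x) x :
  restrict S (fun x => s x - t x) x = restrict S s x - restrict S t x.
Proof. by rewrite /restrict; case: ifP => //; rewrite subr0. Qed.

Lemma restrictD S m (s t : forall x, F m x) x :
  restrict S (fun x => s x + t x) x = restrict S s x + restrict S t x.
Proof. by rewrite /restrict; case: ifP => //; rewrite addr0. Qed.

Lemma restrict0 S m x : restrict S (fun x => 0 : F m x) x = 0.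
Proof. by rewrite /restrict if_same. Qed.

Lemma restrict_sub S S' m (s : forall x, F m x) x :
  S `<=` S' -> restrict S (restrict S' s) x = restrict S s x.
Proof.
move=> h; have [Sx|Sx] := pselect (S x); last by rewrite !restrict_out.
by rewrite !restrict_in//; exact: h.
Qed.

Lemma df_restrict S m (s : forall x, F m x) x :
  df F m x (restrict S s x) = restrict S (fun x => df F m x (s x)) x.
Proof. by rewrite /restrict; case: ifP => // _; rewrite linear0. Qed.
End Classes.

(** * Extension and lifting to the stalks of direct images *)

(** The near-covering form of compactness is applied to the filter of lists ordered by inclusion:
    any given point belongs to all sufficiently large lists. *)
Lemma compact_finite_subcover (X : topologicalType) (A : set X) (V : X -> set X) :
  compact A -> (forall x, open (V x)) -> (forall x, V x x) ->
  exists l : seq X, A `<=` \bigcup_(x in [set` l]) V x.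
Proof.
move=> /compact_near_coveringP kA oV Vx.
pose F : set_system (seq X) := fun Q =>
  exists l : seq X, forall l' : seq X, {subset l <= l'} -> Q l'.
have FF : Filter F.
  split.
  - by exists [::].
  - move=> P Q [l hl] [l' hl']; exists (l ++ l') => l'' h; split.
      by apply: hl => x xl; apply: h; rewrite mem_cat xl.
    by apply: hl' => x xl; apply: h; rewrite mem_cat xl orbT.
  - by move=> P Q PQ [l hl]; exists l => l' /hl/PQ.
suff : \forall l \near F, A `<=` (fun x => exists2 y, y \in l & V y x).
  by move=> [l hl]; exists l => x /(hl l (fun _ => id))[y yl Vyx]; exists y.
apply: kA.
move=> x Ax; exists (V x, [set l : seq X | x \in l]) => /=.
  split; first exact: open_nbhs_nbhs (conj (oV x) (Vx x)).
  by exists [:: x] => l; apply; rewrite inE.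
by move=> [y l] [/= Vy xl]; exists x.
Qed.

Section Extension.
Variables (k : fieldType) (X : topologicalType) (F : sheaf k X).
Hypothesis hX : hausdorff_space X.
Hypothesis lcX : forall (x : X) (U : set X), open U -> U x ->
  exists V, [/\ open V, V x, closure V `<=` U & compact (closure V)].
Hypothesis flF : forall (U : set X) (s : forall x, F x),
  open U -> (forall x, U x -> cont x s) ->
  exists2 t : forall x, F x, (forall x, cont x t) & forall x, U x -> t x = s x.
Variables (S : set X) (s : forall x, F x).

Let good (U : set X) := exists r : forall x, F x,
  [/\ forall x, U x -> cont x r, forall x, U x -> S x -> r x = s x &
      exists2 A, compact A & forall x, ~ A x -> r x = 0].

(* [r] and [r'] are made to agree on V by subtracting from [r] an extension of their
   difference that vanishes on a neighbourhood of S in U. *)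
Lemma extension_step (U U' V : set X) (r' : forall x, F x) :
  open U -> open V -> V `<=` U' -> closure V `<=` U' -> compact (closure V) ->
  (forall x, U' x -> cont x r') -> (forall x, U' x -> S x -> r' x = s x) ->
  good U -> good (U `|` V).
Proof.
move=> oU oV VU' clU' kV cr' r's [r [cr rs [A kA rA]]].
pose T := U `&` V `&` [set x | r x - r' x <> 0].
pose e x : F x := if pselect ((U `&` V) x) is left _ then r x - r' x else 0.
have eE x : U x -> V x -> e x = r x - r' x.
  by move=> Ux Vx; rewrite /e; case: pselect => // -[].
have e0 x : ~ closure T x -> e x = 0.
  move=> nT; rewrite /e; case: pselect => // -[Ux Vx].
  apply: contrapT => ne; apply: nT; apply: subset_closure; split => //.
have ce x : U x -> U' x -> cont x (fun y => r y - r' y).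
  move=> Ux U'x; apply: cont_eq (contP (-1) (cr' x U'x) (cr x Ux)) _ => y.
  by rewrite scaleN1r addrC.
(* On the two open sets [e] is a difference of sections, respectively 0, hence a section on their
   union; flabbiness extends it. *)
have [e1 ce1 e1E] : exists2 t : forall x, F x, (forall x, cont x t) &
    forall x, (U `&` V `|` ~` closure T) x -> t x = e x.
  apply: flF.
    by apply: openU; [exact: openI|apply/closed_openC/closed_closure].
  move=> x [[Ux Vx]|nT].
    apply: cont_ext (ce x Ux (VU' _ Vx)) _.
    apply: filterS2 (open_nbhs_nbhs (conj oU Ux)) (open_nbhs_nbhs (conj oV Vx)).
    by move=> y Uy Vy; rewrite eE.
  apply: cont_ext (cont0 _ _) _.
  have /closed_openC oT : closed (closure T) by exact: closed_closure.
  by apply: filterS (open_nbhs_nbhs (conj oT nT)) => y nTy; rewrite e0.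
have TclV x : closure T x -> closure V x.
  by apply: closureS => y [[]].
have SU x : U x -> S x -> ~ closure T x.
  move=> Ux Sx cTx; have U'x := clU' _ (TclV _ cTx).
  have z : \forall y \near x, r y - r' y = 0.
    by apply: cont_inj (ce x Ux U'x) _; rewrite rs// r's// subrr.
  by have [y [[_ /= nz] /nz]] := cTx _ z.
exists (fun x => if pselect (U x) is left _ then r x - e1 x
                 else if pselect (V x) is left _ then r' x else 0); split.
- move=> x [Ux|Vx].
    apply: (cont_ext (s := fun x => r x - e1 x)).
      apply: cont_eq (contP (-1) (ce1 x) (cr x Ux)) _ => y.
      by rewrite scaleN1r addrC.
    by apply: filterS (open_nbhs_nbhs (conj oU Ux)) => y Uy; case: pselect.
  apply: cont_ext (cr' x (VU' _ Vx)) _.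
  apply: filterS (open_nbhs_nbhs (conj oV Vx)) => y Vy; case: pselect => Uy.
    by rewrite e1E; [rewrite eE// subKr|left].
  by case: pselect.
- move=> x UVx Sx; case: pselect => Ux.
    have nT := SU _ Ux Sx.
    by rewrite e1E; [rewrite e0// subr0; exact: rs|right].
  by case: UVx => // Vx; case: pselect => // _; exact: r's (VU' _ Vx) Sx.
exists (A `|` closure V); first exact: compactU.
move=> x /not_orP[nA nV]; case: pselect => Ux.
  have nT : ~ closure T x by move/TclV.
  by rewrite rA// e1E; [rewrite e0// subr0|right].
by case: pselect => // /subset_closure.
Qed.

(** Off the compact support A the extension is 0, and A is covered by finitely many open sets near
    which s extends; [extension_step] adds them one at a time. The start is open because A is closed
    in the Hausdorff space X. *)
Lemma csec_extend : csec S s -> exists2 r : forall x, F x,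
  csec setT r & forall x, S x -> r x = s x.
Proof.
move=> [cs [A kA sA]].
have loc x : exists V : set X, open V /\ V x /\
    exists (U' : set X) (r' : forall x, F x), [/\ V `<=` U' & closure V `<=` U'] /\
    [/\ compact (closure V), forall x, U' x -> cont x r' &
        forall x, U' x -> S x -> r' x = s x].
  have [r' cr' sr'] := cs x.
  have : nbhs x (fun y => cont y r' /\ ((S y -> s y = r' y) /\
    (~ S y -> \forall z \near y, s z = 0))).
    exact: filterI (cont_near cr') sr'.
  rewrite nbhsE => -[U' [oU' U'x] U'P].
  have [V [oV Vx clV kV]] := lcX oU' U'x.
  exists V; split => //; split => //; exists U', r'; split; split => //.
  - by apply: subset_trans clV; exact: subset_closure.
  - by move=> y /U'P[].
  - by move=> y /U'P[_ [h _]] Sy; rewrite h.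
pose V x := projT1 (cid (loc x)).
have oV x : open (V x) by case: (projT2 (cid (loc x))).
have Vx x : V x x by case: (projT2 (cid (loc x))) => _ [].
have step x U : open U -> good U -> good (U `|` V x).
  have [_ [_ [U' [r' [[VU' clV] [kV cr' r's]]]]]] := projT2 (cid (loc x)).
  by move=> oU; exact: extension_step (oV x) VU' clV kV cr' r's.
have [D AD] := compact_finite_subcover kA oV Vx.
have all_good (l : seq X) : good (~` A `|` \bigcup_(x in [set` l]) V x).
  elim: l => [|x l IH].
    exists (fun=> 0); split.
    - by move=> x _; exact: cont0.
    - by move=> x [nA|[? //]] _; rewrite sA.
    - by exists set0 => //; exact: compact0.
  have -> : ~` A `|` \bigcup_(y in [set` x :: l]) V y =
            (~` A `|` \bigcup_(y in [set` l]) V y) `|` V x.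
    apply/seteqP; split => y.
      move=> [nA|[z /=]]; first by left; left.
      rewrite inE => /orP[/eqP->|zl] Vy; first by right.
      by left; right; exists z.
    move=> [[nA|[z /= zl Vy]]|Vxy]; first by left.
      by right; exists z => //=; rewrite inE zl orbT.
    by right; exists x => //=; rewrite inE eqxx.
  apply: step => //; apply: openU.
    by apply: closed_openC; exact: (compact_closed hX kA).
  by apply: bigcup_open => y _; exact: oV.
have [r [cr rs [B kB rB]]] := all_good D.
have cover x : (~` A `|` \bigcup_(y in [set` D]) V y) x.
  have [Ax|] := pselect (A x); last by left.
  by right; have [y Dy Vy] := AD _ Ax; exists y.
exists r; last by move=> x; exact: rs.
split; last by exists B.
move=> x; exists r; first exact: cr.
by apply: filterE => y; split => // nT; case: nT.
Qed.
End Extension.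

Section Slices.
Variables (k : fieldType) (X Y : topologicalType) (F : sheaf k X).
Variable cf : continuous (fst : (X * Y)%type -> X).
Variable Z : set (X * Y)%type.

Definition slice (y : Y) : set X := [set x | Z (x, y)].

Definition shr_val (y : Y) (v : shr (ten Z (pull cf F)) y) (x : X) : F x :=
  subv (subv v x).

Lemma csec_shr_val y (v : shr (ten Z (pull cf F)) y) : csec (slice y) (shr_val v).
Proof.
have /asboolP[e [[A kA eA] ce] ev] := Defs.subvP v.
have vE x : shr_val v x = subv (e y x) by rewrite /shr_val -ev.
split; last first.
  by exists A => // x nA; rewrite vE (nbhs_singleton eA).
move=> x; have [q [r cr qr] qe] := nbhs_singleton ce x.
exists r; first exact: cr.
have line (P : (X * Y)%type -> Prop) x' :
    (\forall p \near ((x', y) : (X * Y)%type), P p) -> \forall x' \near x', P (x', y).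
  move=> [[U V] /= [nU nV] UV]; apply: filterS nU => z Uz.
  by apply: UV; split => //=; exact: nbhs_singleton nV.
apply: filterS2 (line _ _ qr) (line _ _ qe) => x' qx' [e1 e2].
rewrite /slice /= vE; split=> [Zx'|nZx']; first by rewrite [subv _]e1// qx'.
by apply: filterS (line _ _ (e2 nZx')) => z ez; rewrite vE.
Qed.

Hypothesis hX : hausdorff_space X.
Hypothesis lcX : forall (x : X) (U : set X), open U -> U x ->
  exists V, [/\ open V, V x, closure V `<=` U & compact (closure V)].
Hypothesis flF : forall (U : set X) (s : forall x, F x),
  open U -> (forall x, U x -> cont x s) ->
  exists2 t : forall x, F x, (forall x, cont x t) & forall x, U x -> t x = s x.

(** Base change at y. The section on the slice extends to a compactly supported section r on X, and
    cutting [r p.1] off by Z gives a section near the whole fiber of y because Z is closed there. *)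
Lemma shr_val_ex y (s : forall x, F x) :
  (\forall z \near y, forall x, ~ Z (x, z) ->
     \forall p \near ((x, z) : (X * Y)%type), ~ Z p) ->
  csec (slice y) s -> exists v : shr (ten Z (pull cf F)) y, shr_val v = s.
Proof.
move=> lcZ cs; have [r [cr [A kA rA]] rs] := csec_extend hX lcX flF cs.
pose g (p : X * Y) : pull cf F p := if `[< Z p >] then r p.1 else 0.
have gin p : Z p -> g p = r p.1 by move=> Zp; rewrite /g asboolT.
have gout p : ~ Z p -> g p = 0 by move=> Zp; rewrite /g asboolF.
have cr' x : cont x r.
  have [q cq qr] := cr x; apply: cont_ext cq _; apply: filterS qr => x' [h _].
  by rewrite h.
have cg : \forall z \near y, forall x, ten_cont Z (x, z) g.
  have /near_join lcZ' := lcZ; apply: filterS lcZ' => z lz x.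
  exists (fun p => r p.1).
    by exists r; [exact: cr'|apply: filterE].
  exists (setT, fun z => forall x, ~ Z (x, z) ->
     \forall p \near ((x, z) : (X * Y)%type), ~ Z p).
    by split => //; exact: filterT.
  move=> [x' z'] [_ /= h]; split; first exact: gin.
  by move=> /h; apply: filterS => p /gout.
pose e z : shr_presh (ten Z (pull cf F)) z :=
  fun x => stalk_lift (P := ten_presh Z (pull cf F)) g (x, z).
have eE z x : ten_cont Z (x, z) g -> subv (e z x) = g (x, z).
  exact: (@stalk_liftE _ _ (ten_presh Z (pull cf F))).
have ce : shr_cont y e.
  split.
    exists A => //; apply: filterS cg => z cz x nA; apply: val_inj.
    rewrite [val _]eE // /g; case: ifP => // _; exact: rA.
  apply: filterS cg => z cz x.
  have := @stalk_lift_cont _ _ (ten_presh Z (pull cf F)) g (x, z) (cz x).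
  by move=> h; apply: cont_eq h _ => -[].
exists (@SubT _ _ (stalk_sub (shr_presh (ten Z (pull cf F))) y) (e y)
  (asboolT (ex_intro2 _ _ e ce erefl))).
apply: functional_extensionality_dep => x.
rewrite /shr_val [LHS]eE; last exact: nbhs_singleton cg x.
have [Zx|nZx] := pselect (Z (x, y)); first by rewrite gin// rs.
by rewrite gout// (csec_out cs).
Qed.
End Slices.

(** * Topology of the plane *)

Section PlaneTopology.
Variable R : realType.
Notation plane := (plane R).

Lemma norm_i : `|'i%C| = 1 :> R[i].
Proof. by rewrite normc_def /= expr0n /= add0r expr1n sqrtr1. Qed.

Lemma norm_le_ReIm (z : R[i]) : `|z| <= (`|complex.Re z| + `|complex.Im z|)%:C.
Proof.
have nC (x : R) : `|x%:C| = `|x|%:C :> R[i].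
  by rewrite normc_def /= expr0n /= addr0 sqrtr_sqr.
rewrite {1}(complexE z) (le_trans (ler_normD _ _))// normrM !nC.
by rewrite norm_i mul1r rmorphD.
Qed.

Lemma plane_near (z : plane) (e : R) : 0 < e ->
  \forall z' \near z, `|(z : R[i]) - z'| < e%:C.
Proof.
move=> e0; have e0' : 0 < e%:C :> R[i] by rewrite ltcR.
exact: (@nbhsx_ballx _ (R[i] : numFieldType) z _ e0').
Qed.

Lemma Re_cont : continuous (@complex.Re R : plane -> R).
Proof.
move=> z; apply/(@cvgrPdist_lt R R _ _ (nbhs_filter (z : plane))) => e e0.
apply: filterS (plane_near z e0) => z' zz'.
rewrite -ltcR; apply: le_lt_trans zz'; rewrite -raddfB.
exact: normc_ge_Re.
Qed.

Lemma Im_cont : continuous (@complex.Im R : plane -> R).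
Proof.
move=> z; apply/(@cvgrPdist_lt R R _ _ (nbhs_filter (z : plane))) => e e0.
apply: filterS (plane_near z e0) => z' zz'.
rewrite -ltcR; apply: le_lt_trans zz'; rewrite -raddfB.
have := normc_ge_Re ((z - z') * 'i%C).
by rewrite ReiNIm normrN normrM norm_i mulr1.
Qed.

Lemma Complex_cont : continuous (fun p : R * R => Complex p.1 p.2 : plane).
Proof.
move=> p; apply/(@cvgrPdist_lt _ (R[i] : numFieldType) _ _ (nbhs_filter p)) => e e0.
(* A positive element of R[i] is real, so e may be replaced by its real part. *)
have eE : e = (complex.Re e)%:C by rewrite RRe_real// gtr0_real.
have er0 : 0 < complex.Re e / 2 by rewrite divr_gt0// -ltcR -eE.
have n1 : \forall q \near p, `|p.1 - q.1| < complex.Re e / 2.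
  have h : (fst : R * R -> R) q @[q --> p] --> p.1 by exact: cvg_fst.
  exact: (@cvgrPdist_lt R R _ _ (nbhs_filter p) _ _).1 h _ er0.
have n2 : \forall q \near p, `|p.2 - q.2| < complex.Re e / 2.
  have h : (snd : R * R -> R) q @[q --> p] --> p.2 by exact: cvg_snd.
  exact: (@cvgrPdist_lt R R _ _ (nbhs_filter p) _ _).1 h _ er0.
apply: filterS2 n1 n2 => q h1 h2.
apply: le_lt_trans (norm_le_ReIm _) _; rewrite eE ltcR /=.
by rewrite [ltRHS](splitr (complex.Re e)) ltrD.
Qed.

Lemma plane_hausdorff : hausdorff_space plane.
Proof. exact: (@norm_hausdorff _ (R[i] : numFieldType)). Qed.

Lemma plane_locally_compact (x : plane) (U : set plane) : open U -> U x ->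
  exists V, [/\ open V, V x, closure V `<=` U & compact (closure V)].
Proof.
move=> oU Ux.
have : nbhs x U by exact: open_nbhs_nbhs.
move=> /(@nbhs_ballP _ (R[i] : numFieldType))[e /= e0 eU].
have eE : e = (complex.Re e)%:C by rewrite RRe_real// gtr0_real.
(* The norm is at most the sum of the absolute values of the coordinates, so half-sides e / 4 give
   at most e / 2. *)
pose d := complex.Re e / 4.
have d0 : 0 < d by rewrite divr_gt0// -ltcR -eE.
pose I (s : R) := `[s - d, s + d]%classic.
pose B : set plane := (fun p : R * R => Complex p.1 p.2 : plane) @`
  (I (complex.Re x) `*` I (complex.Im x)).
have cB : compact B.
  apply: continuous_compact; last by apply: compact_setX; exact: segment_compact.
  exact/continuous_subspaceT/Complex_cont.
have BU : B `<=` U.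
  move=> z [[a b] [/= Ia Ib] <-]; apply: eU.
  rewrite /ball /=; apply: le_lt_trans (norm_le_ReIm _) _; rewrite eE ltcR /=.
  case: x Ia Ib {Ux B cB} => xr xi /=; rewrite /I /= !in_itv /= => /andP[h1 h2] /andP[h3 h4].
  have n1 : `|xr - a| <= d by rewrite ler_norml; apply/andP; split; lra.
  have n2 : `|xi - b| <= d by rewrite ler_norml; apply/andP; split; lra.
  by apply: le_lt_trans (lerD n1 n2) _; rewrite /d; move: d0; rewrite /d; lra.
pose J (s : R) := `]s - d, s + d[%classic.
pose V : set plane := (@complex.Re R : plane -> R) @^-1` J (complex.Re x) `&`
                      (@complex.Im R : plane -> R) @^-1` J (complex.Im x).
have JI s t : J s t -> I s t by exact: subset_itv_oo_cc.
have Js s : J s s by rewrite /J /= in_itv /= ltrBlDr ltrDl d0.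
have VB : V `<=` B.
  move=> [a b] [] /= Ja Jb; exists (a, b) => //.
  by split; apply: JI.
have clVB : closure V `<=` B.
  have /closure_id clB : closed B := compact_closed plane_hausdorff cB.
  by rewrite [X in _ `<=` X]clB; exact: closureS VB.
exists V; split.
- apply: openI; apply: open_comp; [by move=> z _; exact: Re_cont|exact: itv_open|
    by move=> z _; exact: Im_cont|exact: itv_open].
- by split; exact: Js.
- exact: subset_trans BU.
by apply: (subclosed_compact _ cB clVB); exact: closed_closure.
Qed.

Lemma rep_cont (w : R[i]) : continuous (fun z : plane => rep z w).
Proof.
move=> z; apply: (cvg_comp (fun z : plane => (z * w : plane))); last exact: Re_cont.
exact: (@cvgMr_tmp (R[i] : numFieldType) _ _ (nbhs_filter (z : plane))).
Qed.

Lemma rep_cont2 : continuous (fun p : plane * plane => rep p.1 p.2).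
Proof.
move=> p; apply: (cvg_comp (fun p : plane * plane => (p.1 * p.2 : plane))); last exact: Re_cont.
by apply: (@cvgM (R[i] : numFieldType) _ _ (nbhs_filter p)); [exact: cvg_fst|exact: cvg_snd].
Qed.

End PlaneTopology.

(** * Strips, half-planes and rays *)

Section PlaneSets.
Variable R : realType.
Notation plane := (plane R).
Implicit Types (z w a b : R[i]).

Lemma near_gt (X : topologicalType) (f : X -> R) (x : X) (q : R) :
  {for x, continuous f} -> q < f x -> \forall y \near x, q < f y.
Proof. by move=> cf qf; exact: cf (lt_nbhsr qf). Qed.

Lemma near_lt (X : topologicalType) (f : X -> R) (x : X) (q : R) :
  {for x, continuous f} -> f x < q -> \forall y \near x, f y < q.
Proof. by move=> cf qf; exact: cf (lt_nbhsl qf). Qed.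

Lemma repD z z' w : rep (z + z') w = rep z w + rep z' w.
Proof. by case: z z' w => [a b] [a' b'] [e f]; rewrite /rep /=; ring. Qed.

Lemma repNr z w : rep z (- w) = - rep z w.
Proof. by case: z w => [a b] [e f]; rewrite /rep /=; ring. Qed.

Lemma repNl z w : rep (- z) w = - rep z w.
Proof. by case: z w => [a b] [e f]; rewrite /rep /=; ring. Qed.

Lemma repZl (r : R) z w : rep (r%:C * z) w = r * rep z w.
Proof. by case: z w => [a b] [e f]; rewrite /rep /=; ring. Qed.

Lemma repZr (r : R) z w : rep z (r%:C * w) = r * rep z w.
Proof. by case: z w => [a b] [e f]; rewrite /rep /=; ring. Qed.

Lemma rep_ray c a b z : rep a b = 0 -> ray c a z -> rep z b = rep c b.
Proof. by move=> ab [r _ ->]; rewrite repD repZl ab mulr0 addr0. Qed.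

Lemma rep_oray c a b z : rep a b = 0 -> oray c a z -> rep z b = rep c b.
Proof. by move=> ab [r _ ->]; rewrite repD repZl ab mulr0 addr0. Qed.

(** The affine coordinate (z - c) / a straightens the ray, which makes its topology explicit. *)
Lemma rayP c a z : a != 0 -> ray c a z <->
  complex.Im ((z - c) / a) = 0 /\ 0 <= complex.Re ((z - c) / a).
Proof.
move=> a0; split=> [[r r0 ->]|[i0 r0]].
  by rewrite [_ - c]addrC addKr mulfK.
exists (complex.Re ((z - c) / a)) => //.
set q := (z - c) / a in i0 r0 *.
have -> : (complex.Re q)%:C = q by case: q i0 r0 => x y /= -> _.
by rewrite /q divfK// addrC subrK.
Qed.

Lemma orayP c a z : a != 0 -> oray c a z <->
  complex.Im ((z - c) / a) = 0 /\ 0 < complex.Re ((z - c) / a).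
Proof.
move=> a0; split=> [[r r0 ->]|[i0 r0]].
  by rewrite [_ - c]addrC addKr mulfK.
exists (complex.Re ((z - c) / a)) => //.
set q := (z - c) / a in i0 r0 *.
have -> : (complex.Re q)%:C = q by case: q i0 r0 => x y /= -> _.
by rewrite /q divfK// addrC subrK.
Qed.

(** As a b is purely imaginary and nonzero, Re(q a b) is - Im q times the imaginary part of a b, so
    it vanishes only for real q. *)
Lemma rep_line c a b z : a != 0 -> b != 0 -> rep a b = 0 ->
  rep z b = rep c b -> complex.Im ((z - c) / a) = 0.
Proof.
move=> a0 b0 ab zc; set q := (z - c) / a.
have : rep (q * a) b = 0 by rewrite /q divfK// repD repNl zc subrr.
have ab0 : a * b != 0 by rewrite mulf_neq0.
rewrite /rep -mulrA; move: ab ab0; rewrite /rep; case: (a * b) => x y /= ->.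
case: q => e f /=; rewrite mulr0 add0r => nz /eqP.
rewrite oppr_eq0 mulf_eq0 => /orP[/eqP//|/eqP y0].
by move: nz; rewrite y0 eqxx.
Qed.

Lemma coord_cont c a : continuous (fun z : plane => ((z - c) / a : plane)).
Proof.
move=> z; apply: (@cvgMr_tmp (R[i] : numFieldType) _ _ (nbhs_filter (z : plane))).
apply: (@cvgB (R[i] : numFieldType) _ _ (nbhs (z : plane)) (nbhs_filter (z : plane))).
  exact: cvg_id.
exact: cvg_cst.
Qed.

Lemma Re_coord_cont c a : continuous (fun z : plane => complex.Re ((z - c) / a)).
Proof.
by move=> z; apply: (cvg_comp (fun z : plane => ((z - c) / a : plane)));
  [exact: coord_cont|exact: Re_cont].
Qed.

Lemma Im_coord_cont c a : continuous (fun z : plane => complex.Im ((z - c) / a)).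
Proof.
by move=> z; apply: (cvg_comp (fun z : plane => ((z - c) / a : plane)));
  [exact: coord_cont|exact: Im_cont].
Qed.

Lemma near_notin_ray c a (z : plane) : a != 0 -> ~ ray c a z ->
  \forall z' \near z, ~ ray c a z'.
Proof.
move=> a0 nz.
have [i0|i0|i0] := ltgtP (complex.Im ((z - c) / a)) 0.
- have : \forall z' \near z, complex.Im (((z' : R[i]) - c) / a) < 0.
    exact: near_lt (@Im_coord_cont c a z) i0.
  apply: filterS => z' z'0 /rayP[]// e; by rewrite e ltxx in z'0.
- have : \forall z' \near z, 0 < complex.Im (((z' : R[i]) - c) / a).
    exact: near_gt (@Im_coord_cont c a z) i0.
  apply: filterS => z' z'0 /rayP[]// e; by rewrite e ltxx in z'0.
have r0 : complex.Re ((z - c) / a) < 0.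
  by rewrite ltNge; apply/negP => r0; apply: nz; apply/rayP.
have : \forall z' \near z, complex.Re (((z' : R[i]) - c) / a) < 0.
  exact: near_lt (@Re_coord_cont c a z) r0.
by apply: filterS => z' z'0 /rayP[]// _; rewrite leNgt z'0.
Qed.

Lemma near_half_lt b (z : plane) (q : R) : rep z b < q ->
  \forall z' \near z, rep z' b < q.
Proof. by move=> h; exact: near_lt (@rep_cont R b z) h. Qed.

Lemma near_half_gt b (z : plane) (q : R) : q < rep z b ->
  \forall z' \near z, q < rep z' b.
Proof. by move=> h; exact: near_gt (@rep_cont R b z) h. Qed.

Definition half b (q : R) : set plane := [set z | q <= rep z b].

Lemma kadm_open (X : topologicalType) (S S' : set X) : S `<=` S' ->
  (forall x, S x -> \forall y \near x, S' y -> S y) -> kadm S S'.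
Proof. by move=> SS' oS; split=> [x /SS'//|x Sx _]; exact: oS. Qed.

Lemma kadm_closed (X : topologicalType) (S S' : set X) : S' `<=` S ->
  (forall x, S x -> ~ S' x -> \forall y \near x, S y -> ~ S' y) -> kadm S S'.
Proof.
by move=> S'S cS'; split=> // x _ _; apply: filterE => y; exact: S'S.
Qed.

Section Strips.
Variables (n : nat) (alpha beta : R[i]) (c : 'I_n -> R[i]).
Hypothesis alpha0 : alpha != 0.
Hypothesis beta0 : beta != 0.
Hypothesis ab0 : rep alpha beta = 0.
Hypothesis c_incr : forall i j : 'I_n, (i < j)%N -> rep (c i) beta < rep (c j) beta.
Let strip := strip beta c.
Let strip_gt := strip_gt beta c.
Let strip_ge := strip_ge beta c.

Let Nab0 : rep (- alpha) beta = 0. Proof. by rewrite repNl ab0 oppr0. Qed.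
Let Nalpha0 : - alpha != 0. Proof. by rewrite oppr_eq0. Qed.

Lemma near_strip i (z : plane) : strip i z -> \forall z' \near z, strip i z'.
Proof.
move=> [h1 h2].
have n1 : \forall y \near z, forall j : 'I_n, (j < i)%N -> rep (c j) beta < rep y beta.
  apply: (@filter_forall _ _ (fun (j : 'I_n) (y : plane) =>
    (j < i)%N -> rep (c j) beta < rep y beta) (nbhs z)) => j.
  have [ji|ji] := boolP (j < i)%N; last exact: filterE.
  by apply: filterS (near_half_gt (h1 _ ji)) => y h _.
have n2 : \forall y \near z, forall j : 'I_n, (i < j)%N -> rep y beta < rep (c j) beta.
  apply: (@filter_forall _ _ (fun (j : 'I_n) (y : plane) =>
    (i < j)%N -> rep y beta < rep (c j) beta) (nbhs z)) => j.
  have [ji|ji] := boolP (i < j)%N; last exact: filterE.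
  by apply: filterS (near_half_lt (h2 _ ji)) => y h _.
by apply: filterS2 n1 n2 => y; split.
Qed.

Lemma near_strip_gt i (z : plane) : strip_gt i z -> \forall z' \near z, strip_gt i z'.
Proof.
by move=> [/near_strip h /near_half_gt h']; apply: filterS2 h h' => y; split.
Qed.

Lemma strip_line i z : rep z beta = rep (c i) beta -> strip i z.
Proof. by move=> e; split=> j ji; rewrite e; exact: c_incr. Qed.

Lemma strip_eq i j z : strip i z -> rep z beta = rep (c j) beta -> i = j.
Proof.
move=> [h1 h2] e; case: (ltngtP i j) => [ij|ij|/val_inj//].
  by have := h2 _ ij; rewrite e ltxx.
by have := h1 _ ij; rewrite e ltxx.
Qed.

Lemma kadm_oray_ray i : kadm (oray (c i) alpha : set plane) (ray (c i) alpha).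
Proof.
apply: kadm_open => [z /orayP-/(_ alpha0)[e h]|z].
  by apply/rayP => //; rewrite ltW.
move=> /orayP-/(_ alpha0)[_] /(near_gt (@Re_coord_cont (c i) alpha z)).
by apply: filterS => y h /rayP-/(_ alpha0)[e _]; apply/orayP.
Qed.

Lemma kadm_strip_gt i : kadm (strip_gt i) (strip i `\` ray (c i) alpha).
Proof.
apply: kadm_open => [z [s h]|z /near_strip_gt]; last by apply: filterS.
split=> // /(rep_ray ab0) e; by rewrite /= e ltxx in h.
Qed.

Lemma kadm_slit i :
  kadm (strip i `\` ray (c i) alpha) (~` \bigcup_j ray (c j) alpha : set plane).
Proof.
apply: kadm_open => [z [s h] [j _ /[dup] zj /(rep_ray ab0) /(strip_eq s) e]|z [s h]].
  by apply: h; rewrite e.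
by apply: filterS2 (near_strip s) (near_notin_ray alpha0 h) => y.
Qed.

Lemma kadm_gt_oray i :
  kadm (strip_gt i `|` oray (c i) alpha) (oray (c i) alpha).
Proof.
apply: kadm_closed => [z|z [[_ h]|//] nz]; first by right.
apply: filterS (near_half_gt h) => y hy _ /(rep_oray ab0) e.
by rewrite e ltxx in hy.
Qed.

Lemma kadm_gt_ge i : kadm (strip_gt i) (strip_gt i `|` oray (c i) alpha).
Proof.
by apply: kadm_open => [z|z /near_strip_gt]; [left|apply: filterS].
Qed.

Lemma kadm_strip_ray i : kadm (strip i) (ray (c i) alpha).
Proof.
apply: kadm_closed => [z /(rep_ray ab0)|z _ /(near_notin_ray alpha0)].
  exact: strip_line.
by apply: filterS.
Qed.

Lemma kadm_slit_strip i : kadm (strip i `\` ray (c i) alpha) (strip i).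
Proof.
apply: kadm_open => [z []//|z [/near_strip h /(near_notin_ray alpha0) h']].
by apply: filterS2 h h' => y.
Qed.

Lemma kadm_ge_ray i a : a != 0 -> rep a beta = 0 -> kadm (strip_ge i) (ray (c i) a).
Proof.
move=> a0 ab; apply: kadm_closed => [z /(rep_ray ab) e|z _ /(near_notin_ray a0)].
  by split; [exact: strip_line|rewrite /= e].
by apply: filterS.
Qed.

Lemma kadm_half_half b (q q' : R) : q <= q' -> kadm (half b q) (half b q').
Proof.
move=> qq'; apply: kadm_closed => [z|z _ /= /negP]; first exact: le_trans.
by rewrite -ltNge => /near_half_lt; apply: filterS => y h _; apply/negP; rewrite -ltNge.
Qed.

Lemma kadm_setT_half b (q : R) : kadm setT (half b q).
Proof.
apply: kadm_closed => [//|z _ /= /negP].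
by rewrite -ltNge => /near_half_lt; apply: filterS => y h _; apply/negP; rewrite -ltNge.
Qed.

Lemma kadm_half_ray b (q : R) k a : a != 0 -> rep a b = 0 -> q <= rep (c k) b ->
  kadm (half b q) (ray (c k) a).
Proof.
move=> a0 ab qk; apply: kadm_closed => [z /(rep_ray ab) e|z _ /(near_notin_ray a0)].
  by rewrite /half /= e.
by apply: filterS.
Qed.

Lemma kadm_strip_setT i : kadm (strip i) (setT : set plane).
Proof. by apply: kadm_open => // z /near_strip; apply: filterS. Qed.

Lemma kadm_slits_setT : kadm (~` \bigcup_j ray (c j) alpha) (setT : set plane).
Proof.
apply: kadm_open => // z h.
have : \forall y \near z, forall j, ~ ray (c j) alpha y.
  apply: (@filter_forall _ _ (fun j (y : plane) => ~ ray (c j) alpha y) (nbhs z)) => j.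
  apply: near_notin_ray => // zj.
  by apply: h; exists j.
by apply: filterS => y hy _ [j _ /hy].
Qed.

Lemma kadm_ge_half i : kadm (strip_ge i) (half beta (rep (c i) beta)).
Proof.
apply: kadm_open => [z []//|z [/near_strip h _]].
by apply: filterS h => y; split.
Qed.

(** On the boundary line the complement of the open ray is the closed opposite ray. Near a point of
    the set, every point of the half-plane is in the strip and off that closed ray, hence in the
    set. *)
Lemma kadm_gt_half i :
  kadm (strip_gt i `|` oray (c i) alpha) (half beta (rep (c i) beta)).
Proof.
have on_ray z : rep z beta = rep (c i) beta -> ~ ray (c i) (- alpha) z ->
    oray (c i) alpha z.
  move=> e h; apply/orayP => //; have i0 := rep_line alpha0 beta0 ab0 e.
  split => //; rewrite ltNge; apply/negP => r0; apply: h; apply/rayP => //.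
  rewrite invrN mulrN; move: i0 r0; case: (_ / _) => x y /= -> x0.
  by rewrite oppr0 oppr_ge0.
apply: kadm_open => [z [[_ /ltW]//|/(rep_oray ab0) e]|z zT].
  by rewrite /half /= e.
have sz : strip i z by case: zT => [[]//|/(rep_oray ab0)/strip_line].
have nz : ~ ray (c i) (- alpha) z.
  case: zT => [[_ /= h] /(rep_ray Nab0) e|]; first by rewrite e ltxx in h.
  move=> [r r0 ->] [r' r'0] /addrI /eqP.
  rewrite mulrN -mulNr -rmorphN => /eqP /(mulIf alpha0) /complexI e.
  by move: r0; rewrite e oppr_gt0 ltNge r'0.
apply: filterS2 (near_strip sz) (near_notin_ray Nalpha0 nz) => y sy ny.
rewrite /half /= le_eqVlt => /orP[/eqP e|h]; last by left; split.
by right; apply: on_ray => //; exact: esym.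
Qed.
End Strips.
End PlaneSets.

(** * Stalks of the Fourier-Sato transform *)

Section FourierStalks.
Variables (R : realType) (n : nat) (c : 'I_n -> R[i]) (F : cpx R[i] (plane R)).
Notation plane := (plane R).
Hypothesis F_flabby : flabby F.
Variable b : R[i].
Hypothesis b0 : b != 0.
Let h := oray 0 b : set plane.

Lemma oray_self : h b.
Proof. by exists 1; rewrite ?ltr01// mul1r add0r. Qed.

(** The open half-line fails to be closed only at 0. Near b one has Re(w / b) > 0, and there being
    off h means Im(w / b) != 0, an open condition. *)
Lemma near_oray_closed : \forall w \near (b : plane), ~ h w ->
  \forall w' \near w, ~ h w'.
Proof.
have : (0 : R) < complex.Re ((b - 0) / b) by rewrite subr0 divff//= ltr01.
move=> /(near_gt (@Re_coord_cont R 0 b b)).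
apply: filterS => w w0 nh.
have : complex.Im ((w - 0) / b) != 0.
  by apply/eqP => e; apply: nh; apply/orayP.
rewrite neq_lt => /orP[i0|i0].
  apply: filterS (near_lt (@Im_coord_cont R 0 b w) i0) => w' i0' /orayP[]// e.
  by rewrite e ltxx in i0'.
apply: filterS (near_gt (@Im_coord_cont R 0 b w) i0) => w' i0' /orayP[]// e.
by rewrite e ltxx in i0'.
Qed.

Lemma pair_near1 (X Y : topologicalType) (x : X) (y : Y) (P : X -> Prop) :
  (\forall x' \near x, P x') -> \forall p \near ((x, y) : (X * Y)%type), P p.1.
Proof. by move=> nP; exists (P, setT) => [|[x' y'] []//]; split=> //; exact: filterT. Qed.

Lemma pair_near2 (X Y : topologicalType) (x : X) (y : Y) (P : Y -> Prop) :
  (\forall y' \near y, P y') -> \forall p \near ((x, y) : (X * Y)%type), P p.2.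
Proof. by move=> nP; exists (setT, P) => [|[x' y'] []//]; split=> //; exact: filterT. Qed.

Lemma near_Zset_closed (t : R) :
  \forall y \near ((b, t) : (plane * R)%type), forall x : plane, ~ Zset h (x, y) ->
     \forall p \near ((x, y) : (plane * (plane * R))%type), ~ Zset h p.
Proof.
apply: filterS (@pair_near1 plane R _ t _ near_oray_closed) => -[w t'] /= hw x.
move=> /not_andP[/hw nh|/= /negP].
  have := @pair_near2 plane (plane * R)%type x _ _ (@pair_near1 plane R _ t' _ nh).
  by apply: filterS => p /= hp [].
rewrite -ltNge => l0.
have cf : {for (x, (w, t')), continuous (fun p : plane * (plane * R) =>
    p.2.2 + rep p.1 p.2.1)}.
  pose p0 : plane * (plane * R) := (x, (w, t')).
  have h1 : (fun p : plane * (plane * R) => p.2.2) p @[p --> p0] --> t'.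
    by apply: (cvg_comp snd); [exact: cvg_snd|exact: cvg_snd].
  have h2 : (fun p : plane * (plane * R) => rep p.1 p.2.1) p @[p --> p0] --> rep x w.
    apply: (cvg_comp (fun p : plane * (plane * R) => (p.1, p.2.1) : plane * plane)
      (fun q => rep q.1 q.2)); last exact: (@rep_cont2 R (x, w)).
    have c1 : (fun p : plane * (plane * R) => p.1) p @[p --> p0] --> (x : plane) by exact: cvg_fst.
    have c2 : (fun p : plane * (plane * R) => p.2.1) p @[p --> p0] --> (w : plane).
      by apply: (cvg_comp snd fst); [exact: cvg_snd|exact: cvg_fst].
    exact: (@cvg_pair _ _ _ (nbhs p0) (nbhs (x : plane)) (nbhs w)
      (nbhs_filter _) (nbhs_filter _) (nbhs_filter _) _ _ c1 c2).
  exact: (@cvgD R R _ _ (nbhs_filter p0) _ _ _ _ h1 h2).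
have : \forall p \near ((x, (w, t')) : (plane * (plane * R))%type),
    p.2.2 + rep p.1 p.2.1 < 0.
  exact: (@near_lt R (plane * (plane * R))%type
    (fun p => p.2.2 + rep p.1 p.2.1) (x, (w, t')) 0 cf l0).
by apply: filterS => p hp [_]; rewrite leNgt hp.
Qed.

Lemma near_exp_closed (s : R[i]) (t : R) :
  \forall y \near ((b, t) : (plane * R)%type),
    ~ (h y.1 /\ 0 <= y.2 + rep s y.1) ->
    \forall y' \near y, ~ (h y'.1 /\ 0 <= y'.2 + rep s y'.1).
Proof.
apply: filterS (@pair_near1 plane R _ t _ near_oray_closed) => -[w t'] /= hw.
move=> /not_andP[/hw nh|/= /negP].
  have := @pair_near1 plane R _ t' _ nh.
  by apply: filterS => p /= hp [].
rewrite -ltNge => l0.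
have cf : {for (w, t'), continuous (fun p : plane * R => p.2 + rep s p.1)}.
  pose p0 : plane * R := (w, t').
  have h1 : (fun p : plane * R => p.2) p @[p --> p0] --> t' by exact: cvg_snd.
  have h2 : (fun p : plane * R => rep s p.1) p @[p --> p0] --> rep s w.
    have -> : (fun p : plane * R => rep s p.1) = (fun p => rep p.1 s).
      by apply: funext => p; rewrite /rep mulrC.
    rewrite [rep s _]/rep mulrC.
    by apply: (cvg_comp fst (fun z => rep z s)); [exact: cvg_fst|exact: rep_cont].
  exact: (@cvgD R R _ _ (nbhs_filter p0) _ _ _ _ h1 h2).
have : \forall p \near ((w, t') : (plane * R)%type), p.2 + rep s p.1 < 0.
  exact: near_lt cf l0.
by apply: filterS => p hp [_]; rewrite leNgt hp.
Qed.

Lemma near_Lset_closed (a : R[i]) i (t : R) : a != 0 ->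
  \forall y \near ((b, t) : (plane * R)%type), forall x : plane, ~ Lset c h a i (x, y) ->
     \forall p \near ((x, y) : (plane * (plane * R))%type), ~ Lset c h a i p.
Proof.
move=> a0; apply: filterS (near_exp_closed (c i) t) => y hy x nL.
have [xr|/(near_notin_ray a0) nx] := pselect (ray (c i) a x); last first.
  by have := @pair_near1 plane (plane * R)%type _ y _ nx; apply: filterS => p hp [].
have /hy ny : ~ (h y.1 /\ 0 <= y.2 + rep (c i) y.1).
  by move=> [h1 h2]; apply: nL.
by have := @pair_near2 plane (plane * R)%type x _ _ ny; apply: filterS => p hp [_ h1 h2]; apply: hp.
Qed.

(** On h one has w = r b, and Re(z b) is constant along the ray: over the ray the inequalities
    defining [Zset] and [Lset] coincide. *)
Lemma kadm_ZL (a : R[i]) i : a != 0 -> rep a b = 0 -> kadm (Zset h) (Lset c h a i).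
Proof.
move=> a0 ab; apply: kadm_closed => [[x [w t]] [/= xr hw l0]|[x [w t]] [/= hw l0] nL].
  split=> //=; move: hw => [r _ e]; move: l0; rewrite e !add0r !repZr.
  by rewrite (rep_ray ab xr).
have [xr|/(near_notin_ray a0) nx] := pselect (ray (c i) a x); last first.
  by have := @pair_near1 plane (plane * R)%type _ (w, t) _ nx; apply: filterS => p hp _ [].
exfalso; apply: nL; split => //=; move: l0; case: hw => r _ ->.
by rewrite !add0r !repZr (rep_ray ab xr).
Qed.

Definition fsval m (y : plane * R) (v : FS F h m y) (x : plane) : F m x :=
  subv (subv v x).

Definition frval (a : R[i]) m (y : plane * R) (v : FSray c F h a m y) i (x : plane) :
  F m x := subv (subv (v i) x).

Lemma fsval_inj m y (v v' : FS F h m y) : fsval v = fsval v' -> v = v'.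
Proof.
move=> e; apply: val_inj; apply: functional_extensionality_dep => x.
by apply: val_inj; exact: (congr1 (fun s => s x) e).
Qed.

Lemma frval_inj a m y (v v' : FSray c F h a m y) : frval v = frval v' -> v = v'.
Proof.
move=> e; apply: functional_extensionality_dep => i.
apply: val_inj; apply: functional_extensionality_dep => x.
by apply: val_inj; exact: (congr1 (fun s => s i x) e).
Qed.

(** This makes the stalk of [FS] at (b, t) the complex of compactly supported sections on a closed
    half-plane, which contains every c i once t is large. *)
Lemma slice_Zset (t : R) : slice (Zset h) (b, t) = half b (- t).
Proof.
apply/seteqP; split=> x; rewrite /slice /half /= /Zset /=; first by case; lra.
by move=> e; split; [exact: oray_self|lra].
Qed.

Lemma slice_Lset a i (t : R) : 0 <= t + rep (c i) b ->
  slice (Lset c h a i) (b, t) = ray (c i) a.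
Proof.
move=> e; apply/seteqP; split=> x; rewrite /slice /= /Lset /=; first by case.
by move=> xr; split => //; exact: oray_self.
Qed.

Lemma csec_fsval m t (v : FS F h m (b, t)) : csec (half b (- t)) (fsval v).
Proof.
rewrite -slice_Zset.
exact: (@csec_shr_val _ plane (plane * R)%type (F m) (@pbar_cont R) (Zset h) (b, t) v).
Qed.

Lemma csec_frval a m t (v : FSray c F h a m (b, t)) i :
  csec (slice (Lset c h a i) (b, t)) (frval v i).
Proof.
exact: (@csec_shr_val _ plane (plane * R)%type (F m) (@pbar_cont R) (Lset c h a i) (b, t) (v i)).
Qed.

Lemma fsval_ex m t s : csec (half b (- t)) s -> exists v : FS F h m (b, t), fsval v = s.
Proof.
rewrite -slice_Zset => cs.
exact: (@shr_val_ex _ plane (plane * R)%type (F m) (@pbar_cont R) (Zset h)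
  (@plane_hausdorff R) (@plane_locally_compact R) (@F_flabby m) (b, t) s
  (near_Zset_closed t) cs).
Qed.

Lemma frval_ex a m t s : a != 0 -> (forall i, csec (slice (Lset c h a i) (b, t)) (s i)) ->
  exists v : FSray c F h a m (b, t), frval v = s.
Proof.
move=> a0 cs.
have hv i := @shr_val_ex _ plane (plane * R)%type (F m) (@pbar_cont R) (Lset c h a i)
  (@plane_hausdorff R) (@plane_locally_compact R) (@F_flabby m) (b, t) (s i)
  (near_Lset_closed i t a0) (cs i).
exists (fun i => projT1 (cid (hv i))).
apply: functional_extensionality_dep => i; exact: (projT2 (cid (hv i))).
Qed.

Lemma frval_restr a m t (v : FS F h m (b, t)) i : a != 0 -> rep a b = 0 ->
  frval (FSrestr c F h a m (b, t) v) i =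
  restrict (slice (Lset c h a i) (b, t)) (fsval v).
Proof.
move=> a0 ab; apply: functional_extensionality_dep => x.
rewrite /frval /= /kmap; case: pselect => // h'.
by case: h'; exact: kadm_ZL.
Qed.
End FourierStalks.

(** * Restriction from half-planes to rays *)

Section HalfPlanes.
Variables (R : realType) (n : nat) (c : 'I_n -> R[i]) (F : cpx R[i] (plane R)).
Notation plane := (plane R).
Hypothesis F_flabby : flabby F.
Variables (a b : R[i]).
Hypothesis a0 : a != 0.
Hypothesis b0 : b != 0.
Hypothesis ab0 : rep a b = 0.
Let h := oray 0 b : set plane.

(* The stalk of FSrestr at (b, - q) is the restriction map from RGamma_c of the
   closed half-plane to the sum of the RGamma_c of the rays issued from its points. *)
Lemma half_cohom0 m (q : R) (s : forall x : plane, F (m + 1 + 1) x) :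
  quasi_iso (FSrestr c F h a) -> csec (half b q) s ->
  (forall x, df F (m + 1 + 1) x (s x) = 0) ->
  (forall k, q <= rep (c k) b ->
     cohom (ray (c k) a) (restrict (ray (c k) a) s) (fun=> 0)) ->
  cohom (half b q) s (fun=> 0).
Proof.
move=> qi cs ds hs.
have cs' : csec (half b (- (- q))) s by rewrite opprK.
have [v vE] := fsval_ex F_flabby b0 cs'.
have hmu k : exists mu : forall x, F (m + 1) x,
    csec (slice (Lset c h a k) (b, - q)) mu /\
    forall x, restrict (slice (Lset c h a k) (b, - q)) s x = df F (m + 1) x (mu x).
  have [qk|qk] := boolP (q <= rep (c k) b).
    have e : 0 <= - q + rep (c k) b by rewrite addrC subr_ge0.
    rewrite slice_Lset//; have [mu cmu emu] := hs _ qk.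
    by exists mu; split=> // x; rewrite -emu subr0.
  (* The ray of c k misses the half-plane: its slice is empty and 0 is a primitive. *)
  exists (fun=> 0); split; first exact: csec0.
  move=> x; rewrite linear0 restrict_out// => -[_ _ /= e].
  by move: qk; rewrite -subr_ge0 addrC e.
pose mu k := projT1 (cid (hmu k)).
have [cmu emu] : (forall k, csec (slice (Lset c h a k) (b, - q)) (mu k)) /\
    (forall k x, restrict (slice (Lset c h a k) (b, - q)) s x = df F (m + 1) x (mu k x)).
  by split=> k; case: (projT2 (cid (hmu k))).
have [w wE] := frval_ex F_flabby b0 a0 cmu.
pose y : plane * R := (b, - q).
have dv : df (FS F h) (m + 1 + 1) y v = 0.
  apply: fsval_inj; apply: functional_extensionality_dep => x.
  by rewrite -[RHS](ds x) -vE.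
have dw : FSrestr c F h a (m + 1 + 1) y v = df (FSray c F h a) (m + 1) y w.
  apply: frval_inj; apply: functional_extensionality_dep => i.
  rewrite frval_restr// vE; apply: functional_extensionality_dep => x.
  by rewrite emu -wE.
(* As dv = 0 and v restricts to dw, the pair (v, - w) is a cocycle of the cone; the first component
   of a primitive is, up to sign, a primitive of s. *)
have [] := @exact_atE _ (stalk_cpx (cone (FSrestr c F h a)) y) m (v, - w) (qi y (m + 1)).
  rewrite /= /cone_fun /= dv oppr0 linearN; congr (_, _).
  by rewrite dw; exact: subrr.
move=> [u w'] /= [e1 _].
have cu := csec_fsval u; rewrite opprK in cu.
exists (fun x => -1 *: fsval u x + 0); first exact: csecP cu (csec0 _ _).
move=> x; rewrite subr0 -vE e1 addr0 scaleN1r linearN.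
by [].
Qed.
End HalfPlanes.

(** * The cocycles given by the Stokes multipliers *)

Lemma ceq_at (k : fieldType) (R : realType) (M : topologicalType) (w : M) (t0 t1 : R)
    (G : cpx k (M * R)%type) m (X Y : cochain w G (m + 1)) t :
  t0 <= t <= t1 -> ceq t0 t1 X Y ->
  exists u : G (m + 1) (w, t), cl X t - cl Y t = df G (m + 1) (w, t) u.
Proof.
move=> tI [Z _ /(_ _ tI)[/= e _ _]]; exists (cl Z t).
by rewrite -e scaleN1r [RHS]addrC.
Qed.

Section Exponentials.
Variables (R : realType) (n : nat) (c : 'I_n -> R[i]).
Notation plane := (plane R).
Variable b : R[i].
Hypothesis b0 : b != 0.
Let h := oray 0 b : set plane.
Variables (t0 t1 : R).
Hypothesis t01 : t0 <= t1.
Hypothesis low : forall i, t0 + rep (c i) b < 0.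
Hypothesis high : forall i, 0 <= t1 + rep (c i) b.

(** The i-th component is 0 until t = - Re(c_i b) and constant afterwards; t0 precedes all these
    thresholds and t1 precedes none. The degree [Negz 2 + 1 + 1] is -1, so that [cl] has degree 0,
    in the form required by [zrel]. *)
Lemma exp_cocycle (M : 'I_n -> lmodType R[i]) (x : forall i, M i) :
  exists Z : cochain (M := plane) b (Eexp c h M) (Negz 2 + 1 + 1),
    ccycle t0 t1 Z /\
    forall i, subv ((cl Z t1 : Eexp c h M 0 (b, t1)) i) = x i.
Proof.
pose S i := [set y : plane * R | h y.1 /\ 0 <= y.2 + rep (c i) y.1].
pose C i := const (plane * R)%type (M i).
pose g i (p : plane * R) : C i p := if `[< S i p >] then x i else 0.
have gin i p : S i p -> g i p = x i by move=> Sp; rewrite /g asboolT.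
have gout i p : ~ S i p -> g i p = 0 by move=> Sp; rewrite /g asboolF.
have cg i t : ten_cont (F := C i) (S i) ((b, t) : (plane * R)%type) (g i).
  exists (fun=> x i); first by apply: filterE.
  apply: filterS (near_exp_closed b0 (c i) t) => y hy; split; first exact: gin.
  by move=> /hy; apply: filterS => y' /gout.
pose s (p : plane * R) : Eexp c h M 0 p :=
  fun i => stalk_lift (P := ten_presh (S i) (C i)) (g i) p.
have sE t i : subv (s (b, t) i) = g i (b, t).
  exact: (@stalk_liftE _ _ (ten_presh (S i) (C i)) (g i) (b, t) (cg i t)).
have cs t : cont (p := Eexp c h M 0) ((b, t) : (plane * R)%type) s.
  move=> i; exact: (@stalk_lift_cont _ _ (ten_presh (S i) (C i)) (g i) (b, t) (cg i t)).
exists (@Cochain _ _ plane b (Eexp c h M) (Negz 2 + 1 + 1)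
  (fun t => s (b, t)) (fun t => s (b, t)) (fun=> 0)); split; last first.
  move=> i; rewrite [LHS]sE gin//; split; last exact: high.
  exact: oray_self.
split.
  split.
  - by apply: (@piecewise_sec _ R plane b (Eexp c h M 0) s) => t _; exact: cs.
  - by move=> t _; apply: (@filterE _ (nbhs t)).
  apply: functional_extensionality_dep => i; apply: val_inj.
  by rewrite [LHS]sE gout// => -[_]; rewrite leNgt low.
by move=> t _; split => //=; rewrite subrr.
Qed.

(** The complex is concentrated in degree 0, so its stalks have no nonzero coboundaries there. *)
Lemma exp_ceq (M : 'I_n -> lmodType R[i])
    (X Y : cochain (M := plane) b (Eexp c h M) (Negz 2 + 1 + 1)) :
  ceq t0 t1 X Y -> cl X t1 = cl Y t1.
Proof.
have tI : t0 <= t1 <= t1 by rewrite lexx t01.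
by move=> /(ceq_at tI)[u e]; apply/eqP; rewrite -subr_eq0 e.
Qed.
End Exponentials.

Section StokesCocycle.
Variables (R : realType) (n : nat) (c : 'I_n -> R[i]) (F : cpx R[i] (plane R)).
Notation plane := (plane R).
Variables (alpha beta b : R[i]).
Hypothesis alpha0 : alpha != 0.
Hypothesis b0 : b != 0.
Hypothesis ab0 : rep alpha b = 0.
Variable A : forall i j, {linear Phi c F alpha j -> Phi c F alpha i}.

(** The equality of zigzags defining the Stokes multiplier is applied to the cocycle of exponentials
    with coefficients x; the intermediate cocycle on the Fourier-Sato complex, read at the right end
    of the segment, is Y. *)
Lemma stokes_cocycle (x : forall j, Phi c F alpha j) : is_stokes beta b A ->
  exists (q : R) (Y : forall z : plane, F 0 z),
  [/\ forall k, q <= rep (c k) b, csec (half b q) Y,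
      forall z, df F 0 z (Y z) = 0,
      forall k, exists2 g : Gam_cpx (ten_cpx (ray (c k) alpha) F) 0, class_of g (x k) &
        @cohom _ _ F (ray (c k) alpha) (-1) (restrict (ray (c k) alpha) Y) (gval g) &
      forall k, exists (tau : {linear Phi c F (- alpha) k -> Phi c F alpha k})
          (x' : Phi c F (- alpha) k)
          (g : Gam_cpx (ten_cpx (ray (c k) (- alpha)) F) 0),
        [/\ is_tau beta tau, class_of g x',
          @cohom _ _ F (ray (c k) (- alpha)) (-1)
            (restrict (ray (c k) (- alpha)) Y) (gval g) &
          tau x' = \sum_j A k j (x j)]].
Proof.
move=> [_ [tau [can [can' [tauE [AE [qr [qc' [[htau hcan hcan' htauE hAE] heq]]]]]]]]].
(* At t = - N - 1 no exponential has started, and at t = N all of them have. *)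
pose N := \sum_k `|rep (c k) b|.
have cN k : `|rep (c k) b| <= N.
  by rewrite /N (bigD1 k)//= lerDl sumr_ge0.
have N0 : 0 <= N by apply: sumr_ge0.
have low k : (- N - 1) + rep (c k) b < 0.
  by have := cN k; rewrite ler_norml => /andP[_ e]; lra.
have high k : 0 <= N + rep (c k) b.
  by have := cN k; rewrite ler_norml => /andP[e _]; lra.
have t01 : - N - 1 <= N by lra.
have tI : - N - 1 <= N <= N by rewrite lexx t01.
have [Z [cZ ZE]] := exp_cocycle b0 low high x.
(* Backwards along the zigzag: [Z5] and [Z1] lie in the sums of exponentials, [Z4] and [Z2] live
   over the rays, and [Z3] is a cocycle of [FS] restricting to both [Z4] and [Z2] up to
   coboundary. *)
have := (eqz_zrel t01 heq Z (ccycle_push AE cZ)).2.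
move=> /(_ _)[|Z5 [cZ5 [Z4 [cZ4 [Z3 [cZ3 [Z2 [cZ2 [Z1 [cZ1 zZ1 e2]]]] e3] e4]] e5]] e6].
  by exists Z; split; [exact: cZ|exact: ceq_refl|exact: ceq_refl].
pose h := oray 0 b : set plane.
pose v : FS F h 0 (b, N) := cl Z3 N.
have [_ /(_ _ tI)[dv _ _]] := cZ3.
have rE a k z : a != 0 -> rep a b = 0 ->
    restrict (ray (c k) a) (fsval v) z = frval (FSrestr c F h a 0 (b, N) v) k z.
  by move=> a0 ab; rewrite frval_restr// slice_Lset.
exists (- N), (fsval v); split.
- by move=> k; rewrite -subr_ge0 opprK addrC.
- exact: csec_fsval.
- by move=> z; have := congr1 (fun s : FS F h 1 (b, N) => fsval s z) dv.
- move=> k; have [rho rhoc rhoE] := hcan.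
  exists (rho k (x k)); first exact: rhoc.
  have [u eu] := ceq_at tI (ceq_trans e3 (ceq_sym e2)).
  exists (frval (u : FSray c F h alpha (-1) (b, N)) k).
    rewrite -(slice_Lset alpha (high k)).
    exact: (csec_frval (u : FSray c F h alpha (-1) (b, N)) k).
  move=> z; rewrite rE//.
  have zE : cl Z1 N = cl Z N by apply/esym/(exp_ceq t01).
  rewrite /gval -ZE -zE -rhoE.
  by have := congr1 (fun s : FSray c F h alpha 0 (b, N) => frval s k z) eu.
move=> k; have [rho rhoc rhoE] := hcan'.
pose x' : Phi c F (- alpha) k := subv ((cl Z5 N : Eexp c h (Phi c F (- alpha)) 0 (b, N)) k).
exists (tau k), x', (rho k x'); split.
- exact: htau.
- exact: rhoc.
- have [u eu] := ceq_at tI (ceq_trans e4 (ceq_sym e5)).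
  exists (frval (u : FSray c F h (- alpha) (-1) (b, N)) k).
    rewrite -(slice_Lset (- alpha) (high k)).
    exact: (csec_frval (u : FSray c F h (- alpha) (-1) (b, N)) k).
  move=> z; rewrite rE ?oppr_eq0 ?repNl ?ab0 ?oppr0//.
  rewrite /gval -rhoE.
  by have := congr1 (fun s : FSray c F h (- alpha) 0 (b, N) => frval s k z) eu.
have eq6 := exp_ceq t01 e6.
have := congr1 (fun s : Eexp c h (Phi c F alpha) 0 (b, N) => subv (s k)) eq6.
rewrite [X in X = _ -> _]htauE [X in _ = X -> _]hAE /= high => ->.
by apply: eq_bigr => j _; rewrite -ZE.
Qed.
End StokesCocycle.

(** * Entries of the Stokes multipliers *)

Section Entries.
Variables (R : realType) (n : nat) (alpha beta : R[i]) (c : 'I_n -> R[i]).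
Variable F : cpx R[i] (plane R).
Notation plane := (plane R).
Hypothesis alpha0 : alpha != 0.
Hypothesis beta0 : beta != 0.
Hypothesis ab0 : rep alpha beta = 0.
Hypothesis c_incr : forall i j : 'I_n, (i < j)%N -> rep (c i) beta < rep (c j) beta.
Hypothesis F_flabby : flabby F.
Hypothesis qis_plus : quasi_iso (FSrestr c F (oray 0 beta) alpha).
Hypothesis qis_minus : quasi_iso (FSrestr c F (oray 0 (- beta)) alpha).

Let strip := strip beta c.
Let strip_gt := strip_gt beta c.
Let strip_ge := strip_ge beta c.
Let r i := rep (c i) beta.
Let slits : set plane := ~` \bigcup_i ray (c i) alpha.
Let T i : set plane := strip_gt i `|` oray (c i) alpha.
Let up i : set plane := ray (c i) alpha.
Let down i : set plane := ray (c i) (- alpha).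
(** [cohom] compares sections of degree m + 1, hence the index -1 for degree 0. *)
Notation coh S s t := (@cohom _ _ F S (-1) s t).
Notation sec := (forall z : plane, F 0 z).

Let Nalpha0 : - alpha != 0. Proof. by rewrite oppr_eq0. Qed.
Let Nbeta0 : - beta != 0. Proof. by rewrite oppr_eq0. Qed.
Let Nab0 : rep (- alpha) beta = 0. Proof. by rewrite repNl ab0 oppr0. Qed.
Let aNb0 : rep alpha (- beta) = 0. Proof. by rewrite repNr ab0 oppr0. Qed.
Let NaNb0 : rep (- alpha) (- beta) = 0. Proof. by rewrite repNr Nab0 oppr0. Qed.

Lemma rep_c_le i k : (r i <= r k) = (i <= k)%N.
Proof.
case: (ltngtP i k) => [h|h|/val_inj ->]; last by rewrite lexx.
  by rewrite ltW// c_incr.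
by apply/negbTE; rewrite -ltNge c_incr.
Qed.

Let coh_refl S (s : sec) : coh S s s. Proof. exact: (@cohom_refl _ _ F S (-1)). Qed.
Let coh_sym S (s t : sec) : coh S s t -> coh S t s.
Proof. exact: (@cohom_sym _ _ F S (-1)). Qed.
Let coh_trans S (s t u : sec) : coh S s t -> coh S t u -> coh S s u.
Proof. exact: (@cohom_trans _ _ F S (-1)). Qed.
Let coh_eq S (s t s' t' : sec) :
  coh S s t -> (forall z, s z = s' z) -> (forall z, t z = t' z) -> coh S s' t'.
Proof. exact: (@cohom_eq _ _ F S (-1)). Qed.
Let cohB S (s t s' t' : sec) : coh S s t -> coh S s' t' ->
  coh S (fun z => s z - s' z) (fun z => t z - t' z).
Proof. exact: (@cohomB _ _ F S (-1)). Qed.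
Let coh_restrict S S' (s t : sec) : kadm S S' -> coh S s t ->
  coh S' (restrict S' s) (restrict S' t).
Proof. exact: (@cohom_restrict _ _ F S S' (-1)). Qed.
Let coh_class S (g g' : Gam_cpx (ten_cpx S F) 0) a :
  class_of g a -> class_of g' a -> coh S (gval g) (gval g').
Proof. exact: (@class_of_cohom _ _ F S (-1)). Qed.
Let coh_class0 S (g : Gam_cpx (ten_cpx S F) 0) : class_of g 0 -> coh S (gval g) (fun=> 0).
Proof. exact: (@class_of_cohom0 _ _ F S (-1)). Qed.
Let class_coh S (g g' : Gam_cpx (ten_cpx S F) 0) a :
  class_of g a -> (forall z, df F 0 z (gval g' z) = 0) ->
  coh S (gval g) (gval g') -> class_of g' a.
Proof. exact: (@cohom_class_of _ _ F S (-1)). Qed.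
Let resB S (s t : sec) z :
  restrict S (fun z => s z - t z) z = restrict S s z - restrict S t z.
Proof. exact: (@restrictB _ _ F S 0). Qed.
Let resD S (s t : sec) z :
  restrict S (fun z => s z + t z) z = restrict S s z + restrict S t z.
Proof. exact: (@restrictD _ _ F S 0). Qed.
Let res0 S z : restrict S (fun z => 0 : F 0 z) z = 0.
Proof. exact: (@restrict0 _ _ F S 0). Qed.

Let half_up (q : R) (s : sec) : csec (half beta q) s ->
  (forall z, df F 0 z (s z) = 0) ->
  (forall k, q <= r k -> coh (up k) (restrict (up k) s) (fun=> 0)) ->
  coh (half beta q) s (fun=> 0).
Proof.
(* With m = -2 the degree m + 1 + 1 is 0. *)
exact: (@half_cohom0 R n c F F_flabby alpha beta alpha0 beta0 ab0 (-2)).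
Qed.
Let half_down i (s : sec) : csec (half (- beta) (- r i)) s ->
  (forall z, df F 0 z (s z) = 0) ->
  (forall k : 'I_n, (k <= i)%N -> coh (up k) (restrict (up k) s) (fun=> 0)) ->
  coh (half (- beta) (- r i)) s (fun=> 0).
Proof.
move=> cs ds hs.
apply: (@half_cohom0 R n c F F_flabby alpha (- beta) alpha0 Nbeta0 aNb0 (-2)) => //.
by move=> k; rewrite repNr lerN2 rep_c_le; exact: hs.
Qed.

(** Let W represent the class on [strip_ge] that restricts to y. Then P - W is trivial on every ray
    l_k(alpha) of the half-plane, hence a coboundary there, so P and W have the same class on l_i(-
    alpha), where W computes [tau]. *)
Lemma tau_eq i (P : sec) (tau : {linear Phi c F (- alpha) i -> Phi c F alpha i})
    (y : Phi c F alpha i) (gy : Gam_cpx (ten_cpx (up i) F) 0)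
    (x' : Phi c F (- alpha) i) (g' : Gam_cpx (ten_cpx (down i) F) 0) :
  is_tau beta tau -> csec (half beta (r i)) P -> (forall z, df F 0 z (P z) = 0) ->
  (forall k : 'I_n, (i < k)%N -> coh (up k) (restrict (up k) P) (fun=> 0)) ->
  class_of gy y -> coh (up i) (restrict (up i) P) (gval gy) ->
  class_of g' x' -> coh (down i) (restrict (down i) P) (gval g') ->
  tau x' = y.
Proof.
move=> [res [res' [[ires ires' bres bres'] tauE]]] cP dP hk cy hy cx' hx'.
have [inv _ resK] := bres.
pose a := inv y; have ya : y = res a by rewrite resK.
have [W cW] := class_of_ex a.
have Wy := ires _ _ cW; have Wx' := ires' _ _ cW.
have adm := kadm_ge_ray c_incr i alpha0 ab0.
have adm' := kadm_ge_ray c_incr i Nalpha0 Nab0.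
have cWD : csec (half beta (r i)) (restrict (half beta (r i)) (gval W)).
  exact: csec_restrict (kadm_ge_half _ _ _) (csec_gval W).
have WD z : restrict (half beta (r i)) (gval W) z = gval W z.
  rewrite /restrict; case: asboolP => // nz.
  by rewrite (csec_out (csec_gval W))// => -[_ /nz].
pose E : sec := fun z => P z - gval W z.
have cE : csec (half beta (r i)) E.
  by apply: csec_eq (csecB cP cWD) _ => z; rewrite WD.
have E0 : coh (half beta (r i)) E (fun=> 0).
  apply: half_up => // [z|k].
    by rewrite linearB dP [X in _ - X](class_of_cocycle cW) subr0.
  rewrite rep_c_le leq_eqVlt => /orP[/eqP/val_inj <-|ik].
    rewrite -ya in Wy; have h := coh_class cy Wy.
    have := cohB (coh_trans hy h) (coh_refl _ (restrict (up i) (gval W))).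
    by move/coh_eq; apply=> z; [rewrite resB|rewrite gval_induced// subrr].
  (* W is supported in the strip of c i, which the later rays do not meet. *)
  apply: coh_eq (hk _ ik) _ _ => // z.
  rewrite resB [X in _ - X]/restrict.
  case: asboolP => [zk|]; last by rewrite subr0.
  rewrite (csec_out (csec_gval W)) ?subr0// => -[/strip_eq h _].
  have e := h _ (rep_ray ab0 zk).
  by move: ik; rewrite e ltnn.
have admD : kadm (half beta (r i)) (down i) by exact: kadm_half_ray.
have h := coh_restrict admD E0.
have {}h : coh (down i) (restrict (down i) P) (restrict (down i) (gval W)).
  have := cohB h (coh_refl _ (fun z => - restrict (down i) (gval W) z)).
  by move/coh_eq; apply=> z; [rewrite resB opprK subrK|rewrite res0 opprK add0r].
have xE : x' = res' a.
  apply: (class_of_fun cx'); apply: (class_coh Wx').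
    exact: class_of_cocycle cx'.
  rewrite gval_induced//.
  exact: coh_trans (coh_sym h) hx'.
by rewrite xE tauE ya.
Qed.

Variables (u : forall i, {linear Psi alpha c F -> Phi c F alpha i}).
Variables (v : forall i, {linear Phi c F alpha i -> Psi alpha c F}).
Hypothesis F_quiver : is_quiver beta u v.

(* s represents x near the ray of c j and Y is a one-sided primitive, near the ray of
   c i, of the class v j x of the differential of s. *)
Lemma quiver_sections i j (x : Phi c F alpha j) :
  exists s Y eta : sec,
  [/\ csec (strip j) s, csec (T i) Y & csec slits eta] /\
  [/\ forall z, df F 0 z (Y z) - df F 0 z (s z) = df F 0 z (eta z),
      forall z, ~ strip_gt i z -> df F 0 z (Y z) = 0,
      exists2 g : Gam_cpx (ten_cpx (up j) F) 0,
        class_of g x & gval g = restrict (up j) s &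
      exists2 g : Gam_cpx (ten_cpx (up i) F) 0,
        class_of g (u i (v j x)) & gval g = restrict (up i) Y].
Proof.
have [u_i [_ [d1 [e1 [_ [e2 [[iu ie1 ie2] [cd1 [_ [[bd1 be1 be2] [_ [uE _]]]]]]]]]]]] := F_quiver i.
have [_ [v_j [d1' [e1' [d2 [e2' [[_ _ ie2'] [_ [cd2 [_ [vE [_ vE']]]]]]]]]]]] := F_quiver j.
(* The class v j x, computed at c j, is brought back to c i through the isomorphism theta of c i;
   the definition of u i applies to psi. *)
have [psi psiE] : exists psi, v j x = e2 (e1 (d1 psi)).
  have [i1 _ k1] := bd1; have [i2 _ k2] := be1; have [i3 _ k3] := be2.
  by exists (i1 (i2 (i3 (v j x)))); rewrite k1 k2 k3.
have [s [t [cs ts ct]]] := cd2 x.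
have [Y [t' [cY tY ct']]] := cd1 psi.
have := ie2' _ _ ct; rewrite -vE -vE' => ct1.
have := ie2 _ _ (ie1 _ _ ct'); rewrite -psiE => ct2.
have ksl k := kadm_slit c alpha0 ab0 k.
have tE z : gval t z = df F 0 z (gval s z).
  have [sz|nz] := pselect (strip j z).
    have := congr1 (fun g : Gam (ten (strip j) (F 1)) => gval g z) ts.
    rewrite gval_induced; last exact: kadm_slit_strip.
    by rewrite restrict_in.
  by rewrite (csec_out (csec_gval t)) ?(csec_out (csec_gval s))// ?linear0// => -[].
have t'E z : gval t' z = df F 0 z (gval Y z).
  have [sz|nz] := pselect (T i z).
    have := congr1 (fun g : Gam (ten (T i) (F 1)) => gval g z) tY.
    rewrite gval_induced; last exact: kadm_gt_ge.
    by rewrite restrict_in.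
  rewrite (csec_out (csec_gval t')) ?(csec_out (csec_gval Y))// ?linear0//.
  by move=> h; apply: nz; left.
(* dY and ds both represent v j x on the complement of the rays. The primitive eta of their
   difference lives there, so it vanishes on the rays. *)
have [eta ceta eE] := class_of_cohom (m := 0) ct2 ct1.
exists (gval s), (gval Y), eta; split; first by split => //; exact: csec_gval.
have slitE k (w : Gam_cpx (ten_cpx (strip k `\` ray (c k) alpha) F) 1) z :
    gval (Gam_kmap F _ slits 1 w) z = gval w z.
  rewrite gval_induced; last exact: kadm_slit.
  rewrite /restrict; case: asboolP => // nz; rewrite (csec_out (csec_gval w))//.
  move=> [sz nr]; apply: nz => -[l _ /[dup] /(rep_ray ab0) /(strip_eq sz) <-].
  exact: nr.
split.
- move=> z; rewrite -eE slitE slitE tE gval_induced; last exact: kadm_strip_gt.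
  congr (_ - _); rewrite -t'E /restrict; case: asboolP => // nz.
  rewrite (csec_out (csec_gval t'))// => sz; apply: nz.
  case: sz => sz h; split => // /(rep_ray ab0) e.
  by move: h; rewrite /= e ltxx.
- by move=> z nz; rewrite -t'E (csec_out (csec_gval t')).
- eexists; first exact: cs.
  by rewrite gval_induced//; exact: kadm_strip_ray.
eexists; first by rewrite psiE uE; exact: iu cY.
rewrite gval_induced; last exact: kadm_oray_ray.
rewrite gval_induced; last exact: kadm_gt_oray.
apply: functional_extensionality_dep => z.
have [zr|nz] := pselect (up i z); last by rewrite !restrict_out.
rewrite !(restrict_in _ zr); have [zo|no] := pselect (oray (c i) alpha z).
  by rewrite restrict_in.
(* The remaining point is c i, which is outside [T i]. *)
rewrite restrict_out// (csec_out (csec_gval Y))// => -[[_ /=]|//].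
by rewrite (rep_ray ab0 zr) ltxx.
Qed.

Let csec_total S (s : sec) : kadm S setT -> csec S s -> csec setT s.
Proof.
by move=> h /(csec_restrict h) cs; apply: csec_eq cs _ => z; rewrite restrict_in.
Qed.

Let up_half (i k : 'I_n) : (i <= k)%N -> up k `<=` half beta (r i).
Proof. by move=> ik z /(rep_ray ab0) e; rewrite /half /= e rep_c_le. Qed.

Let up_half' (i k : 'I_n) : (k <= i)%N -> up k `<=` half (- beta) (- r i).
Proof. by move=> ik z /(rep_ray ab0) e; rewrite /half /= repNr lerN2 e rep_c_le. Qed.

Let down_half i : down i `<=` half beta (r i).
Proof. by move=> z /(rep_ray Nab0) e; rewrite /half /= e. Qed.

Let down_half' i : down i `<=` half (- beta) (- r i).
Proof. by move=> z /(rep_ray Nab0) e; rewrite /half /= repNr lerN2 e. Qed.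

Let slits_up k (s : sec) z : csec slits s -> restrict (up k) s z = 0.
Proof.
move=> cs; rewrite /restrict; case: asboolP => // zk.
by rewrite (csec_out cs)// => h; apply: h; exists k.
Qed.

Let strip_line0 j k a (s : sec) z : rep a beta = 0 -> csec (strip j) s -> k != j ->
  restrict (ray (c k) a) s z = 0.
Proof.
move=> ab cs kj; rewrite /restrict; case: asboolP => // /(rep_ray ab) e.
by rewrite (csec_out cs)// => /strip_eq /(_ e) jk; rewrite jk eqxx in kj.
Qed.

Let T_up i k (s : sec) z : csec (T i) s -> k != i -> restrict (up k) s z = 0.
Proof.
move=> cs ki; rewrite /restrict; case: asboolP => // /(rep_ray ab0) e.
rewrite (csec_out cs)// => zT.
have : strip i z by case: zT => [[]//|/(rep_oray ab0)/(strip_line c_incr)].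
by move=> /strip_eq /(_ e) ik; rewrite ik eqxx in ki.
Qed.

Let T_down i (s : sec) z : csec (T i) s -> restrict (down i) s z = 0.
Proof.
move=> cs; rewrite /restrict; case: asboolP => // zd.
rewrite (csec_out cs)// => -[[_ /=]|].
  by rewrite (rep_ray Nab0 zd) ltxx.
case: zd => [p p0 ->] [p' p'0] /addrI /eqP.
rewrite mulrN -mulNr -rmorphN => /eqP /(mulIf alpha0) /complexI e.
by move: p0; rewrite -oppr_le0 e leNgt p'0.
Qed.

(** Inclusion of the j-th summand, which isolates the j-th column of a Stokes matrix; the transport
    is there because the summands depend on the index. *)
Definition delta j (x : Phi c F alpha j) k : Phi c F alpha k :=
  if @eqP _ k j is ReflectT e then eq_rect_r (fun k => Phi c F alpha k) x e else 0.

Lemma delta_id j (x : Phi c F alpha j) : delta x j = x.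
Proof. by rewrite /delta; case: eqP => // e; rewrite (eq_irrelevance e erefl). Qed.

Lemma delta_neq j (x : Phi c F alpha j) k : k != j -> delta x k = 0.
Proof. by rewrite /delta; case: eqP. Qed.

Lemma sum_delta j (x : Phi c F alpha j) k
    (A : forall i j, {linear Phi c F alpha j -> Phi c F alpha i}) :
  \sum_l A k l (delta x l) = A k j x.
Proof.
rewrite (bigD1 j)//= delta_id big1 ?addr0// => l lj.
by rewrite delta_neq// linear0.
Qed.

Section Cocycle.
Variables (j : 'I_n) (x : Phi c F alpha j) (Yc : sec).
Hypothesis Yc_up : forall k, exists2 g : Gam_cpx (ten_cpx (up k) F) 0,
  class_of g (delta x k) & coh (up k) (restrict (up k) Yc) (gval g).
Variables s : sec.
Hypothesis cs : csec (strip j) s.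
Hypothesis s_up : exists2 g : Gam_cpx (ten_cpx (up j) F) 0,
  class_of g x & gval g = restrict (up j) s.

(** Both sides represent [delta x k]: the strip containing the support of s meets no ray but that of
    c j. *)
Lemma coh_Yc_s k : coh (up k) (restrict (up k) Yc) (restrict (up k) s).
Proof.
have [g cg hg] := Yc_up k; apply: coh_trans hg _.
have [e|kj] := eqVneq k j; last first.
  rewrite delta_neq// in cg; apply: coh_eq (coh_class0 cg) _ _ => // z.
  by rewrite (strip_line0 _ ab0 cs).
subst k; rewrite delta_id in cg.
have [gs cgs gsE] := s_up; rewrite -gsE; exact: coh_class cg cgs.
Qed.
End Cocycle.

(** The Stokes cocycle cut to Re(z beta) >= r_i represents x on l_i(alpha) and 0 on the rays further
    right, which is what [tau_eq] asks for. *)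
Lemma stokes_plus_diag A i (x : Phi c F alpha i) : is_stokes beta beta A -> A i i x = x.
Proof.
move=> hA.
have [q [Yc [qc cYc dYc Yc_up Yc_down]]] := stokes_cocycle alpha0 beta0 ab0 (delta x) hA.
have [tau [x' [g' [htau cg' hg' eA]]]] := Yc_down i.
rewrite -(sum_delta x) -eA; have [g cg hg] := Yc_up i; rewrite delta_id in cg.
have sub (k : 'I_n) : (i <= k)%N -> forall z : plane,
    restrict (up k) Yc z = restrict (up k) (restrict (half beta (r i)) Yc) z.
  by move=> ik z; rewrite restrict_sub//; exact: up_half.
apply: (@tau_eq i (restrict (half beta (r i)) Yc) tau x g x' g' htau) => //.
- by apply: csec_restrict cYc; apply: kadm_half_half; exact: qc.
- by move=> z; rewrite df_restrict /restrict dYc if_same.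
- move=> k ik; have [gk cgk hgk] := Yc_up k.
  rewrite delta_neq ?gt_eqF// in cgk.
  by apply: coh_eq (coh_trans hgk (coh_class0 cgk)) _ _ => //; apply: sub; exact: ltnW.
- by apply: coh_eq hg _ _ => //; exact: sub.
by apply: coh_eq hg' _ _ => // z; rewrite restrict_sub.
Qed.

(** Yc represents 0 on l_i(alpha). A correction turns this into u_i v_j x without changing the class
    on l_i(- alpha), and [tau_eq] then evaluates the entry. *)
Lemma stokes_plus_off A (i j : 'I_n) (x : Phi c F alpha j) :
  is_stokes beta beta A -> (i < j)%N -> A i j x = u i (v j x).
Proof.
move=> hA ij.
have [q [Yc [qc cYc dYc Yc_up Yc_down]]] := stokes_cocycle alpha0 beta0 ab0 (delta x) hA.
have [tau [x' [g' [htau cg' hg' eA]]]] := Yc_down i.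
have [s [Y [eta [[cs cY ceta] [dE dY s_up [gY cgY gYE]]]]]] := quiver_sections i x.
have Ycs := coh_Yc_s Yc_up cs s_up.
have nij : i != j by rewrite lt_eqF.
rewrite -(sum_delta x) -eA.
pose D := half beta (r i); pose D' := half (- beta) (- r i).
(* The correction is closed by [dE]. On each l_k(alpha), s cancels Yc up to coboundary and eta
   vanishes, which leaves Y. *)
pose P : sec := fun z => Yc z - (s z + eta z - Y z).
have cP : csec D (restrict D P).
  have c1 : csec D (restrict D Yc) by apply: csec_restrict cYc; apply: kadm_half_half; exact: qc.
  have c2 : csec D (restrict D s).
    by apply: csec_restrict (kadm_setT_half _ _) (csec_total (kadm_strip_setT _ _ _) cs).
  have c3 : csec D (restrict D eta).
    by apply: csec_restrict (kadm_setT_half _ _) (csec_total (kadm_slits_setT _ alpha0) ceta).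
  have c4 : csec D (restrict D Y) by apply: csec_restrict (kadm_gt_half alpha0 beta0 ab0 c_incr _) cY.
  by apply: csec_eq (csecB c1 (csecB (csecD c2 c3) c4)) _ => z; rewrite !resB resD.
have upP k z : restrict (up k) P z =
    restrict (up k) Yc z - restrict (up k) s z + restrict (up k) Y z.
  by rewrite /P !resB resD [restrict _ eta _]slits_up// addr0 opprB addrA addrAC.
have cohP k : coh (up k) (restrict (up k) P) (restrict (up k) Y).
  have := cohB (cohB (Ycs k) (coh_refl _ (restrict (up k) s)))
    (coh_refl _ (fun z => - restrict (up k) Y z)).
  by move/coh_eq; apply=> z; [rewrite upP opprK|rewrite subrr opprK add0r].
(* On Re(z beta) <= r_i both s and dY vanish, the strip of c j being to the right of c i. So eta is
   closed there and, being 0 on the rays l_k(alpha), is a coboundary. *)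
have eta0 : coh (down i) (restrict (down i) eta) (fun=> 0).
  have ceta' : csec D' (restrict D' eta).
    by apply: csec_restrict (kadm_setT_half _ _) (csec_total (kadm_slits_setT _ alpha0) ceta).
  have deta z : df F 0 z (restrict D' eta z) = 0.
    rewrite df_restrict /restrict; case: asboolP => // zD; rewrite -dE.
    have zr : rep z beta <= r i by move: zD; rewrite /D' /half /= repNr lerN2.
    rewrite dY; last by move=> [_ /=]; rewrite ltNge zr.
    rewrite (csec_out cs) ?linear0 ?oppr0 ?addr0// => -[/(_ _ ij)].
    by rewrite ltNge zr.
  have h : coh D' (restrict D' eta) (fun=> 0).
    apply: half_down => // k ki; apply: coh_eq (coh_refl _ (fun=> 0)) _ _ => // z.
    by rewrite restrict_sub ?[restrict _ eta _]slits_up//; exact: up_half'.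
  have := coh_restrict (kadm_half_ray (c := c) (k := i) Nalpha0 NaNb0 _) h.
  move=> h'; apply: coh_eq (h' _) _ _ => [|z|z]; first by rewrite repNr.
    by rewrite restrict_sub//; exact: down_half'.
  exact: res0.
have subP (k : 'I_n) : (i <= k)%N -> forall z : plane,
    restrict (up k) P z = restrict (up k) (restrict D P) z.
  by move=> ik z; rewrite restrict_sub//; exact: up_half.
apply: (@tau_eq i (restrict D P) tau (u i (v j x)) gY x' g' htau) => //.
- move=> z; rewrite df_restrict /restrict; case: asboolP => // _.
  rewrite /P !(linearB (df F 0 z)) (linearD (df F 0 z)) dYc -dE.
  by rewrite [df F 0 z (s z) + _]addrC subrK subrr subr0.
- move=> k ik; apply: coh_eq (cohP k) _ _ => [z|z]; first exact/subP/ltnW.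
  by rewrite (T_up _ cY)// gt_eqF.
- by apply: coh_eq (cohP i) _ _ => [z|z]; [exact: subP|rewrite gYE].
have := cohB hg' eta0.
move/coh_eq; apply=> z; last by rewrite subr0.
rewrite restrict_sub; last exact: down_half.
by rewrite /P !resB resD (strip_line0 _ Nab0 cs)// (T_down _ cY) add0r subr0.
Qed.

(** Along - beta, Yc lives on a half-plane Re(z beta) <= - q, whereas [tau_eq] asks for a cocycle on
    Re(z beta) >= r_i. The latter is P, and Q compares it with Yc on l_i(- alpha). Through
    [delta x i] the diagonal entry is treated with those below it. *)
Lemma stokes_minus A (i j : 'I_n) (x : Phi c F alpha j) :
  is_stokes beta (- beta) A -> (j <= i)%N -> A i j x = delta x i - u i (v j x).
Proof.
move=> hA ji.
have [q [Yc [qc cYc dYc Yc_up Yc_down]]] := stokes_cocycle alpha0 Nbeta0 aNb0 (delta x) hA.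
have [tau [x' [g' [htau cg' hg' eA]]]] := Yc_down i.
have [s [Y [eta [[cs cY ceta] [dE dY s_up [gY cgY gYE]]]]]] := quiver_sections i x.
have Ycs := coh_Yc_s Yc_up cs s_up.
rewrite -(sum_delta x) -eA.
pose D := half beta (r i); pose D' := half (- beta) (- r i).
have c2 b' q' : csec (half b' q') (restrict (half b' q') s).
  by apply: csec_restrict (kadm_setT_half _ _) (csec_total (kadm_strip_setT _ _ _) cs).
have c3 b' q' : csec (half b' q') (restrict (half b' q') eta).
  by apply: csec_restrict (kadm_setT_half _ _) (csec_total (kadm_slits_setT _ alpha0) ceta).
pose P : sec := fun z => s z + eta z - Y z.
pose Q : sec := fun z => Yc z - (s z + eta z).
have cP : csec D (restrict D P).
  have c4 : csec D (restrict D Y) by apply: csec_restrict (kadm_gt_half alpha0 beta0 ab0 c_incr _) cY.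
  by apply: csec_eq (csecB (csecD (c2 _ _) (c3 _ _)) c4) _ => z; rewrite resB resD.
have cQ : csec D' (restrict D' Q).
  have c1 : csec D' (restrict D' Yc).
    by apply: csec_restrict cYc; apply: kadm_half_half; rewrite /r -repNr; exact: qc.
  by apply: csec_eq (csecB c1 (csecD (c2 _ _) (c3 _ _))) _ => z; rewrite resB resD.
(* On this side dY = 0, so Q is closed; on the rays it equals Yc - s, which is trivial. *)
have Q0 : coh D' (restrict D' Q) (fun=> 0).
  apply: half_down => // [z|k ki].
    rewrite df_restrict /restrict; case: asboolP => // zD.
    have zr : rep z beta <= r i by move: zD; rewrite /D' /half /= repNr lerN2.
    rewrite /Q (linearB (df F 0 z)) (linearD (df F 0 z)) dYc -dE.
    rewrite [df F 0 z (s z) + _]addrC subrK sub0r.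
    by rewrite dY ?oppr0// => -[_ /=]; rewrite ltNge zr.
  have := cohB (Ycs k) (coh_refl _ (restrict (up k) s)).
  move/coh_eq; apply=> z; last by rewrite subrr.
  rewrite restrict_sub; last exact: up_half'.
  by rewrite /Q resB resD [restrict _ eta _]slits_up// addr0.
have subP (k : 'I_n) : (i <= k)%N -> forall z : plane,
    restrict (up k) P z = restrict (up k) (restrict D P) z.
  by move=> ik z; rewrite restrict_sub//; exact: up_half.
have upP k z : restrict (up k) P z = restrict (up k) s z - restrict (up k) Y z.
  by rewrite /P resB resD [restrict _ eta _]slits_up// addr0.
have [g cg hg] := Yc_up i.
apply: (@tau_eq i (restrict D P) tau _ (g - gY) x' g' htau) => //.
- move=> z; rewrite df_restrict /restrict; case: asboolP => // _.
  by rewrite /P (linearB (df F 0 z)) (linearD (df F 0 z)) -dE [df F 0 z (s z) + _]addrC subrK subrr.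
- move=> k ik; apply: coh_eq (coh_refl _ (fun=> 0)) _ _ => // z.
  rewrite -subP ?(ltnW ik)// upP (T_up _ cY) ?gt_eqF// (strip_line0 _ ab0 cs) ?subr0//.
  by rewrite gt_eqF//; exact: leq_ltn_trans ji ik.
- exact: class_ofB.
- have h := coh_trans (coh_sym (Ycs i)) hg.
  have := cohB h (coh_refl _ (gval gY)).
  by move/coh_eq; apply=> z //; rewrite -subP// upP gYE.
have := coh_restrict (kadm_half_ray (c := c) (k := i) Nalpha0 NaNb0 _) Q0.
move=> h; have {}h : coh (down i) (restrict (down i) Q) (fun=> 0).
  apply: coh_eq (h _) _ _ => [|z|z]; first by rewrite repNr.
    by rewrite restrict_sub//; exact: down_half'.
  exact: res0.
have := cohB hg' h.
move/coh_eq; apply=> z; last by rewrite subr0.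
rewrite restrict_sub; last exact: down_half.
by rewrite /P /Q !resB !resD (T_down _ cY) subr0 subKr.
Qed.
End Entries.

(** * Inversion of the block triangular matrix *)

Lemma enum_ord_gt n (i : 'I_n) :
  [seq j : 'I_n <- enum 'I_n | (i < j)%N] = drop i.+1 (enum 'I_n).
Proof.
apply: (inj_map val_inj); rewrite map_drop val_enum_ord.
have -> : map val [seq j : 'I_n <- enum 'I_n | (i < j)%N] =
    [seq k <- iota 0 n | (i < k)%N].
  by rewrite -val_enum_ord filter_map.
have -> : iota 0 n = iota 0 (i.+1 + (n - i.+1)) by rewrite subnKC.
rewrite iotaD filter_cat drop_size_cat ?size_iota//.
rewrite (eq_in_filter (a2 := pred0)) ?filter_pred0 => [|k]; last first.
  by rewrite mem_iota add0n ltnS => /andP[_ ki]; rewrite ltnNge ki.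
rewrite (eq_in_filter (a2 := predT)) ?filter_predT// => k.
by rewrite mem_iota add0n => /andP[-> _].
Qed.

(** Downward induction on m, following the order in which the folds below are computed: the largest
    index first. *)
Lemma drop_enum_ind n (Q : nat -> seq 'I_n -> Prop) :
  Q n [::] -> (forall i : 'I_n, Q i.+1 (drop i.+1 (enum 'I_n)) ->
    Q i (i :: drop i.+1 (enum 'I_n))) ->
  forall m, (m <= n)%N -> Q m (drop m (enum 'I_n)).
Proof.
move=> Qn Qi m mn; rewrite -(subKn mn); elim: (n - m)%N (leq_subr m n) => [|d IH] dn.
  by rewrite subn0 drop_oversize ?size_enum_ord.
have h : (n - d.+1 < n)%N by rewrite ltn_subrL (leq_ltn_trans _ dn).
have e : (n - d.+1).+1 = (n - d)%N by rewrite subnSK.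
rewrite (drop_nth (Ordinal h)) ?size_enum_ord//.
have -> : nth (Ordinal h) (enum 'I_n) (n - d.+1) = Ordinal h.
  by apply: val_inj; rewrite /= nth_enum_ord.
by apply: (Qi (Ordinal h)); rewrite /= e; apply: IH; exact: ltnW.
Qed.

Section BlockInverse.
Variables (k : fieldType) (n : nat) (P : lmodType k) (M : 'I_n -> lmodType k).
Variables (u : forall i, {linear P -> M i}) (v : forall i, {linear M i -> P}).
Variables (Sp Sm : forall i j, {linear M j -> M i}).
Hypothesis Sp_diag : forall i x, Sp i i x = x.
Hypothesis Sp_up : forall i j : 'I_n, (i < j)%N -> forall x, Sp i j x = u i (v j x).
Hypothesis Sp_low : forall i j : 'I_n, (j < i)%N -> forall x, Sp i j x = 0.
Hypothesis Sm_diag : forall i x, Sm i i x = x - u i (v i x).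
Hypothesis Sm_low : forall i j : 'I_n, (j < i)%N -> forall x, Sm i j x = - u i (v j x).
Hypothesis Sm_up : forall i j : 'I_n, (i < j)%N -> forall x, Sm i j x = 0.

(** Entries above the diagonal factor through P, so row i sees the later components only through one
    sum in P. *)
Lemma block_upper x i :
  block Sp x i = x i + u i (\sum_(j < n | (i < j)%N) v j (x j)).
Proof.
rewrite /block (bigD1 i)//= Sp_diag linear_sum; congr (_ + _).
rewrite [LHS]big_mkcond [RHS]big_mkcond; apply: eq_bigr => j _.
case: (ltngtP i j) => [ij|ji|/val_inj ->]; last by rewrite eqxx.
  by rewrite gt_eqF//= Sp_up.
by rewrite lt_eqF//= Sp_low.
Qed.

Lemma block_lower x i :
  block Sm x i = x i - u i (\sum_(j < n | (j < i.+1)%N) v j (x j)).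
Proof.
rewrite /block (bigD1 i)//= Sm_diag -addrA; congr (_ + _).
rewrite (bigD1 (P := fun j : 'I_n => (j < i.+1)%N) i)//= linearD opprD; congr (_ + _).
rewrite linear_sum -sumrN [LHS]big_mkcond [RHS]big_mkcond; apply: eq_bigr => j _.
rewrite ltnS; case: (ltngtP i j) => [ij|ji|/val_inj ->]; last by rewrite eqxx.
  by rewrite gt_eqF//= Sm_up.
by rewrite lt_eqF//= Sm_low.
Qed.

(* Back substitution: the fold over the j > i computes the sum of the v j (x j), x
   being the solution of [block Sp x = z]. *)
Definition tail_sum (z : dfun M) (l : seq 'I_n) : P :=
  foldr (fun j y => y - v j (u j y) + v j (z j)) 0 l.

Definition block_inv (z : dfun M) : dfun M :=
  fun i => z i - u i (tail_sum z (drop i.+1 (enum 'I_n))).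

Let sum_geS (f : 'I_n -> P) (i : 'I_n) :
  \sum_(j < n | (i <= j)%N) f j = f i + \sum_(j < n | (i < j)%N) f j.
Proof.
rewrite (bigD1 i)//=; congr (_ + _); apply: eq_bigl => j.
by rewrite ltn_neqAle eq_sym andbC.
Qed.

Let sum_ltS (f : 'I_n -> P) (i : 'I_n) :
  \sum_(j < n | (j < i.+1)%N) f j = f i + \sum_(j < n | (j < i)%N) f j.
Proof.
rewrite (bigD1 i)//=; congr (_ + _); apply: eq_bigl => j.
by rewrite ltnS ltn_neqAle andbC.
Qed.

Let sum_ge_n (f : 'I_n -> P) : \sum_(j < n | (n <= j)%N) f j = 0.
Proof. by rewrite big1// => j; rewrite leqNgt ltn_ord. Qed.

(** With y the sum of the v_l x_l over l > j, the step of the fold is y - v_j u_j y + v_j (x_j + u_j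
    y) = y + v_j x_j. *)
Lemma block_invK : cancel (block Sp) block_inv.
Proof.
move=> x; apply: functional_extensionality_dep => i; rewrite /block_inv.
suff -> : tail_sum (block Sp x) (drop i.+1 (enum 'I_n)) =
    \sum_(j < n | (i < j)%N) v j (x j) by rewrite block_upper addrK.
apply: (drop_enum_ind (Q := fun m l => tail_sum (block Sp x) l =
  \sum_(j < n | (m <= j)%N) v j (x j))) => //.
move=> j IH; rewrite /= -/(tail_sum _ _) IH block_upper [RHS]sum_geS.
by rewrite linearD -addrA [X in _ + X]addrC addrK addrC.
Qed.

Lemma block_invKV : cancel block_inv (block Sp).
Proof.
move=> z; apply: functional_extensionality_dep => i; rewrite block_upper.
suff <- : tail_sum z (drop i.+1 (enum 'I_n)) =
    \sum_(j < n | (i < j)%N) v j (block_inv z j) by rewrite /block_inv subrK.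
apply: (drop_enum_ind (Q := fun m l => tail_sum z l =
  \sum_(j < n | (m <= j)%N) v j (block_inv z j))) => //.
move=> j IH; rewrite /= -/(tail_sum _ _) [RHS]sum_geS -IH /block_inv.
by rewrite linearB [RHS]addrC addrAC addrA.
Qed.

Lemma block_inv_lower x : block_inv (block Sm x) = TSigma u v x.
Proof.
apply: functional_extensionality_dep => i.
rewrite /block_inv -[RHS]/(x i - Ucol u v i (VSigma v x)) /Ucol enum_ord_gt.
pose T l := foldr (fun j z => z - v j (u j z)) (VSigma v x) l.
(* Invariant at level m: the product of the T_j with j >= m applied to V x, minus the sum of the v_j
   x_j with j < m; both terms are V x at m = n. At level i + 1 that sum cancels against row i of
   [block Sm x]. *)
have -> : tail_sum (block Sm x) (drop i.+1 (enum 'I_n)) =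
    T (drop i.+1 (enum 'I_n)) - \sum_(j < n | (j < i.+1)%N) v j (x j).
  apply: (drop_enum_ind (Q := fun m l => tail_sum (block Sm x) l =
    T l - \sum_(j < n | (j < m)%N) v j (x j))) => //.
    rewrite /= /VSigma [X in _ = _ - X](eq_bigl xpredT) ?subrr// => j.
    by rewrite ltn_ord.
  move=> j; rewrite /= -/(tail_sum _ _) -/(T _) => ->.
  (* Here a is v_j u_j t and b is v_j u_j of the sum p + w, which occurs twice and cancels. *)
  have alg (V : zmodType) (t p w a b : V) : t - (p + w) - (a - b) + (p - b) = t - a - w.
    rewrite opprB -addrA [b - a + _]addrC [p - b + _]addrA subrK opprD [t + _]addrA.
    by rewrite [LHS]addrACA subrK addrA addrAC.
  by rewrite block_lower (linearB (u j)) !(linearB (v j)) sum_ltS alg.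
by rewrite block_lower linearB opprB addrA subrK.
Qed.
End BlockInverse.

Theorem theorem5p2p2 (R : realType) (n : nat) (alpha beta : R[i])
  (c : 'I_n -> R[i])
  (alpha_neq0 : alpha != 0) (beta_neq0 : beta != 0)
  (alpha_beta : rep alpha beta = 0)
  (c_increasing : forall i j : 'I_n, (i < j)%N -> rep (c i) beta < rep (c j) beta)
  (F : cpx R[i] (plane R)) (F_flabby : flabby F) (F_perverse : perverse F (range c))
  (u : forall i, {linear Psi alpha c F -> Phi c F alpha i})
  (v : forall i, {linear Phi c F alpha i -> Psi alpha c F})
  (F_quiver : is_quiver beta u v)
  (Splus Sminus : forall i j, {linear Phi c F alpha j -> Phi c F alpha i})
  (F_stokes_plus : is_stokes beta beta Splus)
  (F_stokes_minus : is_stokes beta (- beta) Sminus) :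
  [/\ forall i x, Splus i i x = x,
      forall i j : 'I_n, (i < j)%N -> forall x, Splus i j x = u i (v j x) &
      forall i j : 'I_n, (j < i)%N -> forall x, Splus i j x = 0] /\
  [/\ forall i x, Sminus i i x = x - u i (v i x),
      forall i j : 'I_n, (j < i)%N -> forall x, Sminus i j x = - u i (v j x) &
      forall i j : 'I_n, (i < j)%N -> forall x, Sminus i j x = 0] /\
  exists2 Sinv, cancel (block Splus) Sinv /\ cancel Sinv (block Splus) &
    forall x, Sinv (block Sminus x) = TSigma u v x.
Proof.
(* The quasi-isomorphism of the restriction to the rays is part of the data of a Stokes multiplier;
   it is what makes cocycles on half-planes determined by the rays. *)
have qis b (A : forall i j, {linear Phi c F alpha j -> Phi c F alpha i}) :
    is_stokes beta b A -> quasi_iso (FSrestr c F (oray 0 b) alpha).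
  by move=> [_ [? [? [? [? [? [q _]]]]]]].
have qp := qis _ _ F_stokes_plus; have qm := qis _ _ F_stokes_minus.
have Pd : forall i x, Splus i i x = x.
  by move=> i x; apply: stokes_plus_diag F_stokes_plus.
have Pu : forall i j : 'I_n, (i < j)%N -> forall x, Splus i j x = u i (v j x).
  by move=> i j ij x; apply: stokes_plus_off F_stokes_plus ij.
have Pl : forall i j : 'I_n, (j < i)%N -> forall x, Splus i j x = 0.
  by move=> i j ji; apply: F_stokes_plus.1; exact: c_increasing.
have Md : forall i x, Sminus i i x = x - u i (v i x).
  move=> i x.
  by rewrite -[X in X - _](delta_id x); apply: stokes_minus F_stokes_minus (leqnn i).
have Ml : forall i j : 'I_n, (j < i)%N -> forall x, Sminus i j x = - u i (v j x).
  move=> i j ji x.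
  rewrite (stokes_minus alpha_neq0 beta_neq0 alpha_beta c_increasing F_flabby qp qm
    F_quiver x F_stokes_minus (ltnW ji)).
  by rewrite delta_neq ?gt_eqF// sub0r.
have Mu : forall i j : 'I_n, (i < j)%N -> forall x, Sminus i j x = 0.
  by move=> i j ij; apply: F_stokes_minus.1; rewrite !repNr ltrN2; exact: c_increasing.
split; [by split|split; [by split|]].
exists (block_inv u v); first by split; [exact: block_invK|exact: block_invKV].
by move=> x; exact: block_inv_lower.
Qed.
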